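(* Let $\alpha,\beta\in(-\tfrac12,\tfrac12)$ satisfy $\alpha_-+\beta_+<\tfrac12$. For each $n$ let $\xi_n\sim N(0,T_n(g_\beta))$ (all defined on one probability space). Then \[ \lim_{n\to\infty} n^{-1}\langle \xi_n, T_n(g_\alpha)^{-1}\xi_n\rangle=\frac1{2\pi}\int_{-\pi}^{\pi}\frac{g_\beta(t)}{g_\alpha(t)}\,dt\quad\text{almost surely.} \]
   Context: For $H\in(0,1)$ let $f_H(\lambda)=C_H|e^{i\lambda}-1|^2\sum_{k\in\mathbb Z}|\lambda-2\pi k|^{-(2H+1)}$, $\lambda\in[-\pi,\pi)$, where $C_H>0$ is the normalizing constant making $f_H$ the spectral density of fractional Gaussian noise, i.e. $\frac1{2\pi}\int_{-\pi}^{\pi}e^{-imt}f_H(t)\,dt=\mathrm{Cov}(Z_{m+1}-Z_m,Z_1-Z_0)$ for a fractional Brownian motion $Z$ with $\mathrm{Var}\,Z_t=|t|^{2H}$. For $\alpha\in(-\frac12,\frac12)$ put $g_\alpha:=f_{1/2+\alpha}$. For integrable $g$ on $[-\pi,\pi)$ write $\hat g(m)=\frac1{2\pi}\int_{-\pi}^{\pi}e^{-imt}g(t)\,dt$ and $T_n(g)=(\hat g(j-k))_{j,k=1}^n$ (Toeplitz matrix). $x_+=\max(x,0)$, $x_-=\max(-x,0)$. *)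

(* Defs.v *)
From HB Require Import structures.
From mathcomp Require Import all_boot all_order all_algebra.
From mathcomp Require Import all_classical all_reals all_analysis.
Set Implicit Arguments. Unset Strict Implicit. Unset Printing Implicit Defensive.
Import Order.TTheory GRing.Theory Num.Theory.
Import numFieldNormedType.Exports.
Local Open Scope classical_set_scope.
Local Open Scope ring_scope.

Section FGN.
Variable R : realType.

Definition Ipi : set R := [set x | - pi <= x < pi].

(* sum_{k in Z} |l - 2 pi k|^{-(2H+1)}, as the limit of symmetric partial
   sums over -N <= k <= N (a series of nonnegative terms). *)
Definition fgn_series (H l : R) : R :=
  limn (fun N : nat => \sum_(i < (2 * N).+1)
          `| l - 2 * pi * ((i%:Z - N%:Z)%:~R) | `^ (- (2 * H + 1))).

(* |e^{i l} - 1|^2 = 2 - 2 cos l, times the series *)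
Definition fgn_unnorm (H l : R) : R := (2 - 2 * cos l) * fgn_series H l.

(* The normalizing constant C_H: it is pinned down by the m = 0 case of the
   defining identity, (1/2pi) int f_H = Var(Z_1 - Z_0) = 1. *)
Definition C_H (H : R) : R :=
  2 * pi / Rintegral lebesgue_measure Ipi (fgn_unnorm H).

Definition f_H (H : R) (l : R) : R := C_H H * fgn_unnorm H l.

Definition g_ (alpha : R) : R -> R := f_H (1/2 + alpha).

(* Fourier coefficient hat g(m) = (1/2pi) int_{-pi}^{pi} e^{-imt} g(t) dt,
   real part; for even g (such as all g_alpha) the imaginary part vanishes. *)
Definition fourier_coef (g : R -> R) (m : int) : R :=
  (2 * pi)^-1 * Rintegral lebesgue_measure Ipi (fun t => cos (m%:~R * t) * g t).

Definition toeplitz (n : nat) (g : R -> R) : 'M[R]_n :=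
  \matrix_(j < n, k < n) fourier_coef g (j%:Z - k%:Z).

(* Centered Gaussian random vector with covariance S: measurable components
   and characteristic function E[exp(i u.X)] = exp(- u^T S u / 2),
   split into real and imaginary parts. *)
Definition centered_gaussian d (Om : measurableType d) (P : probability Om R)
  (n : nat) (X : Om -> 'cV[R]_n) (S : 'M[R]_n) : Prop :=
  (forall i : 'I_n, measurable_fun setT (fun w => X w i ord0)) /\
  (forall u : 'cV[R]_n,
     'E_P[fun w => cos ((u^T *m X w) ord0 ord0)]%E
       = (expR (- ((u^T *m S *m u) ord0 ord0) / 2))%:E /\
     'E_P[fun w => sin ((u^T *m X w) ord0 ord0)]%E = 0%E).

End FGN.

(* Main.v *)
(** Put A = T_n(g_alpha), B = T_n(g_beta) and q = <xi, A^-1 xi>, whose mean is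
    tr(A^-1 B).

    Fluctuations: diagonalizing A and B simultaneously, q is a sum of squares of
    independent centered Gaussians whose variances l_i satisfy sum l_i = tr(A^-1 B)
    and, by g_alpha >= c |t|^(2 alpha_-) and g_beta <= C |t|^(-2 beta_+),
    max l_i <= C n^(2 alpha_- + 2 beta_+) = C n^(1 - delta) with delta > 0.
    Chernoff's bound gives P(|q - tr(A^-1 B)| > n eps) <= C exp(- c n^delta),
    which is summable, and Borel-Cantelli applies whatever the joint law of the
    xi_n.

    Trace: n^-1 tr(A^-1 B) = (2 pi)^-1 int w_n g_beta, where
    w_n(t) = n^-1 e(t)^* A^-1 e(t) and e(t) = (exp(i j t))_j. By Cauchy-Schwarz
    1 / F_n(g_alpha) <= w_n <= F_n(1 / g_alpha) for the (symmetrized) Fejér mean F_n.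
    Both bounds tend to 1 / g_alpha off 0, and F_n |.|^-a <= C |.|^-a for
    0 <= a < 1, so dominated convergence concludes. *)
Require Import Defs.
From HB Require Import structures.
From mathcomp Require Import all_boot all_order all_algebra.
From mathcomp Require Import all_classical all_reals all_analysis.
From mathcomp Require Import measurable_realfun.
From mathcomp Require Import ring lra zify.
Set Implicit Arguments. Unset Strict Implicit. Unset Printing Implicit Defensive.
Import Order.TTheory GRing.Theory Num.Theory.
Import numFieldNormedType.Exports.
Local Open Scope classical_set_scope.
Local Open Scope ring_scope.

(** * Simultaneous diagonalization of two quadratic forms *)

Section QuadraticForms.
Variable R : realType.

Definition bform n (M : 'M[R]_n) (x y : 'cV[R]_n) : R := (x^T *m M *m y) ord0 ord0.
Definition sqn n (x : 'cV[R]_n) : R := \sum_i x i ord0 ^+ 2.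

Lemma bformDl n (M : 'M[R]_n) x y z : bform M (x + y) z = bform M x z + bform M y z.
Proof. by rewrite /bform linearD /= !mulmxDl mxE. Qed.

Lemma bformDr n (M : 'M[R]_n) x y z : bform M z (x + y) = bform M z x + bform M z y.
Proof. by rewrite /bform mulmxDr mxE. Qed.

Lemma bformZl n (M : 'M[R]_n) a x y : bform M (a *: x) y = a * bform M x y.
Proof. by rewrite /bform linearZ /= -!scalemxAl mxE. Qed.

Lemma bformZr n (M : 'M[R]_n) a x y : bform M x (a *: y) = a * bform M x y.
Proof. by rewrite /bform -!scalemxAr mxE. Qed.

Lemma bform_sym n (M : 'M[R]_n) x y : M^T = M -> bform M x y = bform M y x.
Proof.
move=> sM; rewrite /bform.
have -> : (y^T *m M *m x) = (x^T *m M *m y)^T.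
  by rewrite !trmx_mul trmxK sM mulmxA.
by rewrite [RHS]mxE.
Qed.

Lemma bformE n (M : 'M[R]_n) x y :
  bform M x y = \sum_i \sum_j x i ord0 * M i j * y j ord0.
Proof.
rewrite /bform mxE exchange_big /=; apply: eq_bigr => j _.
rewrite mxE mulr_suml; apply: eq_bigr => i _; by rewrite mxE.
Qed.

Lemma bform1 n (x : 'cV[R]_n) : bform 1%:M x x = sqn x.
Proof.
rewrite /bform mulmx1 mxE; apply: eq_bigr => i _; by rewrite mxE expr2.
Qed.

Lemma sqnE n (x : 'cV[R]_n) : sqn x = (x^T *m x) ord0 ord0.
Proof. by rewrite -bform1 /bform mulmx1. Qed.

Lemma sqn_ge0 n (x : 'cV[R]_n) : 0 <= sqn x.
Proof. by apply: sumr_ge0 => i _; rewrite sqr_ge0. Qed.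

Lemma sqn_eq0 n (x : 'cV[R]_n) : (sqn x == 0) = (x == 0).
Proof.
apply/eqP/eqP => [|->]; last first.
  by apply: big1 => i _; rewrite mxE expr0n.
move/eqP; rewrite psumr_eq0 => [/allP h|i _]; last by rewrite sqr_ge0.
apply/matrixP => i j; rewrite ord1 !mxE.
by have := h i (mem_index_enum _); rewrite sqrf_eq0 => /eqP.
Qed.

Lemma sqnZ n a (x : 'cV[R]_n) : sqn (a *: x) = a ^+ 2 * sqn x.
Proof. by rewrite -!bform1 bformZl bformZr mulrA expr2. Qed.

Lemma bform_le_sum n (M : 'M[R]_n) x :
  `|bform M x x| <= (\sum_i \sum_j `|M i j|) * sqn x.
Proof.
rewrite bformE (le_trans (ler_norm_sum _ _ _)) // mulr_suml ler_sum // => i _.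
rewrite (le_trans (ler_norm_sum _ _ _)) // mulr_suml ler_sum // => j _.
rewrite !normrM mulrAC mulrC ler_wpM2l //.
have h k : x k ord0 ^+ 2 <= sqn x.
  by rewrite /sqn (bigD1 k) //= lerDl sumr_ge0 // => l _; rewrite sqr_ge0.
have := h i; have := h j; rewrite -(real_normK (num_real (x i ord0))).
rewrite -(real_normK (num_real (x j ord0))).
have := sqr_ge0 (`|x i ord0| - `|x j ord0|).
nra.
Qed.

Lemma bform_cauchy n (M : 'M[R]_n) x y : M^T = M -> (forall z, 0 <= bform M z z) ->
  bform M x y ^+ 2 <= bform M x x * bform M y y.
Proof.
move=> sM pM.
have key (a b : R) : 0 <= a ^+ 2 * bform M x x + 2 * a * b * bform M x y + b ^+ 2 * bform M y y.
  have := pM (a *: x + b *: y).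
  rewrite !bformDl !bformDr !bformZl !bformZr (bform_sym y x sM).
  by move=> h; apply: le_trans h _; rewrite le_eqVlt; apply/orP; left; apply/eqP; ring.
have hx := pM x; have hy := pM y.
have [xx0|xx0] := eqVneq (bform M x x) 0.
  have [xy0|xy0] := eqVneq (bform M x y) 0.
    by rewrite xy0 xx0 mul0r expr0n.
  have := key (- (bform M y y + 1) / (2 * bform M x y)) 1.
  rewrite xx0 mulr0 add0r.
  have -> : 2 * (- (bform M y y + 1) / (2 * bform M x y)) * 1 * bform M x y = - (bform M y y + 1) by field.
  by rewrite expr1n mul1r => h; move: h; rewrite opprD addrAC addNr add0r oppr_ge0 ler10.
have x_gt0 : 0 < bform M x x by rewrite lt_def xx0.
have := key (- bform M x y) (bform M x x).
have -> : (- bform M x y) ^+ 2 * bform M x x + 2 * - bform M x y * bform M x x * bform M x y +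
     bform M x x ^+ 2 * bform M y y = bform M x x * (bform M x x * bform M y y - bform M x y ^+ 2) by ring.
by rewrite pmulr_rge0 // subr_ge0.
Qed.

(* If [m] is the supremum of the Rayleigh quotient and [m - S] were invertible,
   Cauchy-Schwarz for the form [m - S] would bound it below by a positive
   multiple of the identity. *)
Lemma symmetric_eigenvector n (S : 'M[R]_n.+1) : S^T = S ->
  exists (v : 'cV[R]_n.+1) (m : R), sqn v = 1 /\ S *m v = m *: v.
Proof.
move=> sS.
pose K : R := \sum_i \sum_j `|S i j|.
pose E := [set r | exists2 x : 'cV[R]_n.+1, sqn x = 1 & r = bform S x x].
have E0 : E !=set0.
  pose x : 'cV[R]_n.+1 := delta_mx ord0 ord0.
  exists (bform S x x); exists x => //.
  rewrite /sqn (bigD1 ord0) //= big1 => [|i ni]; first by rewrite mxE !eqxx expr1n addr0.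
  by rewrite mxE (negbTE ni) expr0n.
have EK : has_ubound E.
  exists K => _ [x x1 ->]; rewrite (le_trans (ler_norm _)) //.
  by have := bform_le_sum S x; rewrite x1 mulr1.
have hs : has_sup E by split.
pose m : R := sup E; pose T : 'M[R]_n.+1 := m%:M - S.
have sT : T^T = T by rewrite /T linearB /= tr_scalar_mx sS.
have TE x : bform T x x = m * sqn x - bform S x x.
  rewrite /bform /T mulmxBr mulmxBl mxE [in X in _ + X]mxE; congr (_ - _).
  by rewrite mul_mx_scalar -scalemxAl mxE -sqnE.
have hom x : x != 0 -> sqn ((Num.sqrt (sqn x))^-1 *: x) = 1.
  move=> x0; rewrite sqnZ exprVn sqr_sqrtr ?sqn_ge0 // mulVf // sqn_eq0 //.
have Tpos x : 0 <= bform T x x.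
  have [->|x0] := eqVneq x 0; first by rewrite /bform mulmx0 mxE.
  have : bform S ((Num.sqrt (sqn x))^-1 *: x) ((Num.sqrt (sqn x))^-1 *: x) <= m.
    by apply: ub_le_sup => //; exists ((Num.sqrt (sqn x))^-1 *: x) => //; apply: hom.
  rewrite bformZl bformZr mulrA -expr2 exprVn sqr_sqrtr ?sqn_ge0 //.
  have p : 0 < sqn x by rewrite lt_def sqn_eq0 x0 sqn_ge0.
  by rewrite mulrC ler_pdivrMr // TE subr_ge0.
have nT : T \notin unitmx.
  apply/negP => uT.
  pose L : R := \sum_i \sum_j `|invmx T i j| + 1.
  have L0 : 0 < L.
    by rewrite /L ltr_wpDl // sumr_ge0 // => i _; rewrite sumr_ge0.
  have lb x : sqn x = 1 -> L^-1 <= bform T x x.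
    move=> x1; have := bform_cauchy (invmx T *m x) x sT Tpos.
    have -> : bform T (invmx T *m x) x = 1.
      rewrite /bform trmx_mul trmx_inv sT -mulmxA -(mulmxA x^T) mulKmx //.
      by rewrite -sqnE x1.
    have -> : bform T (invmx T *m x) (invmx T *m x) = bform (invmx T) x x.
      by rewrite /bform trmx_mul trmx_inv sT -!mulmxA mulKVmx // mulmxA.
    rewrite expr1n => h.
    have h2 : bform (invmx T) x x <= L.
      have := bform_le_sum (invmx T) x; rewrite x1 mulr1 => h3.
      by rewrite (le_trans (ler_norm _)) // (le_trans h3) // lerDl.
    rewrite -[L^-1]mulr1 ler_pdivrMl //.
    by apply: (le_trans h); apply: ler_wpM2r.
  have Li : 0 < L^-1 by rewrite invr_gt0.
  have [_ [x x1 ->] hx] := sup_adherent Li hs.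
  by have := lb x x1; rewrite TE x1 mulr1 -/m; move: hx; rewrite -/m; lra.
have : \det T == 0 by move: nT; rewrite unitmxE unitfE negbK.
move=> /det0P [w w0 wT].
have hw : w^T != 0 by rewrite trmx_eq0.
exists ((Num.sqrt (sqn w^T))^-1 *: w^T), m; split; first exact: hom.
have : T *m w^T = 0 by rewrite -[T]sT -trmx_mul wT trmx0.
rewrite /T mulmxBl mul_scalar_mx => /eqP; rewrite subr_eq0 => /eqP e.
by rewrite -scalemxAr -e scalerA mulrC scalerA.
Qed.

Lemma householder n (v : 'cV[R]_n.+1) : sqn v = 1 ->
  exists H : 'M[R]_n.+1, [/\ H^T = H, H *m H = 1%:M & H *m v = delta_mx ord0 ord0].
Proof.
move=> v1; pose e : 'cV[R]_n.+1 := delta_mx ord0 ord0.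
pose w : 'cV[R]_n.+1 := e - v.
have [w0|w0] := eqVneq w 0.
  exists 1%:M; rewrite trmx1 mulmx1 mul1mx; split => //.
  by move/eqP: w0; rewrite subr_eq0 => /eqP <-.
have e1 : e^T *m e = 1%:M by rewrite trmx_delta mul_delta_mx; apply/matrixP => i j; rewrite !ord1 !mxE.
have vv : v^T *m v = 1%:M by apply/matrixP => i j; rewrite !ord1 -sqnE v1 mxE.
have ev : e^T *m v = (v ord0 ord0)%:M.
  by rewrite trmx_delta -rowE; apply/matrixP => i j; rewrite !ord1 !mxE.
have ve : v^T *m e = (v ord0 ord0)%:M by rewrite -[v^T *m e]trmxK trmx_mul trmxK ev tr_scalar_mx.
pose q : R := 2 - 2 * v ord0 ord0.
have wT : w^T = e^T - v^T by rewrite /w linearB.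
have ww : w^T *m w = q%:M.
  rewrite wT mulmxBl /w !mulmxBr e1 vv ev ve.
  by apply/matrixP => i j; rewrite !ord1 !mxE eqxx !mulr1n /q; ring.
have q0 : q != 0.
  have : sqn w != 0 by rewrite sqn_eq0.
  by rewrite sqnE ww mxE eqxx mulr1n.
pose c : R := 2 / q.
exists (1%:M - c *: (w *m w^T)); split.
- by rewrite linearB /= trmx1 linearZ /= trmx_mul trmxK.
- rewrite mulmxBl mul1mx mulmxBr mulmx1 -scalemxAl -scalemxAr -!mulmxA (mulmxA w^T) ww.
  rewrite mul_scalar_mx -!scalemxAr scalerA scalerA.
  have -> : c * (c * q) = 2 * c by rewrite /c; field.
  by rewrite mulrDl mul1r scalerDl opprB addrK subrK.
- rewrite mulmxBl mul1mx -scalemxAl -mulmxA.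
  have -> : w^T *m v = (v ord0 ord0 - 1)%:M.
    by rewrite wT mulmxBl ev vv; apply/matrixP => i j; rewrite !ord1 !mxE eqxx !mulr1n.
  rewrite mul_mx_scalar scalerA.
  have -> : c * (v ord0 ord0 - 1) = -1 by rewrite /c /q; field; rewrite -/q.
  by rewrite scaleN1r opprK /w addrC subrK.
Qed.

Lemma symmetric_spectral n (S : 'M[R]_n) : S^T = S ->
  exists (O : 'M[R]_n) (l : 'rV[R]_n), O *m O^T = 1%:M /\ O *m S *m O^T = diag_mx l.
Proof.
elim: n S => [|n IH] S sS.
  by exists 1%:M, 0; split; apply/matrixP => -[].
have [v [m [v1 Sv]]] := symmetric_eigenvector sS.
have [H [sH HH Hv]] := householder v1.
pose S' : 'M[R]_(1 + n) := H *m S *m H.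
have sS' : S'^T = S' by rewrite /S' !trmx_mul sH sS mulmxA.
have He : H *m delta_mx ord0 ord0 = v by rewrite -Hv mulmxA HH mul1mx.
have Se : S' *m delta_mx ord0 ord0 = m *: (delta_mx ord0 ord0 : 'cV_(1 + n)).
  by rewrite /S' -!mulmxA He Sv -scalemxAr Hv.
have S'i i : S' i ord0 = m * (i == ord0)%:R.
  have := congr1 (fun M : 'cV_(1 + n) => M i ord0) Se.
  by rewrite -colE !mxE eqxx andbT.
have S'def : S' = H *m S *m H by [].
clearbody S'.
have l0 : lshift n ord0 = ord0 :> 'I_(1 + n) by apply/val_inj.
have dl0 : dlsubmx S' = 0.
  by apply/matrixP => i j; rewrite !mxE ord1 l0 S'i mulr0.
have ur0 : ursubmx S' = 0 by rewrite -sS' -trmx_dlsub dl0 trmx0.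
have ul : ulsubmx S' = m%:M.
  by apply/matrixP => i j; rewrite !ord1 !mxE !l0 S'i eqxx mulr1 mulr1n.
pose S1 := drsubmx S'.
have [Q [l1 [OO OS]]] := IH S1 ltac:(by rewrite /S1 trmx_drsub sS').
have S'E : S' = block_mx m%:M 0 0 S1 by rewrite -[LHS]submxK dl0 ur0 ul.
pose O2 : 'M[R]_(1 + n) := block_mx 1%:M 0 0 Q.
exists (O2 *m H), (row_mx m%:M l1); split.
  rewrite trmx_mul sH -mulmxA (mulmxA H) HH mul1mx /O2 (@tr_block_mx _ 1 n 1 n) (@mulmx_block _ 1 n 1 n 1 n).
  by rewrite !trmx0 trmx1 !mulmx0 !mul0mx mulmx1 !addr0 add0r OO -scalar_mx_block.
have -> : O2 *m H *m S *m (O2 *m H)^T = O2 *m S' *m O2^T.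
  by rewrite trmx_mul sH S'def !mulmxA.
rewrite S'E /O2 (@tr_block_mx _ 1 n 1 n) !(@mulmx_block _ 1 n 1 n 1 n) !trmx0 trmx1.
rewrite !(mulmx0, mul0mx, mulmx1, mul1mx, addr0, add0r) OS.
have e := diag_mx_row (m%:M : 'rV[R]_1) l1.
apply: esym; apply: etrans e _; congr block_mx; apply/matrixP => i j; by rewrite !ord1 !mxE eqxx !mulr1n.
Qed.

Lemma simultaneous_diagonalization n (A B : 'M[R]_n) :
  A^T = A -> B^T = B -> (forall x, x != 0 -> 0 < bform A x x) ->
  exists (V : 'M[R]_n) (l : 'rV[R]_n),
    [/\ V *m A *m V^T = 1%:M, V *m B *m V^T = diag_mx l & invmx A = V^T *m V].
Proof.
move=> sA sB pA.
have [U [a [OO OA]]] := symmetric_spectral sA.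
have a0 i : 0 < a ord0 i.
  have -> : a ord0 i = bform A (U^T *m delta_mx i ord0) (U^T *m delta_mx i ord0).
    have -> (e : 'cV[R]_n) : bform A (U^T *m e) (U^T *m e) = bform (U *m A *m U^T) e e.
      by rewrite /bform trmx_mul trmxK !mulmxA.
    rewrite OA /bform trmx_delta.
    by rewrite -rowE -colE !mxE eqxx mulr1n.
  apply: pA; apply/eqP => /(congr1 (mulmx U)); rewrite mulmxA OO mul1mx mulmx0.
  by move=> /matrixP /(_ i ord0); rewrite !mxE !eqxx => /eqP; rewrite oner_eq0.
pose D : 'M[R]_n := diag_mx (\row_i (Num.sqrt (a ord0 i))^-1).
have sD : D^T = D by rewrite tr_diag_mx.
have DD : D *m diag_mx a *m D = 1%:M.
  rewrite /D !mulmx_diag; apply/matrixP => i j; rewrite !mxE.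
  have [->|//] := eqVneq i j; congr (_ *+ _).
  have p := a0 j; have q := sqr_sqrtr (ltW p).
  have s0 : Num.sqrt (a ord0 j) != 0 by rewrite gt_eqF // sqrtr_gt0.
  by rewrite -{2}q; field.
pose B' := (D *m U) *m B *m (D *m U)^T.
have [Q [l [OO2 OB]]] := @symmetric_spectral n B' ltac:(by rewrite /B' !trmx_mul !trmxK sB !mulmxA).
pose V := Q *m (D *m U).
have VA : V *m A *m V^T = 1%:M.
  have -> : V *m A *m V^T = Q *m (D *m (U *m A *m U^T) *m D) *m Q^T.
    by rewrite /V !trmx_mul sD !mulmxA.
  by rewrite OA DD mulmx1 OO2.
exists V, l; split => //.
  by rewrite -OB /B' /V !trmx_mul !mulmxA.
have uV : V \in unitmx.
  have : V *m (A *m V^T) = 1%:M by rewrite mulmxA.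
  by move/mulmx1_unit => [].
have uVT : V^T \in unitmx by rewrite unitmx_tr.
have AE : V^T *m V *m A = 1%:M.
  have e : V *m A = invmx V^T by rewrite -[LHS](mulmxK uVT) VA mul1mx.
  by rewrite -mulmxA e mulmxV.
have uA : A \in unitmx by have [] := mulmx1_unit AE.
by rewrite -[LHS]mul1mx -AE mulmxK.
Qed.

End QuadraticForms.

(** * Exponential moments of Gaussian vectors *)

Section GaussianFourier.
Variable R : realType.
Notation mu := (@lebesgue_measure R).
Variable s : R.
Hypothesis s0 : s != 0.
Let p := normal_pdf 0 s.

Lemma normal_pdf0E t : p t = normal_peak s * expR (- t ^+ 2 / (s ^+ 2 *+ 2)).
Proof. by rewrite /p normal_pdfE // /normal_fun subr0. Qed.

Lemma is_derive_normal_pdf0 (t : R) : is_derive t 1 p (- (t / s ^+ 2) * p t).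
Proof.
have -> : p = fun u => normal_peak s * expR (- u ^+ 2 / (s ^+ 2 *+ 2)).
  by apply/funext => u; exact: normal_pdf0E.
apply: is_derive_eq.
rewrite /GRing.scale /=.
by field.
Qed.

Lemma integrable_mul_normal_pdf0 : mu.-integrable setT (fun t => (t * p t)%:E).
Proof.
pose s' := Num.sqrt 2 * s.
have s'0 : s' != 0 by rewrite mulf_neq0 // gt_eqF // sqrtr_gt0.
have s'2 : s' ^+ 2 = 2 * s ^+ 2 by rewrite /s' exprMn sqr_sqrtr.
have np : 0 < normal_peak s' by apply: normal_peak_gt0.
have np1 : 0 < normal_peak s by apply: normal_peak_gt0.
apply: (@le_integrable _ _ _ mu setT measurableT _
  (fun t => (normal_peak s * `|s| / normal_peak s')%:E * (normal_pdf 0 s' t)%:E)%E).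
- apply/measurable_EFinP; apply: measurable_funM => //.
  exact: measurable_normal_pdf.
- move=> t _; rewrite -EFinM !abse_EFin lee_fin.
  rewrite normrM (ger0_norm (normal_pdf_ge0 _ _ _)) normrM (ger0_norm (normal_pdf_ge0 _ _ _)).
  rewrite [`|_ / normal_peak s'|]ger0_norm; last by rewrite divr_ge0 ?mulr_ge0 // ltW.
  rewrite -/(p t) normal_pdf0E normal_pdfE // /normal_fun subr0.
  rewrite mulrA -(mulrA (_ * _)) (mulrA _^-1) mulVf ?gt_eqF // mul1r.
  rewrite (mulrC `|t|) -2!mulrA ler_pM2l //.
  have sp : 0 < `|s| by rewrite normr_gt0.
  have -> : `|t| = `|s| * (`|t| / `|s|) by field; rewrite gt_eqF.
  rewrite -mulrA ler_pM2l //.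
  have -> : - t ^+ 2 / (s ^+ 2 *+ 2) = - t ^+ 2 / (s' ^+ 2 *+ 2) - (`|t| / `|s|) ^+ 2 / 4.
    rewrite s'2 expr_div_n !real_normK ?num_real //; field; exact: s0.
  rewrite expRD mulrCA ler_piMr ?expR_ge0 //.
  set y := `|t| / `|s|; rewrite expRN ler_pdivrMr ?expR_gt0 // mul1r.
  apply: le_trans (expR_ge1Dx _).
  have := sqr_ge0 (y / 2 - 1); nra.
- apply: integrableZl => //; exact: integrable_normal_pdf.
Qed.

Lemma integrable_bounded_normal_pdf (h : R -> R) (C : R) :
  measurable_fun setT h -> (forall t, `|h t| <= C) ->
  mu.-integrable setT (fun t => (h t * p t)%:E).
Proof.
move=> mh hC.
apply: (@le_integrable _ _ _ mu setT measurableT _ (fun t => C%:E * (normal_pdf 0 s t)%:E)%E).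
- apply/measurable_EFinP; apply: measurable_funM => //; exact: measurable_normal_pdf.
- move=> t _; rewrite -EFinM !abse_EFin lee_fin !normrM ler_wpM2r //.
  by rewrite (le_trans (hC t)) // ler_norm.
- apply: integrableZl => //; exact: integrable_normal_pdf.
Qed.

Lemma cvg_integral_itv_sym (h : R -> R) : mu.-integrable setT (EFin \o h) ->
  (fun n : nat => \int[mu]_(x in `[- n%:R, n%:R]) h x) @ \oo --> \int[mu]_x h x.
Proof.
move=> ih.
have mh : measurable_fun setT h by case/integrableP: ih => /measurable_EFinP.
have [ih1 _ c] := @dominated_convergence _ _ R mu setT measurableT
  (fun n : nat => (fun x => (h x * \1_(`[- n%:R, n%:R]) x)%:E)) (EFin \o h)
  (fun x => `|(h x)%:E|%E)
  ltac:(by move=> n; apply/measurable_EFinP; apply: measurable_funM => //;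
     apply: measurable_indic)
  ltac:(by apply/measurable_EFinP)
  ltac:(apply: aeW => /= x _; apply: cvg_near_cst;
     exists (Num.truncn `|x|).+1 => // n /= hn;
     rewrite indicE mem_set ?mulr1 //= in_itv /= -ler_norml;
     apply: ltW; apply: lt_le_trans (truncnS_gt _) _; by rewrite ler_nat)
  ltac:(by apply: integrable_abse)
  ltac:(apply: aeW => /= x n _; rewrite -abse_EFin /= lee_fin normrM ler_piMr //;
     rewrite indicE; case: (_ \in _); by rewrite ?normr1 ?normr0).
have := fine_cvg (_ : _ --> (fine (\int[mu]_x (h x)%:E))%:E).
rewrite fineK; last exact: integrable_fin_num.
move=> /(_ _ _ _ _ c); rewrite /Rintegral.
apply: cvg_trans; apply: near_eq_cvg; near=> n => /=.
congr fine; rewrite [RHS]integral_mkcond; apply: eq_integral => x _.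
rewrite /= patchE indicE; case: ifP => /=; by rewrite ?mulr1 ?mulr0.
Unshelve. all: by end_near. Qed.

Definition gcos (x : R) : R := \int[mu]_t (cos (t * x) * p t).

Lemma continuous_cosM x : continuous (fun t : R => cos (t * x)).
Proof.
move=> t; apply: continuous_comp; last exact: continuous_cos.
by apply: cvgMr_tmp; exact: cvg_id.
Qed.

Lemma continuous_sinM x : continuous (fun t : R => sin (t * x)).
Proof.
move=> t; apply: continuous_comp; last exact: continuous_sin.
by apply: cvgMr_tmp; exact: cvg_id.
Qed.

Lemma measurable_cosM x : measurable_fun setT (fun t : R => cos (t * x)).
Proof.
apply: continuous_measurable_fun; exact: continuous_cosM.
Qed.

Lemma measurable_sinM x : measurable_fun setT (fun t : R => sin (t * x)).
Proof.
apply: continuous_measurable_fun; exact: continuous_sinM.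
Qed.

Lemma norm_cos_le1 (x : R) : `|cos x| <= 1.
Proof. by rewrite ler_norml cos_geN1 cos_le1. Qed.
Lemma norm_sin_le1 (x : R) : `|sin x| <= 1.
Proof. by rewrite ler_norml sin_geN1 sin_le1. Qed.

Lemma integrable_cos_normal_pdf0 x : mu.-integrable setT (fun t => (cos (t * x) * p t)%:E).
Proof.
apply: (@integrable_bounded_normal_pdf _ 1); first exact: measurable_cosM.
by move=> t; exact: norm_cos_le1.
Qed.

Lemma integrable_sinM_normal_pdf0 x : mu.-integrable setT (fun t => (t * sin (t * x) * p t)%:E).
Proof.
apply: (@le_integrable _ _ _ mu setT measurableT _ _ _ _ integrable_mul_normal_pdf0).
- apply/measurable_EFinP; apply: measurable_funM => //; last exact: measurable_normal_pdf.
  apply: measurable_funM => //; exact: measurable_sinM.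
- move=> t _; rewrite !abse_EFin lee_fin !normrM ler_wpM2r // ler_piMr //.
  exact: norm_sin_le1.
Qed.

Lemma cvg_normal_pdf0 : (fun n : nat => p n%:R) @ \oo --> (0 : R).
Proof.
apply: (@squeeze_cvgr _ _ _ _ (fun=> 0) (fun n : nat => (normal_peak s * (s ^+ 2 *+ 2)) * n%:R^-1)).
- near=> n; rewrite normal_pdf_ge0 /= normal_pdf0E -mulrA ler_pM2l ?normal_peak_gt0 //.
  have n0 : (0 : R) < n%:R by rewrite ltr0n; near: n; exact: nbhs_infty_gt.
  have s2 : 0 < s ^+ 2 *+ 2 by rewrite pmulrn_lgt0 // exprn_even_gt0.
  rewrite mulNr expRN invf_ple ?posrE ?expR_gt0 ?mulr_gt0 ?invr_gt0 //.
  rewrite invfM invrK; apply: le_trans (expR_ge1Dx _).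
  rewrite -[leLHS]add0r lerD // mulrC ler_wpM2r ?invr_ge0 ?ltW //.
  rewrite expr2 -[ltLHS]mulr1 ltr_pM2l // ltr1n; near: n; exact: nbhs_infty_gt.
- exact: cvg_cst.
- rewrite -[X in _ --> X](mulr0 (normal_peak s * (s ^+ 2 *+ 2))); apply: cvgMl_tmp.
  apply/cvgrPdist_le => e e0; near=> n.
  rewrite sub0r normrN ger0_norm ?invr_ge0 // -[e]invrK lef_pV2 ?posrE ?invr_gt0 //.
    apply: le_trans (ltW (truncnS_gt _)) _; rewrite ler_nat; near: n.
    exact: nbhs_infty_ge.
  by rewrite ltr0n; near: n; exact: nbhs_infty_gt.
Unshelve. all: by end_near. Qed.

Lemma gcos_ibp x : \int[mu]_t (t * sin (t * x) * p t) = s ^+ 2 * x * gcos x.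
Proof.
have ic := integrable_cos_normal_pdf0 x.
have isn := integrable_sinM_normal_pdf0 x.
pose h t := x * (cos (t * x) * p t) - (s ^+ 2)^-1 * (t * sin (t * x) * p t).
have ih : mu.-integrable setT (EFin \o h).
  have -> : EFin \o h = ((fun t => x%:E * (cos (t * x) * p t)%:E) \- (fun t => ((s ^+ 2)^-1)%:E * (t * sin (t * x) * p t)%:E))%E.
    by apply/funext => t.
  by apply: integrableB => //; apply: integrableZl.
pose F t := sin (t * x) * p t.
have dF (t : R) : is_derive t 1 F (h t).
  have := is_derive_normal_pdf0 t => dp.
  apply: is_derive_eq; rewrite /h /GRing.scale /=; by ring.
have pc : continuous p by apply: continuous_normal_pdf.
have ch : continuous h.
  move=> t; apply: cvgB.
    apply: cvgMl_tmp; apply: cvgM; last exact: pc.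
    exact: continuous_cosM.
  apply: cvgMl_tmp; apply: cvgM; last exact: pc.
  apply: cvgM; first exact: cvg_id.
  exact: continuous_sinM.
have cF : continuous F.
  by move=> t; apply: differentiable_continuous; apply/derivable1_diffP; case: (dF t).
have h0 : \int[mu]_t h t = 0.
  apply: (@cvg_unique _ _ _ _ _ _ (cvg_integral_itv_sym ih)) => //.
  have : (fun n : nat => sin (n%:R * x) * 2 * p n%:R) @ \oo --> (0 : R).
    apply: (@squeeze_cvgr _ _ _ _ (fun n => - (2 * p n%:R)) (fun n : nat => 2 * p n%:R)).
    - near=> n; rewrite -ler_norml !normrM (ger0_norm (normal_pdf_ge0 _ _ _)).
      rewrite ler_wpM2r ?normal_pdf_ge0 // normr_nat ler_piMl //; exact: norm_sin_le1.
    - rewrite -[X in _ --> X]oppr0 -[X in _ --> - X](mulr0 2); apply: cvgN; apply: cvgMl_tmp.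
      exact: cvg_normal_pdf0.
    - rewrite -[X in _ --> X](mulr0 2); apply: cvgMl_tmp; exact: cvg_normal_pdf0.
  apply: cvg_trans; apply: near_eq_cvg; near=> n.
  have n0 : (0 : R) < n%:R by rewrite ltr0n; near: n; exact: nbhs_infty_gt.
  rewrite /Rintegral (@continuous_FTC2 _ h F) ?gtrN //=.
  - rewrite /F mulNr sinN !normal_pdf0E sqrrN; ring.
  - by apply: continuous_subspaceT.
  - split.
    + by move=> t _; case: (dF t).
    + by apply: cvg_at_right_filter; exact: cF.
    + by apply: cvg_at_left_filter; exact: cF.
  - by move=> t _; rewrite derive1E; case: (dF t).
move: h0; rewrite /h RintegralB //; last 2 first.
- by apply: (integrableZl measurableT _ ic).
- by apply: (integrableZl measurableT _ isn).
rewrite !RintegralZl // => /eqP; rewrite subr_eq0 => /eqP h0.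
have s20 : s ^+ 2 != 0 by rewrite expf_neq0.
by rewrite -mulrA /gcos h0 mulVKf.
Unshelve. all: by end_near. Qed.

Lemma is_derive_gcos (x : R) : is_derive x 1 gcos (- (s ^+ 2 * x) * gcos x).
Proof.
pose f x t := cos (t * x) * p t.
have d1 (y t : R) : is_derive y 1 (f ^~ t) (- (t * sin (t * y) * p t)).
  apply: is_derive_eq; rewrite /GRing.scale /=; ring.
have c := @cvg_differentiation_under_integral R _ _ mu f setT measurableT x (x - 1) (x + 1)
  ltac:(by rewrite /= in_itv /= ltrDl ltr01 gtrDl oppr_lt0 ltr01)
  ltac:(by move=> y _; exact: integrable_cos_normal_pdf0)
  ltac:(by move=> y t _ _; case: (d1 y t))
  (fun t => `|t * p t|) ltac:(by move=> t; exact: normr_ge0)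
  ltac:(by apply: (integrable_abse integrable_mul_normal_pdf0))
  ltac:(move=> y t _ _; rewrite partial1of2E; have [_ ->] := d1 y t;
   rewrite normrN !normrM ler_wpM2r // ler_piMr //; exact: norm_sin_le1).
have e : \int[mu]_t partial1of2 f x t = - (s ^+ 2 * x) * gcos x.
  rewrite mulNr -gcos_ibp.
  have -> : \int[mu]_t partial1of2 f x t = \int[mu]_t (-1 * (t * sin (t * x) * p t)).
    by apply: eq_Rintegral => t _; rewrite partial1of2E; have [_ ->] := d1 x t; rewrite mulN1r.
  by rewrite RintegralZl ?mulN1r //; exact: integrable_sinM_normal_pdf0.
rewrite e in c.
apply: DeriveDef.
  apply/cvg_ex; exists (- (s ^+ 2 * x) * gcos x).
  by under eq_fun do rewrite /GRing.scale /= mulr1.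
apply/cvg_lim => //.
by under eq_fun do rewrite /GRing.scale /= mulr1.
Qed.

Lemma gcosE x : gcos x = expR (- (s ^+ 2 * x ^+ 2) / 2).
Proof.
pose G y := gcos y * expR (s ^+ 2 * y ^+ 2 / 2).
have dG (y : R) : is_derive y 1 G 0.
  have := is_derive_gcos y => dg.
  apply: is_derive_eq; rewrite /GRing.scale /=; by field.
have := is_derive_0_is_cst x 0 dG.
rewrite /G expr0n /= !(mulr0, mul0r) expR0 mulr1.
have -> : gcos 0 = 1.
  rewrite /gcos /Rintegral; under eq_integral do rewrite mulr0 cos0 mul1r.
  by rewrite integral_normal_pdf.
move=> e; rewrite mulNr expRN -[LHS]mulr1 -[X in _ * X = _](mulfV (x := expR (s ^+ 2 * x ^+ 2 / 2))) ?gt_eqF ?expR_gt0 //.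
by rewrite mulrA e mul1r.
Qed.

End GaussianFourier.

Section GaussianMoments.
Variable R : realType.
Notation mu := (@lebesgue_measure R).

Lemma measurable_cos : measurable_fun setT (@cos R).
Proof. by apply: continuous_measurable_fun; exact: continuous_cos. Qed.

Lemma measurable_sin : measurable_fun setT (@sin R).
Proof. by apply: continuous_measurable_fun; exact: continuous_sin. Qed.

Lemma normal_peakE (s : R) : 0 < s -> normal_peak s = s^-1 * normal_peak 1.
Proof.
move=> s0; rewrite /normal_peak expr1n mul1r -mulrnAr sqrtrM ?sqr_ge0 //.
by rewrite sqrtr_sqr gtr0_norm // invfM.
Qed.

Lemma normal_pdf_scale (s v t : R) : 0 < s -> 0 < 1 + s ^+ 2 * v ->
  expR (- (t ^+ 2 * v) / 2) * normal_pdf 0 s t =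
  (Num.sqrt (1 + s ^+ 2 * v))^-1 * normal_pdf 0 (s / Num.sqrt (1 + s ^+ 2 * v)) t.
Proof.
move=> s0 v0; set q := Num.sqrt _.
have q0 : 0 < q by rewrite sqrtr_gt0.
have q2 : q ^+ 2 = 1 + s ^+ 2 * v by rewrite sqr_sqrtr // ltW.
have sq0 : 0 < s / q by rewrite divr_gt0.
rewrite !normal_pdf0E ?gt_eqF // (normal_peakE s0) (normal_peakE sq0).
have -> : - t ^+ 2 / ((s / q) ^+ 2 *+ 2) = - (t ^+ 2 * v) / 2 + - t ^+ 2 / (s ^+ 2 *+ 2).
  rewrite expr_div_n q2; field.
  by rewrite gt_eqF //= gt_eqF.
rewrite expRD; field.
by rewrite !gt_eqF.
Qed.

Lemma integral_expR_normal_pdf (s z : R) : 0 < s ->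
  (\int[mu]_t (expR (t * z) * normal_pdf 0 s t)%:E = (expR (s ^+ 2 * z ^+ 2 / 2))%:E)%E.
Proof.
move=> s0.
have e t : expR (t * z) * normal_pdf 0 s t = expR (s ^+ 2 * z ^+ 2 / 2) * normal_pdf (s ^+ 2 * z) s t.
  rewrite !normal_pdfE ?gt_eqF // /normal_fun subr0 mulrCA [RHS]mulrCA -!expRD.
  by congr (_ * expR _); field; rewrite gt_eqF.
under eq_integral do rewrite e EFinM.
rewrite integralZl //; last exact: integrable_normal_pdf.
by rewrite integral_normal_pdf mule1.
Qed.

Lemma Rintegral_EFin d (T : measurableType d) (m : {measure set T -> \bar R}) (f : T -> R) :
  m.-integrable setT (EFin \o f) -> ((\int[m]_x f x)%:E = \int[m]_x (f x)%:E)%E.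
Proof. by move=> i; rewrite /Rintegral fineK // integrable_fin_num. Qed.

Lemma RintegralE d (T : measurableType d) (m : {measure set T -> \bar R}) D (f : T -> R) r :
  (\int[m]_(x in D) (f x)%:E = r%:E)%E -> \int[m]_(x in D) f x = r.
Proof. by rewrite /Rintegral => ->. Qed.

Section Prob.
Context d (Om : measurableType d) (P : probability Om R).

Lemma integrable_bounded_prob (f : Om -> R) (C : R) : measurable_fun setT f ->
  (forall w, `|f w| <= C) -> P.-integrable setT (EFin \o f).
Proof.
move=> mf fC; apply: (@le_integrable _ _ _ P setT measurableT _ (cst C%:E)).
- exact/measurable_EFinP.
- by move=> w _ /=; rewrite lee_fin (le_trans (fC w)) // ler_norm.
- apply/integrableP; split => //.
  by rewrite integral_cst //= probability_setT mule1 ltry.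
Qed.

Lemma Fubini_bounded (s : R) (k : Om * R -> R) : s != 0 ->
  measurable_fun setT k -> (forall x, `|k x| <= 1) ->
  \int[P]_w (\int[mu]_t (k (w, t) * normal_pdf 0 s t)) =
  \int[mu]_t ((\int[P]_w k (w, t)) * normal_pdf 0 s t).
Proof.
move=> s0 mk k1.
have mp : measurable_fun setT (fun x : Om * R => normal_pdf 0 s x.2).
  by apply: measurableT_comp => //; exact: measurable_normal_pdf.
pose f (x : Om * R) := (k x * normal_pdf 0 s x.2)%:E.
have mf : measurable_fun setT f.
  by apply/measurable_EFinP; apply: measurable_funM.
have kw w : measurable_fun setT (fun t => k (w, t)).
  by apply: measurableT_comp => //; exact: pair1_measurable.
have kt t : measurable_fun setT (fun w => k (w, t)).
  by apply: measurableT_comp => //; exact: pair2_measurable.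
have int_f : (P \x mu)%E.-integrable setT f.
  apply/(integrable12ltyP P mu mf).
  apply: (@le_lt_trans _ _ (\int[P]_w (cst 1 w))%E).
    apply: ge0_le_integral => //.
    - by move=> w _; apply: integral_ge0.
    - apply: (@measurable_fun_fubini_tonelli_F _ _ _ _ _ mu (fun x => `|f x|%E)) => //; exact: measurableT_comp.
    - move=> w _ /=; rewrite -(integral_normal_pdf 0 s); apply: ge0_le_integral => //.
      + apply/measurable_EFinP; apply: measurableT_comp => //.
        by apply: measurable_funM; [exact: kw|exact: measurable_normal_pdf].
      + by apply/measurable_EFinP; exact: measurable_normal_pdf.
      + move=> t _; rewrite /f /= lee_fin normrM (ger0_norm (normal_pdf_ge0 _ _ _)).
        by rewrite ler_piMl // normal_pdf_ge0.
  by rewrite integral_cst //= probability_setT mule1 ltry.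
have := Fubini int_f => F.
rewrite /Rintegral; congr fine; transitivity (\int[P]_x \int[mu]_y f (x, y))%E.
  apply: eq_integral => w _; rewrite Rintegral_EFin //.
  exact: (integrable_bounded_normal_pdf s (kw w) (fun t => k1 (w, t))).
rewrite F; apply: eq_integral => t _ /=.
rewrite /f /= ; under eq_integral do rewrite EFinM.
rewrite integralZr //; last exact: (@integrable_bounded_prob _ 1).
by rewrite EFinM Rintegral_EFin //; exact: (@integrable_bounded_prob _ 1).
Qed.

Lemma Rintegral_pdf_scale (s v c : R) (h : R -> R) : 0 < s -> 0 < 1 + s ^+ 2 * v ->
  measurable_fun setT h -> (forall t, `|h t| <= 1) ->
  \int[mu]_t (h t * (c * expR (- (t ^+ 2 * v) / 2)) * normal_pdf 0 s t) =
  c * (Num.sqrt (1 + s ^+ 2 * v))^-1 *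
    \int[mu]_t (h t * normal_pdf 0 (s / Num.sqrt (1 + s ^+ 2 * v)) t).
Proof.
move=> s0 v0 mh h1; set q := Num.sqrt _.
have q0 : 0 < q by rewrite sqrtr_gt0.
rewrite -RintegralZl //; last first.
  exact: (integrable_bounded_normal_pdf (s / q) mh h1).
apply: eq_Rintegral => t _.
have := normal_pdf_scale t s0 v0; rewrite -/q.
move: (normal_pdf 0 s t) (normal_pdf 0 (s / q) t) (expR _) => a b E e.
by rewrite -mulrA -[X in h t * X]mulrA e; ring.
Qed.

(* [expR (- (s * y) ^+ 2 / 2)] is the characteristic function of N(0, s^2) at [y]:
   integrating the hypothesis in [u n] against N(0, s^2) trades one linear phase
   for one square. *)
Lemma laplace_sum_squares (s : R) (z : nat -> Om -> R) (l : nat -> R) : 0 < s ->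
  (forall i, measurable_fun setT (z i)) -> (forall i, 0 <= l i) ->
  forall n (w : Om -> R) c, measurable_fun setT w -> (forall x, `|w x| <= 1) ->
  (forall u : nat -> R, \int[P]_x (w x * cos (\sum_(i < n) u i * z i x)) =
     c * expR (- (\sum_(i < n) u i ^+ 2 * l i) / 2)) ->
  \int[P]_x (w x * expR (- (s ^+ 2 * \sum_(i < n) z i x ^+ 2) / 2)) =
    c * \prod_(i < n) (Num.sqrt (1 + s ^+ 2 * l i))^-1.
Proof.
move=> s0 mz l0; elim=> [|n IH] w c mw w1 H.
  have := H (fun=> 0); rewrite !big_ord0.
  under eq_Rintegral do rewrite !big_ord0 cos0.
  rewrite oppr0 mul0r expR0 => <-.
  by apply: eq_Rintegral => x _; rewrite big_ord0 mulr0 oppr0 mul0r expR0.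
rewrite big_ord_recr /= mulrCA mulrC -mulrA.
pose w' x := w x * expR (- (s ^+ 2 * z n x ^+ 2) / 2).
have mw' : measurable_fun setT w'.
  apply: measurable_funM => //; apply: measurableT_comp => //.
  apply: measurable_funM => //; apply: measurableT_comp => //.
  by apply: measurable_funM => //; apply: measurable_funX.
have e1 x : expR (- (s ^+ 2 * z n x ^+ 2) / 2) <= 1.
  by rewrite expR_le1 mulNr oppr_le0 divr_ge0 // mulr_ge0 // sqr_ge0.
have w'1 x : `|w' x| <= 1.
  rewrite normrM (ger0_norm (expR_ge0 _)) -[leRHS]mulr1 ler_pM //.
transitivity (\int[P]_x (w' x * expR (- (s ^+ 2 * \sum_(i < n) z i x ^+ 2) / 2))).
  apply: eq_Rintegral => x _; rewrite /w' -mulrA -expRD big_ord_recr /=.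
  by congr (_ * expR _); ring.
rewrite (IH w' (c * (Num.sqrt (1 + s ^+ 2 * l n))^-1)) //; first by ring.
move=> u.
pose W x := \sum_(i < n) u i * z i x.
have mW : measurable_fun setT W.
  by apply: measurable_sum => i; apply: measurable_funM.
have mcW : measurable_fun setT (fun x => cos (W x)) by apply: measurableT_comp => //; exact: measurable_cos.
pose k (x : Om * R) := w x.1 * cos (W x.1) * cos (x.2 * z n x.1).
have mk : measurable_fun setT k.
  apply: measurable_funM; first exact: (measurableT_comp (measurable_funM mw mcW) measurable_fst).
  apply: measurableT_comp; first exact: measurable_cos.
  apply: measurable_funM => //; exact: measurableT_comp.
have k1 x : `|k x| <= 1.
  rewrite /k !normrM -[leRHS]mulr1 ler_pM ?norm_cos_le1 // -[leRHS]mulr1 ler_pM ?norm_cos_le1 //.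
have sn0 : s != 0 by rewrite gt_eqF.
have := Fubini_bounded sn0 mk k1; rewrite /k /=.
have -> : \int[P]_x (\int[mu]_t (w x * cos (W x) * cos (t * z n x) * normal_pdf 0 s t)) =
   \int[P]_x (w' x * cos (W x)).
  apply: eq_Rintegral => x _.
  under eq_Rintegral do rewrite -mulrA.
  rewrite RintegralZl //; last exact: integrable_cos_normal_pdf0.
  have := gcosE sn0 (z n x); rewrite /gcos => ->; rewrite /w'; ring.
move=> ->.
set E := expR (- (\sum_(i < n) _) / 2).
transitivity (\int[mu]_t (1 * (c * E * expR (- (t ^+ 2 * l n) / 2)) * normal_pdf 0 s t)).
  apply: eq_Rintegral => t _; congr (_ * _); rewrite mul1r.
  have Hu (b : R) : \int[P]_x (w x * cos (W x + b * z n x)) = c * E * expR (- (b ^+ 2 * l n) / 2).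
    have := H (fun i => if i == n then b else u i).
    rewrite big_ord_recr /= eqxx.
    have -> : \sum_(i < n) (if i == n :> nat then b else u i) ^+ 2 * l i = \sum_(i < n) u i ^+ 2 * l i.
      by apply: eq_bigr => i _; rewrite ltn_eqF.
    rewrite opprD mulrDl expRD mulrA => <-.
    apply: eq_Rintegral => x _; congr (_ * cos _); rewrite big_ord_recr /= eqxx; congr (_ + _).
    by apply: eq_bigr => i _; rewrite ltn_eqF.
  have ib (b : R) : P.-integrable setT (EFin \o (fun x => w x * cos (W x + b * z n x))).
    apply: (@integrable_bounded_prob _ 1).
      apply: measurable_funM => //; apply: measurableT_comp; first exact: measurable_cos.
      by apply: measurable_funD => //; apply: measurable_funM.
    by move=> x; rewrite normrM -[leRHS]mulr1 ler_pM ?norm_cos_le1.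
  transitivity (\int[P]_x (2^-1 * (w x * cos (W x + t * z n x)) + 2^-1 * (w x * cos (W x + (- t) * z n x)))).
    apply: eq_Rintegral => x _; rewrite mulNr cosB cosD; by field.
  rewrite RintegralD //; [|exact: (integrableZl measurableT 2^-1 (ib t)) | exact: (integrableZl measurableT 2^-1 (ib (- t)))].
  rewrite !RintegralZl // !Hu sqrrN; by field.
have vl : 0 < 1 + s ^+ 2 * l n by rewrite ltr_pwDl // mulr_ge0 // sqr_ge0.
have n1 (t : R) : `|cst (1 : R) t| <= 1 by rewrite normr1.
apply: etrans (Rintegral_pdf_scale (c * E) s0 vl (measurable_cst (1 : R)) n1) _.
rewrite [X in _ * X](_ : _ = 1); first by ring.
apply: RintegralE; under eq_integral do rewrite mul1r.
exact: integral_normal_pdf.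
Qed.

Lemma mgf_sum_squares (s : R) (z : nat -> Om -> R) (l : nat -> R) : 0 < s ->
  (forall i, measurable_fun setT (z i)) -> (forall i, s ^+ 2 * l i < 1) ->
  forall n (w : Om -> R) c, measurable_fun setT w -> (forall x, 0 <= w x) ->
  (forall u : nat -> R, (\int[P]_x (w x * expR (\sum_(i < n) u i * z i x))%:E =
     (c * expR ((\sum_(i < n) u i ^+ 2 * l i) / 2))%:E)%E) ->
  (\int[P]_x (w x * expR (s ^+ 2 * (\sum_(i < n) z i x ^+ 2) / 2))%:E =
    (c * \prod_(i < n) (Num.sqrt (1 - s ^+ 2 * l i))^-1)%:E)%E.
Proof.
move=> s0 mz l0; elim=> [|n IH] w c mw w1 H.
  have := H (fun=> 0); rewrite !big_ord0.
  under eq_integral do rewrite !big_ord0.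
  rewrite mul0r expR0 => <-.
  by apply: eq_integral => x _; rewrite big_ord0 mulr0 mul0r expR0.
rewrite big_ord_recr /= mulrCA mulrC -mulrA.
pose w' x := w x * expR (s ^+ 2 * z n x ^+ 2 / 2).
have mw' : measurable_fun setT w'.
  apply: measurable_funM => //; apply: measurableT_comp => //.
  apply: measurable_funM => //; apply: measurable_funM => //.
  by apply: measurable_funX.
have w'1 x : 0 <= w' x by rewrite mulr_ge0 // expR_ge0.
transitivity (\int[P]_x (w' x * expR (s ^+ 2 * (\sum_(i < n) z i x ^+ 2) / 2))%:E)%E.
  apply: eq_integral => x _; rewrite /w' -[in RHS]mulrA -expRD big_ord_recr /=.
  by congr (_ * expR _)%:E; ring.
rewrite (IH w' (c * (Num.sqrt (1 - s ^+ 2 * l n))^-1)) //; first by congr EFin; ring.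
move=> u.
pose W x := \sum_(i < n) u i * z i x.
have mW : measurable_fun setT W.
  by apply: measurable_sum => i; apply: measurable_funM.
pose k (x : Om * R) := (w x.1 * expR (W x.1) * (expR (x.2 * z n x.1) * normal_pdf 0 s x.2))%:E.
have mk : measurable_fun setT k.
  apply/measurable_EFinP; apply: measurable_funM.
    have h : measurable_fun setT (fun x => w x * expR (W x)).
      by apply: measurable_funM => //; exact: measurableT_comp.
    exact: (measurableT_comp h measurable_fst).
  apply: measurable_funM; last by apply: measurableT_comp => //; exact: measurable_normal_pdf.
  apply: measurableT_comp => //; apply: measurable_funM => //; exact: measurableT_comp.
have k0 x : (0 <= k x)%E.
  by rewrite lee_fin !mulr_ge0 ?expR_ge0 ?normal_pdf_ge0.
have := @fubini_tonelli _ _ _ _ _ P mu k mk k0; rewrite /k /=.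
have -> : (\int[P]_x (\int[mu]_t (w x * expR (W x) * (expR (t * z n x) * normal_pdf 0 s t))%:E) =
   \int[P]_x (w' x * expR (W x))%:E)%E.
  apply: eq_integral => x _.
  under eq_integral do rewrite EFinM.
  rewrite ge0_integralZl //.
  - by rewrite integral_expR_normal_pdf // -EFinM /w'; congr EFin; ring.
  - apply/measurable_EFinP; apply: measurable_funM; last exact: measurable_normal_pdf.
    apply: measurableT_comp => //; exact: measurable_funM.
  - by move=> t _; rewrite lee_fin mulr_ge0 ?expR_ge0 ?normal_pdf_ge0.
  - by rewrite lee_fin mulr_ge0 ?expR_ge0.
move=> ->.
set E := expR ((\sum_(i < n) _) / 2).
have v0 : 0 < 1 + s ^+ 2 * - l n by rewrite mulrN subr_gt0.
set q := Num.sqrt (1 - _).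
have q0 : 0 < q by rewrite sqrtr_gt0 subr_gt0.
have c0 : 0 <= c.
  have := H (fun=> 0); rewrite [X in expR (X / 2)]big1; last by move=> i _; rewrite expr0n mul0r.
  rewrite mul0r expR0 mulr1 -lee_fin => <-; apply: integral_ge0 => x _.
  by rewrite lee_fin mulr_ge0 ?expR_ge0.
transitivity (\int[mu]_t ((c * E * q^-1)%:E * (normal_pdf 0 (s / q) t)%:E))%E.
  apply: eq_integral => t _.
  have := normal_pdf_scale t s0 v0; rewrite !mulrN opprK -/q => e.
  have := H (fun i => if i == n then t else u i).
  rewrite big_ord_recr /= eqxx.
  have -> : \sum_(i < n) (if i == n :> nat then t else u i) ^+ 2 * l i = \sum_(i < n) u i ^+ 2 * l i.
    by apply: eq_bigr => i _; rewrite ltn_eqF.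
  rewrite mulrDl expRD mulrA -/E => Hu.
  have e2 : c * E / q * normal_pdf 0 (s / q) t = c * E * expR (t ^+ 2 * l n / 2) * normal_pdf 0 s t.
    by rewrite -[RHS]mulrA e mulrA.
  rewrite -EFinM e2 [in RHS]EFinM -Hu -ge0_integralZr //.
  - apply: eq_integral => x _; rewrite -EFinM; congr EFin.
    rewrite big_ord_recr /= eqxx expRD.
    have -> : \sum_(i < n) (if i == n :> nat then t else u i) * z i x = W x.
      by apply: eq_bigr => i _; rewrite ltn_eqF.
    by ring.
  - apply/measurable_EFinP; apply: measurable_funM => //; apply: measurableT_comp => //.
    by apply: measurable_sum => i; apply: measurable_funM.
  - by move=> x _; rewrite lee_fin mulr_ge0 ?expR_ge0.
  - by rewrite lee_fin normal_pdf_ge0.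
rewrite integralZl //; last exact: integrable_normal_pdf.
rewrite integral_normal_pdf mule1; congr EFin; ring.
Qed.

(* Averaging the characteristic function of [y - X] against N(0, 1) determines
   [E (expR (- (y - X) ^+ 2 / 2))] for all [y]; integrating this against [expR y]
   then yields [E (expR X)] by Tonelli. *)
Lemma gaussian_mgf (X : Om -> R) (v : R) : 0 <= v -> measurable_fun setT X ->
  (forall t, \int[P]_x cos (t * X x) = expR (- (t ^+ 2 * v) / 2)) ->
  (forall t, \int[P]_x sin (t * X x) = 0) ->
  (\int[P]_x (expR (X x))%:E = (expR (v / 2))%:E)%E.
Proof.
move=> v0 mX Hc Hs.
pose q := Num.sqrt (1 + v).
have q2 : q ^+ 2 = 1 + v by rewrite sqr_sqrtr // addr_ge0.
have q0 : 0 < q by rewrite sqrtr_gt0 ltr_pwDl.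
have step1 y : \int[P]_x expR (- (y - X x) ^+ 2 / 2) = q^-1 * expR (- (y / q) ^+ 2 / 2).
  pose k (x : Om * R) := cos (x.2 * (y - X x.1)).
  have mk : measurable_fun setT k.
    apply: measurableT_comp; first exact: measurable_cos.
    apply: measurable_funM => //; apply: measurable_funB => //; exact: measurableT_comp.
  have := @Fubini_bounded 1 k (oner_neq0 R) mk (fun x => norm_cos_le1 _).
  rewrite /k /=.
  have -> : \int[P]_x (\int[mu]_t (cos (t * (y - X x)) * normal_pdf 0 1 t)) =
     \int[P]_x expR (- (y - X x) ^+ 2 / 2).
    apply: eq_Rintegral => x _; have := gcosE (oner_neq0 R) (y - X x).
    by rewrite /gcos expr1n mul1r.
  move=> ->.
  transitivity (\int[mu]_t (cos (t * y) * (1 * expR (- (t ^+ 2 * v) / 2)) * normal_pdf 0 1 t)).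
    apply: eq_Rintegral => t _; congr (_ * _); rewrite mul1r.
    have ic : P.-integrable setT (EFin \o (fun x => cos (t * X x))).
      apply: (@integrable_bounded_prob _ 1); last by move=> x; exact: norm_cos_le1.
      apply: measurableT_comp; first exact: measurable_cos. exact: measurable_funM.
    have isn : P.-integrable setT (EFin \o (fun x => sin (t * X x))).
      apply: (@integrable_bounded_prob _ 1); last by move=> x; exact: norm_sin_le1.
      apply: measurableT_comp; first exact: measurable_sin. exact: measurable_funM.
    transitivity (\int[P]_x (cos (t * y) * cos (t * X x) + sin (t * y) * sin (t * X x))).
      by apply: eq_Rintegral => x _; rewrite mulrBr cosB.
    rewrite RintegralD //; [|exact: (integrableZl measurableT _ ic) | exact: (integrableZl measurableT _ isn)].
    by rewrite !RintegralZl // Hc Hs mulr0 addr0.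
  rewrite Rintegral_pdf_scale //; last 3 first.
  - by rewrite expr1n mul1r ltr_pwDl.
  - exact: measurable_cosM.
  - by move=> t; exact: norm_cos_le1.
  rewrite expr1n !mul1r -/q; congr (_ * _).
  have q'0 : q^-1 != 0 by rewrite invr_neq0 // gt_eqF.
  have := gcosE q'0 y; rewrite /gcos => ->; congr expR.
  by field; rewrite gt_eqF.
pose k (x : Om * R) := (expR (x.2 - (x.2 - X x.1) ^+ 2 / 2))%:E.
have mk : measurable_fun setT k.
  apply/measurable_EFinP; apply: measurableT_comp => //.
  apply: measurable_funB => //; apply: measurable_funM => //; apply: measurable_funX.
  by apply: measurable_funB => //; exact: measurableT_comp.
have k0 x : (0 <= k x)%E by rewrite lee_fin expR_ge0.
have p1 : 0 < normal_peak (1 : R) by rewrite normal_peak_gt0 // oner_neq0.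
have := @fubini_tonelli _ _ _ _ _ P mu k mk k0; rewrite /k /=.
have -> : (\int[P]_x (\int[mu]_t (expR (t - (t - X x) ^+ 2 / 2))%:E) =
   \int[P]_x ((expR 2^-1 / normal_peak 1)%:E * (expR (X x))%:E))%E.
  apply: eq_integral => x _.
  have e t : expR (t - (t - X x) ^+ 2 / 2) =
     (expR (X x) * (expR 2^-1 / normal_peak 1)) * normal_pdf (X x + 1) 1 t.
    rewrite normal_pdfE ?oner_neq0 // /normal_fun expr1n.
    rewrite -!mulrA mulKf ?gt_eqF // -!expRD; congr expR; by field.
  under eq_integral do rewrite e EFinM.
  rewrite integralZl //; last exact: integrable_normal_pdf.
  by rewrite integral_normal_pdf mule1 mulrC EFinM.
have -> : (\int[mu]_t (\int[P]_x (expR (t - (t - X x) ^+ 2 / 2))%:E) =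
   \int[mu]_t ((expR (q ^+ 2 / 2) / normal_peak 1)%:E * (normal_pdf (q ^+ 2) q t)%:E))%E.
  apply: eq_integral => t _.
  have mY : measurable_fun setT (fun x => expR (- (t - X x) ^+ 2 / 2)).
    apply: measurableT_comp => //; apply: measurable_funM => //; apply: measurableT_comp => //.
    by apply: measurable_funX; apply: measurable_funB.
  transitivity ((expR t)%:E * \int[P]_x (expR (- (t - X x) ^+ 2 / 2))%:E)%E.
    rewrite -ge0_integralZl //.
      by apply: eq_integral => x _; rewrite -EFinM -expRD mulNr.
    exact/measurable_EFinP.
  rewrite -Rintegral_EFin; last first.
    apply: (@integrable_bounded_prob _ 1) => // x.
    by rewrite ger0_norm ?expR_ge0 // expR_le1 mulNr oppr_le0 divr_ge0 // sqr_ge0.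
  rewrite step1 -!EFinM; congr EFin.
  rewrite normal_pdfE ?gt_eqF // (normal_peakE q0) /normal_fun.
  have -> : expR (q ^+ 2 / 2) / normal_peak 1 * (q^-1 * normal_peak 1 * expR (- (t - q ^+ 2) ^+ 2 / (q ^+ 2 *+ 2)))
    = q^-1 * (expR (q ^+ 2 / 2) * expR (- (t - q ^+ 2) ^+ 2 / (q ^+ 2 *+ 2))).
    by field; rewrite !gt_eqF.
  rewrite mulrCA; congr (_ * _); rewrite -!expRD; congr expR.
  by field; rewrite gt_eqF.
have -> : (\int[mu]_t ((expR (q ^+ 2 / 2) / normal_peak 1)%:E * (normal_pdf (q ^+ 2) q t)%:E) =
    (expR (q ^+ 2 / 2) / normal_peak 1)%:E)%E.
  rewrite integralZl //; last exact: integrable_normal_pdf.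
  by rewrite integral_normal_pdf mule1.
have K0 : 0 < expR 2^-1 / normal_peak (1 : R) by rewrite divr_gt0 // expR_gt0.
have -> : expR (q ^+ 2 / 2) / normal_peak 1 = expR 2^-1 / normal_peak 1 * expR (v / 2).
  rewrite q2 mulrDl expRD mul1r; ring.
set K := _ / _ in K0 *.
have -> : (\int[P]_x (K%:E * (expR (X x))%:E) = K%:E * \int[P]_x (expR (X x))%:E)%E.
  rewrite ge0_integralZl //; last by rewrite lee_fin ltW.
  by apply/measurable_EFinP; exact: measurableT_comp.
clearbody K; move/(congr1 (fun y => (K^-1)%:E * y)%E).
by rewrite EFinM !muleA -!EFinM mulVf ?gt_eqF // mul1e mul1r.
Qed.

End Prob.
End GaussianMoments.

(** * Concentration of Gaussian quadratic forms *)

Section Concentration.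
Variable R : realType.
Notation mu := (@lebesgue_measure R).

Lemma expR_quadratic_le (x : R) : - (1/2) <= x -> expR (x - 2 * x ^+ 2) <= 1 + x.
Proof.
move=> hx.
have p : 0 < 1 - x + 2 * x ^+ 2 by have := sqr_ge0 (x - 1/4); nra.
have -> : x - 2 * x ^+ 2 = - (2 * x ^+ 2 - x) by ring.
rewrite expRN; apply: (@le_trans _ _ (1 - x + 2 * x ^+ 2)^-1).
  rewrite lef_pV2 ?posrE ?expR_gt0 //; apply: le_trans (expR_ge1Dx _); lra.
rewrite -[_^-1]mul1r ler_pdivrMr //.
have -> : (1 + x) * (1 - x + 2 * x ^+ 2) = 1 + x ^+ 2 * (1 + 2 * x) by ring.
by rewrite lerDl mulr_ge0 ?sqr_ge0 //; lra.
Qed.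

Lemma inv_sqrt_le_expR (x : R) : - (1/2) <= x ->
  (Num.sqrt (1 + x))^-1 <= expR (- x / 2 + x ^+ 2).
Proof.
move=> hx; have h := expR_quadratic_le hx.
have -> : - x / 2 + x ^+ 2 = - ((x - 2 * x ^+ 2) / 2) by field.
have x1 : 0 < 1 + x by lra.
rewrite expRN lef_pV2 ?posrE ?expR_gt0 ?sqrtr_gt0 //.
rewrite -[leLHS]gtr0_norm ?expR_gt0 // -sqrtr_sqr ler_wsqrtr //.
by rewrite -expRM_natl mulrC divfK.
Qed.

Definition zero_ext n (T : zmodType) (f : 'I_n -> T) (i : nat) : T :=
  if insub i is Some j then f j else 0.

Lemma zero_extE n (T : zmodType) (f : 'I_n -> T) (i : 'I_n) : zero_ext f i = f i.
Proof. by rewrite /zero_ext valK. Qed.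

Context d (Om : measurableType d) (P : probability Om R).

Lemma gaussian_bform_ge0 n (X : Om -> 'cV[R]_n) (S : 'M[R]_n) :
  centered_gaussian P X S -> forall u, 0 <= bform S u u.
Proof.
move=> [mX H] u; have [+ _] := H u; rewrite unlock => e.
have : ((expR (- bform S u u / 2))%:E <= 1)%E.
  rewrite /bform -e; apply: (@le_trans _ _ (\int[P]_w (cst 1%:E w))%E).
    apply: le_integral => //.
    - apply: (@integrable_bounded_prob _ _ _ P _ 1); last by move=> w; exact: norm_cos_le1.
      apply: measurableT_comp; first exact: measurable_cos.
      have -> : (fun w => (u^T *m X w) ord0 ord0) = (fun w => \sum_i u i ord0 * X w i ord0).
        by apply/funext => w; rewrite mxE; apply: eq_bigr => i _; rewrite mxE.
      by apply: measurable_sum => i; exact: measurable_funM.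
    - by apply: (@integrable_bounded_prob _ _ _ P (cst 1) 1) => // w; rewrite normr1.
    - by move=> w _ /=; rewrite lee_fin cos_le1.
  by rewrite integral_cst //= probability_setT mule1.
by rewrite lee_fin expR_le1; lra.
Qed.

Lemma quadratic_form_mgf n (X : Om -> 'cV[R]_n) (A B : 'M[R]_n) (Lam : R) :
  A^T = A -> B^T = B -> (forall x, x != 0 -> 0 < bform A x x) ->
  (forall x, bform B x x <= Lam * bform A x x) ->
  centered_gaussian P X B ->
  forall (s e : R), 0 < s -> s * Lam <= 1/2 -> (e == 1) || (e == - 1) ->
  let q w := ((X w)^T *m invmx A *m X w) ord0 ord0 in
  let m := \tr (invmx A *m B) in
  measurable_fun setT q /\
  (\int[P]_w (expR (e * s * (q w - m) / 2))%:E <= (expR (s ^+ 2 * (Lam * m)))%:E)%E.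
Proof.
move=> sA sB pA AB gX s e s0 sL e1 q m.
have B0 := gaussian_bform_ge0 gX.
have [mX H] := gX.
have [V [l [VA VB AE]]] := simultaneous_diagonalization sA sB pA.
have mxl y : bform (diag_mx l) y y = \sum_i y i ord0 ^+ 2 * l ord0 i.
  rewrite bformE; apply: eq_bigr => i _; rewrite (bigD1 i) //= big1 ?addr0.
    by rewrite mxE eqxx mulr1n; ring.
  by move=> j ji; rewrite mxE eq_sym (negbTE ji) mulr0n mulr0 mul0r.
have BV y : bform B (V^T *m y) (V^T *m y) = \sum_i y i ord0 ^+ 2 * l ord0 i.
  by rewrite -mxl -VB /bform trmx_mul trmxK !mulmxA.
have AV y : bform A (V^T *m y) (V^T *m y) = sqn y.
  by rewrite -bform1 -VA /bform trmx_mul trmxK !mulmxA.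
have dl i : \sum_j (delta_mx i ord0 : 'cV[R]_n) j ord0 ^+ 2 * l ord0 j = l ord0 i.
  rewrite (bigD1 i) //= big1 ?addr0; first by rewrite mxE !eqxx expr1n mul1r.
  by move=> j ji; rewrite mxE (negbTE ji) expr0n mul0r.
have l0 i : 0 <= l ord0 i by rewrite -dl -BV.
have lL i : l ord0 i <= Lam.
  have := AB (V^T *m delta_mx i ord0); rewrite BV dl AV.
  rewrite [sqn _](_ : _ = 1) ?mulr1 // /sqn (bigD1 i) //= big1 ?addr0.
    by rewrite mxE !eqxx expr1n.
  by move=> j ji; rewrite mxE (negbTE ji) expr0n.
have mE : m = \sum_i l ord0 i.
  by rewrite /m AE -mulmxA mxtrace_mulC VB mxtrace_diag.
pose z (i : nat) (w : Om) := zero_ext (fun j => (V *m X w) j ord0) i.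
pose l' := zero_ext (fun j => l ord0 j).
have qE w : q w = \sum_(i < n) z i w ^+ 2.
  rewrite /q AE mulmxA -trmx_mul -mulmxA -sqnE; apply: eq_bigr => i _.
  by rewrite /z zero_extE.
have mz i : measurable_fun setT (z i).
  rewrite /z /zero_ext; case: insub => [j|]; last exact: measurable_cst.
  under eq_fun do rewrite mxE.
  by apply: measurable_sum => k; exact: measurable_funM.
have mq : measurable_fun setT q.
  rewrite (_ : q = fun w => \sum_(i < n) z i w ^+ 2); last by apply/funext => w; exact: qE.
  by apply: measurable_sum => k; exact: measurable_funX.
split => //.
have l'0 i : 0 <= l' i by rewrite /l' /zero_ext; case: insub.
have uX (u : nat -> R) w : \sum_(i < n) u i * z i w = ((V^T *m (\col_i u i))^T *m X w) ord0 ord0.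
  rewrite trmx_mul trmxK -mulmxA mxE; apply: eq_bigr => i _.
  by rewrite /z zero_extE !mxE.
have uB (u : nat -> R) : \sum_(i < n) u i ^+ 2 * l' i = bform B (V^T *m (\col_i u i)) (V^T *m (\col_i u i)).
  by rewrite BV; apply: eq_bigr => i _; rewrite /l' zero_extE mxE.
pose s' := Num.sqrt s.
have s'0 : 0 < s' by rewrite sqrtr_gt0.
have s'2 : s' ^+ 2 = s by rewrite sqr_sqrtr // ltW.
have slL i : s * l ord0 i <= 1/2.
  by apply: le_trans sL; rewrite ler_pM2l.
have sl2 : \sum_i (s * l ord0 i) ^+ 2 <= s ^+ 2 * (Lam * m).
  rewrite mE !mulr_sumr ler_sum // => i _; rewrite exprMn ler_wpM2l ?sqr_ge0 //.
  by rewrite expr2 ler_wpM2r.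
have K (c : R) : (c == 1) || (c == - 1) ->
   \prod_(i < n) (Num.sqrt (1 + c * (s * l' i)))^-1 <= expR (s ^+ 2 * (Lam * m) - c * s * m / 2).
  move=> c1; rewrite mE.
  have -> : c * s * (\sum_i l ord0 i) / 2 = \sum_i (c * (s * l ord0 i) / 2).
    by rewrite mulr_sumr mulr_suml; apply: eq_bigr => i _; rewrite mulrA.
  apply: (@le_trans _ _ (expR (\sum_i ((s * l ord0 i) ^+ 2 - c * (s * l ord0 i) / 2)))); last first.
    by rewrite ler_expR sumrB lerD2r -mE.
  rewrite expR_sum; apply: ler_prod => i _; rewrite invr_ge0 sqrtr_ge0 /= /l' zero_extE.
  have -> : (s * l ord0 i) ^+ 2 - c * (s * l ord0 i) / 2 = - (c * (s * l ord0 i)) / 2 + (c * (s * l ord0 i)) ^+ 2.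
    by case/orP: c1 => /eqP ->; field.
  apply: inv_sqrt_le_expR; have := slL i; have : 0 <= s * l ord0 i by rewrite mulr_ge0 // ltW.
  by case/orP: c1 => /eqP ->; lra.
have fin (F : Om -> R) r c : (\int[P]_w (F w)%:E = r%:E)%E -> (forall w, 0 <= F w) -> measurable_fun setT F ->
  r <= expR (s ^+ 2 * (Lam * m) + c * s * m / 2) ->
  (\int[P]_w (F w * expR (- (c * s * m / 2)))%:E <= (expR (s ^+ 2 * (Lam * m)))%:E)%E.
  move=> Fr F0 mF rle; under eq_integral do rewrite EFinM.
  rewrite ge0_integralZr //; [|exact/measurable_EFinP|by move=> w _; rewrite lee_fin].
  by rewrite Fr -EFinM lee_fin expRN ler_pdivrMr ?expR_gt0 // -expRD.
have mQ c : measurable_fun setT (fun w => 1 * expR (c * (\sum_(i < n) z i w ^+ 2) / 2)).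
  apply: measurable_funM => //; apply: measurableT_comp => //; apply: measurable_funM => //.
  by apply: measurable_funM => //; apply: measurable_sum => k; exact: measurable_funX.
case/orP: e1 => /eqP ->.
  have sl1 i : s' ^+ 2 * l' i < 1.
    rewrite s'2 /l' /zero_ext; case: insub => [j|]; last by rewrite mulr0.
    by apply: le_lt_trans (slL j) _; lra.
  have := @mgf_sum_squares R _ Om P s' z l' s'0 mz sl1 n (cst 1) 1 (measurable_cst _) (fun _ => ler01).
  move=> /(_ _)/wrap[].
    move=> u; rewrite mul1r.
    transitivity (\int[P]_w (expR (((V^T *m (\col_i u i))^T *m X w) ord0 ord0))%:E)%E.
      by apply: eq_integral => w _; rewrite mul1r uX.
    rewrite uB; apply: gaussian_mgf => //.
    - under eq_fun do rewrite -uX.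
      by apply: measurable_sum => k; exact: measurable_funM.
    - move=> t; apply: RintegralE.
      have [+ _] := H (t *: (V^T *m (\col_i u i))); rewrite unlock.
      rewrite -/(bform _ _ _) bformZl bformZr => e0.
      rewrite mulrA -expr2 in e0; rewrite -e0.
      by apply: eq_integral => w _; rewrite linearZ /= -scalemxAl [in RHS]mxE.
    - move=> t; apply: RintegralE.
      have [_ +] := H (t *: (V^T *m (\col_i u i))); rewrite unlock => e0; apply: etrans e0.
      by apply: eq_integral => w _; rewrite linearZ /= -scalemxAl [in RHS]mxE.
  rewrite s'2 => E1.
  have := fin _ _ 1 E1 (fun w => mulr_ge0 ler01 (expR_ge0 _)) (mQ s).
  move=> /(_ _)/wrap[].
    rewrite mul1r; have := K (- 1); rewrite eqxx orbT => /(_ isT).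
    under eq_bigr do rewrite mulN1r.
    by rewrite !mulNr opprK.
  apply: le_trans; rewrite le_eqVlt; apply/orP; left; apply/eqP.
  apply: eq_integral => w _; rewrite /= !mul1r -expRD qE; congr (expR _)%:E; ring.
have := @laplace_sum_squares R _ Om P s' z l' s'0 mz l'0 n (cst 1) 1 (measurable_cst _).
move=> /(_ _)/wrap[]; first by move=> w; rewrite normr1.
move=> /(_ _)/wrap[].
  move=> u; rewrite mul1r uB; apply: RintegralE.
  have [+ _] := H (V^T *m (\col_i u i)); rewrite unlock => <-.
  by apply: eq_integral => w _; rewrite mul1r uX.
rewrite s'2 => E1.
have E2 : (\int[P]_w (1 * expR (- s * (\sum_(i < n) z i w ^+ 2) / 2))%:E =
    (1 * \prod_(i < n) (Num.sqrt (1 + s * l' i))^-1)%:E)%E.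
  rewrite -E1 Rintegral_EFin.
    by apply: eq_integral => w _; rewrite !mulNr.
  apply: (@integrable_bounded_prob _ _ _ P _ 1).
    by have := mQ (- s); under eq_fun do rewrite mulNr.
  move=> w; rewrite /cst mul1r ger0_norm ?expR_ge0 // expR_le1 mulNr oppr_le0 divr_ge0 // mulr_ge0 //; first exact: ltW.
  by apply: sumr_ge0 => i _; rewrite sqr_ge0.
have := fin _ _ (- 1) E2 (fun w => mulr_ge0 ler01 (expR_ge0 _)) (mQ (- s)).
move=> /(_ _)/wrap[].
  rewrite mul1r; have := K 1; rewrite eqxx => /(_ isT).
  under eq_bigr do rewrite mul1r.
  by rewrite mul1r !mulNr mul1r.
apply: le_trans; rewrite le_eqVlt; apply/orP; left; apply/eqP.
apply: eq_integral => w _; rewrite /= !mul1r -expRD qE; congr (expR _)%:E; ring.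
Qed.

Lemma Borel_Cantelli_eventually (E : nat -> set Om) (p : nat -> R) (M : R) :
  (forall n, measurable (E n)) -> (forall n, (P (E n) <= (p n)%:E)%E) ->
  (forall n, \sum_(i < n) p i <= M) ->
  {ae P, forall w, exists N, forall n, (N <= n)%N -> ~ E n w}.
Proof.
move=> mE EP pM.
have p0 n : (0 <= (p n)%:E)%E by apply: le_trans (EP n).
have : P (lim_sup_set E) = 0%E.
  apply: lim_sup_set_cvg0 => //.
  apply: (@le_lt_trans _ _ M%:E); last by rewrite ltry.
  apply: (@le_trans _ _ (\sum_(n <oo) (p n)%:E)%E).
    by apply: lee_nneseries => [n _ _|n _]; [exact: measure_ge0|exact: EP].
  apply: lime_le; first by apply: is_cvg_nneseries => n _ _.
  apply: nearW => n; rewrite sumEFin lee_fin big_mkord; exact: pM.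
move=> E0; exists (lim_sup_set E); split => //.
  by apply: bigcap_measurable => // k _; apply: bigcup_measurable => j _.
move=> w /= nw n _.
apply: contrapT => h; apply: nw; exists n => k nk Ek; apply: h.
by exists k.
Qed.

Lemma measurable_ge_fun (Y : Om -> R) (eps : R) : measurable_fun setT Y ->
  measurable [set w | (eps <= Y w)%R].
Proof.
move=> mY; rewrite (_ : [set _ | _] = setT `&` Y @^-1` `[eps, +oo[).
  by apply: mY => //; exact: measurable_itv.
by rewrite setTI; apply/seteqP; split => w /=; rewrite in_itv /= andbT.
Qed.

Lemma Chernoff_bound (Y : Om -> R) (s eps r : R) : measurable_fun setT Y ->
  (\int[P]_w (expR (s * Y w))%:E <= (expR r)%:E)%E -> 0 < s ->
  (P [set w | (eps <= Y w)%R] <= (expR (r - s * eps))%:E)%E.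
Proof.
move=> mY h s0.
have mE : measurable [set w | (eps <= Y w)%R].
  exact: measurable_ge_fun.
rewrite expRB EFinM lee_pdivlMr ?expR_gt0 //; apply: le_trans h.
have := @ge0_le_integral _ _ R P setT measurableT
  (fun w => ((expR (s * eps)) * \1_[set w | (eps <= Y w)%R] w)%:E) (fun w => (expR (s * Y w))%:E).
move=> /(_ _ _ _ _)/wrap[].
- by move=> w _; rewrite lee_fin mulr_ge0 ?expR_ge0.
- apply/measurable_EFinP; apply: measurable_funM => //; exact: measurable_indic.
- apply/measurable_EFinP; apply: measurableT_comp => //; exact: measurable_funM.
- move=> w _; rewrite lee_fin indicE; case: (boolP (w \in _)) => hw; last by rewrite mulr0 expR_ge0.
  by rewrite mulr1 ler_expR ler_pM2l //; move: hw; rewrite inE.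
apply: le_trans.
under eq_integral do rewrite EFinM.
rewrite ge0_integralZl //; last by apply/measurable_EFinP; exact: measurable_indic.
by rewrite integral_indic // setIT muleC.
Qed.

Lemma quadratic_form_ae_cvg (X : forall n, Om -> 'cV[R]_n) (A B : forall n, 'M[R]_n)
    (Lam : nat -> R) (K L : R) :
  (forall n, (A n)^T = A n) -> (forall n, (B n)^T = B n) ->
  (forall n x, x != 0 -> 0 < bform (A n) x x) ->
  (forall n x, bform (B n) x x <= n%:R * Lam n * bform (A n) x x) ->
  (forall n, centered_gaussian P (X n) (B n)) ->
  (forall n, 0 < Lam n) ->
  (forall n, n%:R^-1 * \tr (invmx (A n) *m B n) <= K) ->
  (forall c, 0 < c -> exists M, forall n, \sum_(i < n) expR (- (c / Lam i.+1)) <= M) ->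
  (fun n => n%:R^-1 * \tr (invmx (A n) *m B n)) @ \oo --> L ->
  {ae P, forall w, (fun n => n%:R^-1 * ((X n w)^T *m invmx (A n) *m X n w) ord0 ord0) @ \oo --> L}.
Proof.
move=> sA sB pA AB gX L0 trK LamS trL.
pose K' := Num.max K 1.
have K'1 : 1 <= K' by rewrite le_max lexx orbT.
have K'0 : 0 < K' by apply: lt_le_trans K'1.
pose q n w := ((X n w)^T *m invmx (A n) *m X n w) ord0 ord0.
pose m n := \tr (invmx (A n) *m B n).
pose Y (e : R) n w := e * (n.+1%:R^-1 * q n.+1 w - n.+1%:R^-1 * m n.+1).
have mY e n : measurable_fun setT (Y e n).
  have [mq _] := quadratic_form_mgf (sA n.+1) (sB n.+1) (pA n.+1) (AB n.+1) (gX n.+1)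
    (s := (2 * (n.+1%:R * Lam n.+1))^-1) (e := 1)
    ltac:(by rewrite invr_gt0 !mulr_gt0 // ltr0n)
    ltac:(rewrite invfM -mulrA mulVf ?mulr1 ?mul1r //; by rewrite gt_eqF // mulr_gt0 // ltr0n)
    ltac:(by rewrite eqxx).
  by apply: measurable_funM => //; apply: measurable_funB => //; apply: measurable_funM.
have key (e eps : R) : (e == 1) || (e == - 1) -> 0 < eps ->
  {ae P, forall w, exists N, forall n, (N <= n)%N -> ~ (eps <= Y e n w)}.
  move=> e1 e0.
  pose k := Num.min (1/2) (eps / (2 * K')) / 2.
  have k0 : 0 < k by rewrite divr_gt0 // lt_min divr_gt0 //= divr_gt0 // mulr_gt0.
  have k1 : 2 * k <= 1/2 by rewrite /k mulrC divfK // ge_min lexx.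
  have k2 : 4 * k * K' <= eps.
    have : 2 * k <= eps / (2 * K') by rewrite /k mulrC divfK // ge_min lexx orbT.
    by rewrite ler_pdivlMr ?mulr_gt0 //; lra.
  have [M HM] := LamS (k * eps / 4) ltac:(by rewrite divr_gt0 // mulr_gt0).
  apply: (@Borel_Cantelli_eventually (fun n => [set w | eps <= Y e n w])
    (fun i => expR (- (k * eps / 4 / Lam i.+1))) M _ _ HM).
  - by move=> n; apply: measurable_ge_fun; exact: mY.
  - move=> n.
    have n0 : (0 : R) < n.+1%:R by rewrite ltr0n.
    pose s := k / (n.+1%:R * Lam n.+1).
    have nL : 0 < n.+1%:R * Lam n.+1 by rewrite mulr_gt0.
    have s0 : 0 < s by rewrite divr_gt0.
    have sL : s * (n.+1%:R * Lam n.+1) <= 1/2 by rewrite /s divfK ?gt_eqF //; lra.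
    have [_ h] := quadratic_form_mgf (sA n.+1) (sB n.+1) (pA n.+1) (AB n.+1) (gX n.+1) s0 sL e1.
    have h' : (\int[P]_w (expR ((k / (2 * Lam n.+1)) * Y e n w))%:E <=
        (expR (s ^+ 2 * (n.+1%:R * Lam n.+1 * m n.+1)))%:E)%E.
      apply: le_trans h; rewrite le_eqVlt; apply/orP; left; apply/eqP.
      apply: eq_integral => w _; congr (expR _)%:E; rewrite /Y /s -/(q n.+1 w) -/(m n.+1).
      by field; rewrite !gt_eqF.
    have := Chernoff_bound eps (mY e n) h' ltac:(by rewrite divr_gt0 // mulr_gt0).
    move=> /le_trans; apply; rewrite lee_fin ler_expR /s.
    have mK : m n.+1 <= n.+1%:R * K'.
      by rewrite -ler_pdivrMl // (le_trans (trK n.+1)) // le_max lexx.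
    have -> : (k / (n.+1%:R * Lam n.+1)) ^+ 2 * (n.+1%:R * Lam n.+1 * m n.+1) - k / (2 * Lam n.+1) * eps
      = (k ^+ 2 * (m n.+1 / n.+1%:R) - k * eps / 2) / Lam n.+1.
      by field; rewrite !gt_eqF.
    rewrite -[leRHS]mulNr ler_pM2r ?invr_gt0 //.
    have mK' : m n.+1 / n.+1%:R <= K' by rewrite ler_pdivrMr // mulrC.
    have : k ^+ 2 * (m n.+1 / n.+1%:R) <= k ^+ 2 * K' by rewrite ler_wpM2l ?sqr_ge0.
    have : k * (4 * k * K') <= k * eps by rewrite ler_pM2l.
    move=> h1 h2; rewrite lerBlDr (le_trans h2) //.
    have -> : - (k * eps / 4) + k * eps / 2 = k * eps / 4 by field.
    have -> : k ^+ 2 * K' = k * (4 * k * K') / 4 by field.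
    by rewrite ler_pM2r // invr_gt0.
have : {ae P, forall w, forall i, exists N, forall n, (N <= n)%N -> `|Y 1 n w| < i.+1%:R^-1}.
  apply/ae_foralln => i.
  have i0 : (0 : R) < i.+1%:R^-1 by rewrite invr_gt0 ltr0n.
  have k1 := key 1 _ ltac:(by rewrite eqxx) i0.
  have k2 := key (- 1) _ ltac:(by rewrite eqxx orbT) i0.
  near=> w.
  have [N1 h1] : exists N, forall n, (N <= n)%N -> ~ (i.+1%:R^-1 <= Y 1 n w) by near: w.
  have [N2 h2] : exists N, forall n, (N <= n)%N -> ~ (i.+1%:R^-1 <= Y (- 1) n w) by near: w.
  exists (maxn N1 N2) => n; rewrite geq_max => /andP[n1 n2].
  have /negP := h1 n n1; have /negP := h2 n n2; rewrite -!ltNge ltr_norml /Y => a b.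
  by rewrite mul1r in b *; rewrite mulN1r ltrNl in a; rewrite a b.
apply: filterS => w hw.
rewrite -cvg_shiftS /=.
have trL' : (fun n => n.+1%:R^-1 * m n.+1) @ \oo --> L.
  by move: trL; rewrite -cvg_shiftS.
rewrite -[L]add0r.
have -> : (fun n : nat => n.+1%:R^-1 * ((X n.+1 w)^T *m invmx (A n.+1) *m X n.+1 w) ord0 ord0) =
   (fun n => Y 1 n w + n.+1%:R^-1 * m n.+1).
  by apply/funext => n; rewrite /Y mul1r subrK.
apply: cvgD trL'.
apply/cvgrPdist_lt => eps e0.
pose i := Num.truncn eps^-1.
have [N hN] := hw i; exists N => // n /= Nn.
rewrite sub0r normrN; apply: lt_trans (hN n Nn) _.
rewrite -[ltRHS]invrK ltf_pV2 ?posrE ?invr_gt0 ?ltr0n //.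
exact: truncnS_gt.
Unshelve. all: by end_near. Qed.

End Concentration.

(** * Integrals over the torus *)

Section Torus.
Variable R : realType.
Notation mu := (@lebesgue_measure R).
Notation I h := (Rintegral mu (@Ipi R) h).
Notation integ h := (mu.-integrable (@Ipi R) (EFin \o h)).

Lemma IpiE : @Ipi R = [set` `[- pi, pi[].
Proof. by apply/seteqP; split => x; rewrite /Ipi /= in_itv. Qed.

Lemma measurable_Ipi : measurable (@Ipi R : set (measurableTypeR R)).
Proof. by rewrite IpiE; exact: measurable_itv. Qed.

Lemma Ipi_norm (t : R) : Ipi t -> `|t| <= pi.
Proof. by rewrite /Ipi /= ler_norml => /andP[-> /ltW ->]. Qed.

Lemma mu_Ipi : mu (@Ipi R) = (2 * pi)%:E.
Proof.
rewrite IpiE lebesgue_measure_itv /= lte_fin gtrN ?pi_gt0 // -EFinD.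
by congr EFin; ring.
Qed.

Lemma integ_cst c : integ (fun=> c).
Proof.
apply/integrableP; split; first exact/measurable_EFinP.
apply: (@le_lt_trans _ _ (\int[mu]_(x in @Ipi R) (cst `|c|%:E x))%E); first by [].
rewrite integral_cst; last exact: measurable_Ipi.
rewrite [X in (X < _)%E](_ : _ = (`|c| * (2 * pi))%:E) ?ltry //.
by rewrite EFinM; congr (_ * _)%E; exact: mu_Ipi.
Qed.

Lemma I_cst c : I (fun=> c) = 2 * pi * c.
Proof.
rewrite Rintegral_cst; last exact: measurable_Ipi.
by rewrite [RHS]mulrC; congr (c * _); rewrite -[RHS]/(fine (2 * pi)%:E); congr fine; exact: mu_Ipi.
Qed.

Lemma integ_measurable (h : R -> R)  : integ h -> measurable_fun (@Ipi R) h.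
Proof. by case/integrableP => /measurable_EFinP. Qed.

Lemma integ_le (h k : R -> R)  : measurable_fun (@Ipi R) h -> integ k ->
  (forall t, Ipi t -> `|h t| <= k t) -> integ h.
Proof.
move=> mh ik hk; apply: (@le_integrable _ _ _ mu _ measurable_Ipi _ (EFin \o k)) => //.
- exact/measurable_EFinP.
- by move=> t It /=; rewrite lee_fin (le_trans (hk t It)) // ler_norm.
Qed.

Lemma integM (h k : R -> R) (C : R) : integ h -> measurable_fun (@Ipi R) k -> (forall t, Ipi t -> `|k t| <= C) ->
  integ (fun t => k t * h t).
Proof.
move=> ih mk kC; apply: (@integ_le _ (fun t => C * `|h t|)).
- by apply: measurable_funM => //; exact: integ_measurable.
- exact: (integrableZl measurable_Ipi C (integrable_norm ih)).
- by move=> t It; rewrite normrM ler_wpM2r // kC.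
Qed.

Lemma integD (h k : R -> R)  : integ h -> integ k -> integ (fun t => h t + k t).
Proof. by move=> ih ik; exact: (integrableD measurable_Ipi ih ik). Qed.

Lemma integZ (c : R) (h : R -> R) : integ h -> integ (fun t => c * h t).
Proof. by move=> ih; exact: (integrableZl measurable_Ipi c ih). Qed.

Lemma integ_sum J (s : seq J) (h : J -> R -> R) : (forall j, integ (h j)) ->
  integ (fun t => \sum_(j <- s) h j t).
Proof.
move=> ih; elim: s => [|j s IH].
  by under eq_fun do rewrite big_nil; exact: integ_cst.
by under eq_fun do rewrite big_cons; exact: integD.
Qed.

Lemma I_sum J (s : seq J) (h : J -> R -> R) : (forall j, integ (h j)) ->
  I (fun t => \sum_(j <- s) h j t) = \sum_(j <- s) I (h j).
Proof.
move=> ih; elim: s => [|j s IH].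
  rewrite big_nil; under eq_Rintegral do rewrite big_nil.
  by rewrite I_cst mulr0.
rewrite big_cons; under eq_Rintegral do rewrite big_cons.
by rewrite RintegralD ?IH //; [exact: measurable_Ipi|exact: integ_sum].
Qed.

Lemma I_Z (c : R) (h : R -> R) : integ h -> I (fun t => c * h t) = c * I h.
Proof. by move=> ih; rewrite RintegralZl //; exact: measurable_Ipi. Qed.

Lemma le_I (h k : R -> R)  : integ h -> integ k -> (forall t, Ipi t -> h t <= k t) -> I h <= I k.
Proof. by move=> ih ik hk; apply: le_Rintegral => //; exact: measurable_Ipi. Qed.

Lemma eq_I (h k : R -> R)  : (forall t, Ipi t -> h t = k t) -> I h = I k.
Proof. by move=> hk; apply: eq_Rintegral => t /set_mem; exact: hk. Qed.

Lemma eq_I_off0 (h k : R -> R)  : measurable_fun (@Ipi R) h -> measurable_fun (@Ipi R) k ->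
  (forall t, Ipi t -> t != 0 -> h t = k t) -> I h = I k.
Proof.
move=> mh mk hk; rewrite /Rintegral; congr fine.
apply: ae_eq_integral; [exact: measurable_Ipi|exact/measurable_EFinP|exact/measurable_EFinP|].
exists [set 0]; split; [exact: measurable_set1|exact: lebesgue_measure_set1|].
move=> t /= nt; apply: contrapT => t0; apply: nt => It; congr EFin; apply: hk => //.
by apply/eqP.
Qed.

Lemma le_I_off0 (h k : R -> R)  : integ h -> integ k ->
  (forall t, Ipi t -> t != 0 -> h t <= k t) -> I h <= I k.
Proof.
move=> ih ik hk.
have mh := integ_measurable ih; have mk := integ_measurable ik.
have mn0 : measurable_fun (@Ipi R) (fun t : R => (t != 0)%:R : R).
  have -> : (fun t : R => (t != 0)%:R : R) = \1_(~` [set 0]).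
    apply/funext => t; rewrite indicE; congr (_ : bool)%:R.
    by apply/idP/idP; rewrite inE /= => /eqP.
  by apply: measurable_funTS; apply: measurable_indic; exact: measurableC.
have im (u : R -> R) : integ u -> integ (fun t => (t != 0)%:R * u t).
  move=> iu; apply: (@integM _ _ 1 iu mn0) => t _.
  by case: (t != 0); rewrite ?normr1 ?normr0 ?ler01.
have e (u : R -> R) : integ u -> I u = I (fun t => (t != 0)%:R * u t).
  move=> iu; apply: eq_I_off0; [exact: integ_measurable|exact: integ_measurable (im _ iu)|].
  by move=> t _ ->; rewrite mul1r.
rewrite (e _ ih) (e _ ik); apply: le_I; [exact: im|exact: im|] => t It.
by case: (eqVneq t 0) => [|t0]; rewrite ?mul0r // !mul1r hk.
Qed.

Lemma sin_natpi (n : nat) : sin (n%:R * pi : R) = 0.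
Proof.
elim: n => [|n IH]; first by rewrite mul0r sin0.
by rewrite -natr1 mulrDl mul1r sinDpi IH oppr0.
Qed.

Lemma sin_intpi (m : int) : sin (m%:~R * pi : R) = 0.
Proof.
case: m => n; first exact: sin_natpi.
by rewrite NegzE mulrNz mulNr sinN sin_natpi oppr0.
Qed.

Lemma continuous_cosMl (x : R) : continuous (fun t : R => cos (x * t)).
Proof. by move=> t; under eq_fun do rewrite mulrC; exact: continuous_cosM. Qed.

Lemma continuous_sinMl (x : R) : continuous (fun t : R => sin (x * t)).
Proof. by move=> t; under eq_fun do rewrite mulrC; exact: continuous_sinM. Qed.

Lemma measurable_cosMl x D : measurable_fun D (fun t : R => cos (x * t)).
Proof. by apply: measurable_funTS; apply: continuous_measurable_fun; exact: continuous_cosMl. Qed.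

Lemma integ_cos (m : int) : integ (fun t => cos (m%:~R * t)).
Proof.
apply: (@integ_le _ (fun=> 1)); [exact: measurable_cosMl|exact: integ_cst|].
by move=> t _; exact: norm_cos_le1.
Qed.

Lemma I_cos (m : int) : I (fun t => cos (m%:~R * t)) = 2 * pi * (m == 0)%:R.
Proof.
have [->|m0] := eqVneq m 0.
  by under eq_Rintegral do rewrite mul0r cos0; rewrite I_cst.
have mR : (m%:~R : R) != 0 by rewrite intr_eq0.
rewrite mulr0 IpiE Rintegral_itv_bndo_bndc; last by rewrite -IpiE; exact: integ_cos.
rewrite /Rintegral (@continuous_FTC2 _ (fun t => cos (m%:~R * t)) (fun t => (m%:~R)^-1 * sin (m%:~R * t))).
- by rewrite mulrN sinN sin_intpi oppr0 mulr0 -EFinB subrr.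
- by rewrite gtrN // pi_gt0.
- by apply: continuous_subspaceT; exact: continuous_cosMl.
- have c : continuous (fun t : R => (m%:~R)^-1 * sin (m%:~R * t)).
    move=> t; apply: cvgM; first exact: cvg_cst.
    by exact: continuous_sinMl.
  split; [|by apply: cvg_at_right_filter; exact: c|by apply: cvg_at_left_filter; exact: c].
  by move=> t _; apply: ex_derive.
- move=> t _; rewrite derive1E.
  have dd : is_derive t 1 (fun t : R => (m%:~R)^-1 * sin (m%:~R * t)) (cos (m%:~R * t)).
    apply: is_derive_eq; rewrite /GRing.scale /=; by field.
  by case: dd.
Qed.

Lemma continuous_powR_norm (b x : R) : x != 0 -> {for x, continuous (fun t : R => `|t| `^ b)}.
Proof.
move=> x0.
have e : {near x, (fun t : R => expR (b * ln `|t|)) =1 (fun t => `|t| `^ b)}.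
  have : \forall t \near x, t != 0 by exact: open_neq.
  apply: filterS => t t0; by rewrite /powR normr_eq0 (negbTE t0).
have ex : `|x| `^ b = expR (b * ln `|x|) by rewrite /powR normr_eq0 (negbTE x0).
change ((fun t => `|t| `^ b) @ x --> `|x| `^ b); rewrite ex.
apply: cvg_trans; first exact: near_eq_cvg e.
apply: (cvg_comp (fun t : R => b * ln `|t|) expR); last exact: continuous_expR.
have c1 : {for x, continuous (fun t : R => ln `|t|)}.
  apply: (@continuous_comp R R R (fun t : R => `|t|) (@ln R)).
    exact: norm_continuous.
  by apply: continuous_ln; rewrite normr_gt0.
exact: (cvgM (cvg_cst b) c1).
Qed.

Lemma integral_powR_piece (b e r : R) : b < 1 -> 0 < e -> e < r ->
  (\int[mu]_(x in `[e, r]) (`|x| `^ (- b))%:E = ((r `^ (1 - b) - e `^ (1 - b)) / (1 - b))%:E)%E.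
Proof.
move=> b1 e0 er.
have b0 : 1 - b != 0 by rewrite subr_eq0 gt_eqF.
have -> : (\int[mu]_(x in `[e, r]) (`|x| `^ (- b))%:E = \int[mu]_(x in `[e, r]) (x `^ (- b))%:E)%E.
  apply: eq_integral => x /set_mem; rewrite /= in_itv /= => /andP[ex _].
  by rewrite ger0_norm // (le_trans (ltW e0)).
have dp (x : R) : 0 < x -> is_derive x 1 (fun y => y `^ (1 - b) / (1 - b)) (x `^ (- b)).
  move=> x0.
  have d1 : derivable (fun y : R => y `^ (1 - b)) x 1 by apply: derivable_powR; rewrite in_itv /= x0.
  have e1 := powR_derive1 (1 - b); have := e1 x; rewrite in_itv /= andbT x0 => /(_ isT) e2.
  have d2 : is_derive x 1 (fun y => y `^ (1 - b)) ((1 - b) * x `^ (1 - b - 1)).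
    by apply: DeriveDef => //; rewrite -derive1E.
  apply: is_derive_eq; rewrite /GRing.scale /= addrAC subrr add0r.
  by field.
have cont (x : R) b' : 0 < x -> {for x, continuous (fun y => y `^ b')}.
  move=> x0; apply: differentiable_continuous; apply/derivable1_diffP.
  by apply: derivable_powR; rewrite in_itv /= x0.
rewrite (@continuous_FTC2 _ (fun x => x `^ (- b)) (fun x => x `^ (1 - b) / (1 - b))) //.
- by rewrite -EFinD; congr EFin; ring.
- apply: continuous_in_subspaceT => x /set_mem /=; rewrite in_itv /= => /andP[ex _].
  by apply: cont; exact: lt_le_trans ex.
- have c x : 0 < x -> {for x, continuous (fun y => y `^ (1 - b) / (1 - b))}.
    by move=> x0; apply: cvgM; [exact: cont|exact: cvg_cst].
  split.
  + move=> x; rewrite in_itv /= => /andP[ex _]; have [] := dp x; last by [].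
    exact: lt_trans ex.
  + by apply: cvg_at_right_filter; apply: c.
  + by apply: cvg_at_left_filter; apply: c; exact: lt_trans er.
- move=> x; rewrite in_itv /= => /andP[ex _]; rewrite derive1E.
  by have [] := dp x (lt_trans e0 ex).
Qed.

Lemma integral_powR_piece_neg (b e r : R) : b < 1 -> 0 < e -> e < r ->
  (\int[mu]_(x in `[(- r)%R, (- e)%R]) (`|x| `^ (- b))%:E =
    ((r `^ (1 - b) - e `^ (1 - b)) / (1 - b))%:E)%E.
Proof.
move=> b1 e0 er.
rewrite (@integration_by_substitution_oppr _ (fun x => `|x| `^ (- b))) ?(ltW er) //; last first.
  apply: continuous_in_subspaceT => x /set_mem /=; rewrite in_itv /= => /andP[_ ex].
  by apply: continuous_powR_norm; rewrite lt_eqF // (le_lt_trans ex) // oppr_lt0.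
rewrite -integral_powR_piece //.
by apply: eq_integral => x _ /=; rewrite normrN.
Qed.

Lemma measurable_powR_norm (b : R) : measurable_fun setT (fun x : R => `|x| `^ b).
Proof.
apply: (@measurableT_comp _ _ _ _ _ _ (fun y : R => y `^ b)).
  exact: measurable_powR.
exact: normr_measurable.
Qed.

Lemma measurable_ball_norm (r : R) : measurable ([set x | (`|x| <= r)%R] : set (measurableTypeR R)).
Proof.
have -> : [set x | (`|x| <= r)%R] = [set` `[- r, r]].
  by apply/seteqP; split => x /=; rewrite in_itv /= ler_norml.
exact: measurable_itv.
Qed.

Lemma measurable_ball_indic (r : R) D : measurable_fun D (fun t : R => (`|t| <= r)%R%:R : R).
Proof.
have -> : (fun t : R => (`|t| <= r)%R%:R : R) = \1_[set x | (`|x| <= r)%R].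
  by apply/funext => t; rewrite indicE mem_setE.
by apply: measurable_funTS; apply: measurable_indic; exact: measurable_ball_norm.
Qed.

Lemma integral_powR_ball (b r : R) : b < 1 -> 0 < r ->
  (\int[mu]_(x in [set x | (`|x| <= r)%R]) (`|x| `^ (- b))%:E <= (2 * r `^ (1 - b) / (1 - b))%:E)%E.
Proof.
move=> b1 r0.
have B : 0 < 1 - b by rewrite subr_gt0.
pose F (k : nat) : set R := [set` `[r / k.+2%:R, r]] `|` [set` `[- r, - (r / k.+2%:R)]].
have rk k : 0 < r / k.+2%:R :> R by rewrite divr_gt0 // ltr0n.
have rk1 k : r / k.+2%:R < r by rewrite ltr_pdivrMr ?ltr0n // ltr_pMr // ltr1n.
have mF k : measurable (F k) by apply: measurableU; exact: measurable_itv.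
have mp D : measurable_fun D (fun x : R => (`|x| `^ (- b))%:E).
  by apply: measurable_funTS; apply/measurable_EFinP; exact: measurable_powR_norm.
have nF : nondecreasing_seq F.
  apply/nondecreasing_seqP => k; apply/subsetPset => x; rewrite /F /= !in_itv /=.
  have h : r / k.+3%:R <= r / k.+2%:R :> R.
    by rewrite ler_pM2l // lef_pV2 ?posrE ?ltr0n // ler_nat.
  case=> /andP[h1 h2]; [left|right].
    by rewrite h2 (le_trans h h1).
  by rewrite h1 /= (le_trans h2) // lerN2.
have cv : (\int[mu]_(x in F i) (`|x| `^ (- b))%:E)%E @[i --> \oo] -->
    (\int[mu]_(x in \bigcup_i F i) (`|x| `^ (- b))%:E)%E.
  apply: ge0_nondecreasing_set_cvg_integral; [exact: nF|exact: mF|by move=> i; exact: mp|].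
  by move=> i x _; rewrite lee_fin powR_ge0.
have -> : (\int[mu]_(x in [set x | (`|x| <= r)%R]) (`|x| `^ (- b))%:E =
   \int[mu]_(x in \bigcup_i F i) (`|x| `^ (- b))%:E)%E.
  have e : [set x | (`|x| <= r)%R] = (\bigcup_i F i) `|` [set 0].
    apply/seteqP; split => x /=.
      have [->|x0 xr] := eqVneq x 0; first by right.
      left; exists (Num.truncn (r / `|x|)) => //.
      have x1 : 0 < `|x| by rewrite normr_gt0.
      have h : r / (Num.truncn (r / `|x|)).+2%:R <= `|x|.
        rewrite ler_pdivrMr ?ltr0n // mulrC -ler_pdivrMr //.
        by apply: le_trans (ltW (truncnS_gt _)) _; rewrite ler_nat.
      case: (ltrP x 0) => xs; [right|left]; rewrite /= in_itv /=; move: h xr.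
        rewrite ltr0_norm // lerNr => h1; rewrite lerNl => h2.
        by rewrite h1 h2.
      by rewrite ger0_norm // => -> ->.
    case=> [[k _ [|]]|->]; rewrite /= ?normr0 ?(ltW r0) // in_itv /= => /andP[h1 h2].
      by rewrite ger0_norm // (le_trans _ h1) // ltW.
    have x0 : x <= 0 by apply: (le_trans h2); rewrite oppr_le0 ltW.
    by rewrite ler0_norm // lerNl.
  rewrite e integral_setU_EFin //=.
  - by rewrite integral_set1 adde0.
  - by apply: bigcup_measurable => k _; exact: mF.
  - by apply: measurable_funTS; exact: measurable_powR_norm.
  - apply/disj_setPS => x [[k _ Fk]] x0; move: Fk; rewrite /F /= x0 !in_itv /=.
    case=> /andP[h1 h2]; have := rk k; first by rewrite ltNge h1.
    by move: h2; rewrite lerNr oppr0 => h2; rewrite ltNge h2.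
apply: (cvge_to_le cv); apply: nearW => k.
rewrite /F integral_setU_EFin //=.
- rewrite integral_powR_piece // integral_powR_piece_neg // -EFinD lee_fin -mulrDl.
  rewrite ler_pM2r ?invr_gt0 //.
  by have := powR_ge0 (r / k.+2%:R) (1 - b); lra.
- by apply: measurable_funTS; exact: measurable_powR_norm.
- apply/disj_setPS => x [] /=; rewrite !in_itv /= => /andP[h1 _] /andP[_ h2].
  have h : (r / k.+2%:R <= - (r / k.+2%:R))%R by exact: (le_trans h1 h2).
  by move: h; rewrite leNgt (lt_trans _ (rk k)) // oppr_lt0 rk.
Qed.

Lemma integ_powR (b : R) : b < 1 -> integ (fun t => `|t| `^ (- b)).
Proof.
move=> b1; have mp D : measurable_fun D (fun x : R => (`|x| `^ (- b))%:E).
  by apply: measurable_funTS; apply/measurable_EFinP; exact: measurable_powR_norm.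
apply/integrableP; split; first exact: mp.
apply: (@le_lt_trans _ _ (\int[mu]_(x in [set x | (`|x| <= pi)%R]) (`|x| `^ (- b))%:E)%E).
  under eq_integral do rewrite /= ger0_norm ?powR_ge0 //.
  apply: ge0_subset_integral => //=;
    [exact: measurable_Ipi|exact: measurable_ball_norm|exact: mp|exact: Ipi_norm].
by apply: le_lt_trans (integral_powR_ball b1 (pi_gt0 R)) _; rewrite ltry.
Qed.

Lemma integ_powR_ball (b r : R) : b < 1 -> integ (fun t => (`|t| <= r)%R%:R * `|t| `^ (- b)).
Proof.
move=> b1; apply: (@integM _ _ 1 (integ_powR b1)) => [|t _].
  exact: measurable_ball_indic.
by case: (`|t| <= r); rewrite ?normr1 ?normr0 ?ler01.
Qed.

Lemma I_powR_ball (b r : R) : b < 1 -> 0 < r ->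
  I (fun t => (`|t| <= r)%R%:R * `|t| `^ (- b)) <= 2 * r `^ (1 - b) / (1 - b).
Proof.
move=> b1 r0; have mp D : measurable_fun D (fun x : R => (`|x| `^ (- b))%:E).
  by apply: measurable_funTS; apply/measurable_EFinP; exact: measurable_powR_norm.
rewrite -lee_fin; apply: le_trans (integral_powR_ball b1 r0).
rewrite /Rintegral fineK; last by apply: integrable_fin_num; [exact: measurable_Ipi|exact: integ_powR_ball].
have -> : (\int[mu]_(t in @Ipi R) ((`|t| <= r)%R%:R * `|t| `^ (- b))%:E =
    \int[mu]_(t in @Ipi R `&` [set x | (`|x| <= r)%R]) (`|t| `^ (- b))%:E)%E.
  rewrite integral_mkcondr; apply: eq_integral => t _; rewrite patchE.
  case: ifPn; rewrite ?inE ?notin_setE /=; first by move=> ->; rewrite mul1r.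
  by move=> /negP/negbTE ->; rewrite mul0r.
apply: ge0_subset_integral => //=.
- by apply: measurableI; [exact: measurable_Ipi|exact: measurable_ball_norm].
- exact: measurable_ball_norm.
- exact: mp.
Qed.

End Torus.

(** * Toeplitz forms and Fejér kernels *)

Section Kernels.
Variable R : realType.
Notation mu := (@lebesgue_measure R).
Notation I h := (Rintegral mu (@Ipi R) h).
Notation integ h := (mu.-integrable (@Ipi R) (EFin \o h)).

Definition ctrig n (x : 'cV[R]_n) (t : R) := \sum_(j < n) x j ord0 * cos (j%:R * t).
Definition strig n (x : 'cV[R]_n) (t : R) := \sum_(j < n) x j ord0 * sin (j%:R * t).
Definition dirichlet_sq n (u : R) := \sum_(j < n) \sum_(k < n) cos ((j%:R - k%:R) * u).
(* Summing over [t] and [-t] keeps the kernel real for the cosine-only Fourier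
   coefficients; it reproduces even functions only. *)
Definition fejer_sum n (t s : R) :=
  \sum_(j < n) \sum_(k < n) cos ((j%:R - k%:R) * t) * cos ((j%:R - k%:R) * s).

Lemma twopi_gt0 : 0 < 2 * pi :> R.
Proof. by rewrite mulr_gt0 // pi_gt0. Qed.

Lemma twopi_neq0 : 2 * pi != 0 :> R.
Proof. exact: lt0r_neq0 twopi_gt0. Qed.

Lemma natB_int (j k : nat) : ((j%:Z - k%:Z)%:~R : R) = j%:R - k%:R.
Proof. by rewrite rmorphB. Qed.

Lemma trig_prodE n (x y : 'cV[R]_n) t :
  \sum_(j < n) \sum_(k < n) x j ord0 * y k ord0 * cos ((j%:R - k%:R) * t) =
  ctrig x t * ctrig y t + strig x t * strig y t.
Proof.
rewrite /ctrig /strig !mulr_suml -big_split /=; apply: eq_bigr => j _.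
rewrite !mulr_sumr -big_split /=; apply: eq_bigr => k _.
by rewrite mulrBl cosB; ring.
Qed.

Lemma dirichlet_sqE n u :
  dirichlet_sq n u = (\sum_(j < n) cos (j%:R * u)) ^+ 2 + (\sum_(j < n) sin (j%:R * u)) ^+ 2.
Proof.
have := trig_prodE (const_mx 1 : 'cV[R]_n) (const_mx 1) u.
rewrite /ctrig /strig /dirichlet_sq.
under eq_bigr do under eq_bigr do rewrite !mxE !mul1r.
move=> ->; rewrite !expr2.
have e (f : R -> R) : \sum_(j < n) (const_mx 1 : 'cV[R]_n) j ord0 * f (j%:R * u) = \sum_(j < n) f (j%:R * u).
  by apply: eq_bigr => j _; rewrite mxE mul1r.
by rewrite !e.
Qed.

Lemma dirichlet_sq_ge0 n u : 0 <= dirichlet_sq n u.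
Proof. by rewrite dirichlet_sqE addr_ge0 // sqr_ge0. Qed.

Lemma dirichlet_sq_le n u : dirichlet_sq n u <= n%:R ^+ 2.
Proof.
apply: (@le_trans _ _ (\sum_(j < n) \sum_(k < n) 1)).
  by apply: ler_sum => j _; apply: ler_sum => k _; exact: cos_le1.
by rewrite !sumr_const card_ord -mulrnA expr2 -natrM.
Qed.

Lemma versineE (u : R) : 2 - 2 * cos u = (2 * sin (u / 2)) ^+ 2.
Proof.
have e : u = (u / 2) *+ 2 by rewrite -mulr_natr; field.
rewrite [in LHS]e cos_mulr2n exprMn sin2cos2 -mulr_natr; ring.
Qed.

Lemma versine_dirichlet_sq n u : (2 - 2 * cos u) * dirichlet_sq n u <= 8.
Proof.
rewrite versineE dirichlet_sqE; set v := u / 2.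
have uv : u = 2 * v by rewrite /v; field.
have ec : 2 * sin v * (\sum_(j < n) cos (j%:R * u)) = sin (n%:R * u - v) + sin v.
  elim: n => [|n IH]; first by rewrite big_ord0 mulr0 mul0r sub0r sinN addNr.
  rewrite big_ord_recr /= mulrDr IH.
  have -> : n.+1%:R * u - v = n%:R * u + v by rewrite -natr1 uv; ring.
  by rewrite sinB sinD; ring.
have es : 2 * sin v * (\sum_(j < n) sin (j%:R * u)) = cos v - cos (n%:R * u - v).
  elim: n {ec} => [|n IH]; first by rewrite big_ord0 mulr0 mul0r sub0r cosN subrr.
  rewrite big_ord_recr /= mulrDr IH.
  have -> : n.+1%:R * u - v = n%:R * u + v by rewrite -natr1 uv; ring.
  by rewrite cosB cosD; ring.
rewrite mulrDr -!exprMn ec es.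
have b (x y : R) : `|x| <= 1 -> `|y| <= 1 -> (x + y) ^+ 2 <= 4.
  move=> hx hy; have : `|x + y| <= 2 by apply: (le_trans (ler_normD _ _)); lra.
  rewrite -(real_normK (num_real (x + y))); have := normr_ge0 (x + y); nra.
have h1 := b _ _ (norm_sin_le1 (n%:R * u - v)) (norm_sin_le1 v).
have h2 : (cos v - cos (n%:R * u - v)) ^+ 2 <= 4.
  by apply: b; rewrite ?normrN norm_cos_le1.
lra.
Qed.

Lemma fejer_sumE n t s : fejer_sum n t s = (dirichlet_sq n (t - s) + dirichlet_sq n (t + s)) / 2.
Proof.
rewrite /fejer_sum /dirichlet_sq -big_split /= mulr_suml; apply: eq_bigr => j _.
rewrite -big_split /= mulr_suml; apply: eq_bigr => k _.
by rewrite mulrBr mulrDr cosB cosD; field.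
Qed.

Lemma fejer_sum_ge0 n t s : 0 <= fejer_sum n t s.
Proof. by rewrite fejer_sumE divr_ge0 // addr_ge0 // dirichlet_sq_ge0. Qed.

Lemma fejer_sum_le n t s : fejer_sum n t s <= n%:R ^+ 2.
Proof.
by rewrite fejer_sumE; have := dirichlet_sq_le n (t - s); have := dirichlet_sq_le n (t + s); lra.
Qed.

Lemma measurable_fejer_sum n t D : measurable_fun D (fejer_sum n t).
Proof.
apply: measurable_sum => j; apply: measurable_sum => k; apply: measurable_funM => //.
exact: measurable_cosMl.
Qed.

Lemma integ_cosM (c : R) f : integ f -> integ (fun t => cos (c * t) * f t).
Proof.
move=> i; apply: (@integM _ _ _ 1 i); first exact: measurable_cosMl.
by move=> t _; exact: norm_cos_le1.
Qed.

Lemma toeplitz_sum n (a : 'I_n -> 'I_n -> R) f : integ f ->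
  \sum_j \sum_k a j k * toeplitz n f j k =
  (2 * pi)^-1 * I (fun t => (\sum_(j < n) \sum_(k < n) a j k * cos ((j%:R - k%:R) * t)) * f t).
Proof.
move=> i.
have ij j k : integ (fun t => a j k * (cos ((j%:R - k%:R) * t) * f t)).
  by apply: integZ; exact: integ_cosM.
transitivity ((2 * pi)^-1 * I (fun t => \sum_(j < n) \sum_(k < n) a j k * (cos ((j%:R - k%:R) * t) * f t))).
  rewrite I_sum; last by move=> j; exact: integ_sum.
  rewrite mulr_sumr; apply: eq_bigr => j _.
  rewrite I_sum // mulr_sumr; apply: eq_bigr => k _.
  rewrite mxE /fourier_coef I_Z; last exact: integ_cosM.
  by rewrite mulrCA; congr (_ * (_ * _)); apply: eq_I => t _; rewrite natB_int.
congr (_ * _); apply: eq_I => t _; rewrite mulr_suml; apply: eq_bigr => j _.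
by rewrite mulr_suml; apply: eq_bigr => k _; rewrite mulrA.
Qed.

Lemma toeplitz1 n : toeplitz n (fun=> 1) = 1%:M :> 'M[R]_n.
Proof.
apply/matrixP => j k; rewrite !mxE /fourier_coef.
have -> : I (fun t => cos ((j%:Z - k%:Z)%:~R * t) * 1) = 2 * pi * (j%:Z - k%:Z == 0)%:R.
  by rewrite -I_cos; apply: eq_I => t _; rewrite mulr1.
by rewrite mulKf ?twopi_neq0 // subr_eq0 eqz_nat.
Qed.

Lemma toeplitz_sym n f : integ f -> (toeplitz n f)^T = toeplitz n f :> 'M[R]_n.
Proof.
move=> i; apply/matrixP => j k; rewrite !mxE /fourier_coef; congr (_ * _).
by apply: eq_I => t _; rewrite -opprB rmorphN mulNr cosN.
Qed.

Lemma bform_toeplitz n f (x y : 'cV[R]_n) : integ f ->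
  bform (toeplitz n f) x y = (2 * pi)^-1 * I (fun t => (ctrig x t * ctrig y t + strig x t * strig y t) * f t).
Proof.
move=> i; rewrite bformE.
under eq_bigr do under eq_bigr do rewrite mulrAC.
rewrite toeplitz_sum //; congr (_ * _); apply: eq_I => t _.
by rewrite trig_prodE.
Qed.

Lemma measurable_ctrig n (x : 'cV[R]_n) D : measurable_fun D (ctrig x).
Proof. by apply: measurable_sum => j; apply: measurable_funM => //; exact: measurable_cosMl. Qed.

Lemma measurable_strig n (x : 'cV[R]_n) D : measurable_fun D (strig x).
Proof.
apply: measurable_sum => j; apply: measurable_funM => //.
by apply: measurable_funTS; apply: continuous_measurable_fun; exact: continuous_sinMl.
Qed.

Lemma trig_sq_le n (x : 'cV[R]_n) t : ctrig x t ^+ 2 + strig x t ^+ 2 <= n%:R * sqn x.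
Proof.
rewrite !expr2 -trig_prodE.
apply: (@le_trans _ _ (\sum_(j < n) \sum_(k < n) (x j ord0 ^+ 2 + x k ord0 ^+ 2) / 2)).
  apply: ler_sum => j _; apply: ler_sum => k _.
  apply: (@le_trans _ _ `|x j ord0 * x k ord0|).
    apply: (le_trans (ler_norm _)); rewrite normrM ler_piMr //; exact: norm_cos_le1.
  rewrite normrM -(real_normK (num_real (x j ord0))) -(real_normK (num_real (x k ord0))).
  have := sqr_ge0 (`|x j ord0| - `|x k ord0|); nra.
under eq_bigr do rewrite -mulr_suml big_split /= sumr_const card_ord -/(sqn x).
rewrite -mulr_suml big_split /= sumr_const card_ord sumrMnl -/(sqn x).
rewrite -!(mulr_natl (sqn x)); move: (sqn x) (n%:R : R) => q m; lra.
Qed.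

Lemma trig_bound n (x : 'cV[R]_n) : exists C, forall t,
  `|ctrig x t| <= C /\ `|strig x t| <= C.
Proof.
exists (n%:R * sqn x + 1) => t; have h := trig_sq_le x t.
have b (a c : R) : a ^+ 2 + c ^+ 2 <= n%:R * sqn x -> `|a| <= n%:R * sqn x + 1.
  have := sqr_ge0 c; rewrite -(real_normK (num_real a)); have := sqr_ge0 (`|a| - 1 / 2); nra.
by split; [exact: (b _ _ h)|apply: (b _ (ctrig x t)); rewrite addrC].
Qed.

Lemma integ_trig n f (x y : 'cV[R]_n) : integ f ->
  integ (fun t => (ctrig x t * ctrig y t + strig x t * strig y t) * f t).
Proof.
move=> i; have [C hC] := trig_bound x; have [C' hC'] := trig_bound y.
apply: (@integM _ _ _ (C * C' + C * C') i).
  by apply: measurable_funD; apply: measurable_funM; (exact: measurable_ctrig || exact: measurable_strig).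
move=> t _; have [c1 s1] := hC t; have [c2 s2] := hC' t.
by apply: (le_trans (ler_normD _ _)); rewrite !normrM lerD // ler_pM.
Qed.

Lemma parseval n (x y : 'cV[R]_n) :
  (x^T *m y) ord0 ord0 = (2 * pi)^-1 * I (fun t => ctrig x t * ctrig y t + strig x t * strig y t).
Proof.
have := bform_toeplitz x y (integ_cst (1 : R)); rewrite toeplitz1 /bform mulmx1 => ->.
by congr (_ * _); apply: eq_I => t _; rewrite mulr1.
Qed.

Lemma trace_toeplitz n (M : 'M[R]_n) f : integ f ->
  \tr (M *m toeplitz n f) =
  (2 * pi)^-1 * I (fun t => (\sum_(j < n) \sum_(k < n) M j k * cos ((j%:R - k%:R) * t)) * f t).
Proof.
move=> i; rewrite -toeplitz_sum //; apply: eq_bigr => j _; rewrite mxE; apply: eq_bigr => k _.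
by rewrite -[in RHS](toeplitz_sym n i) [in RHS]mxE.
Qed.

Definition fejer n (h : R -> R) (t : R) := (2 * pi)^-1 * n%:R^-1 * I (fun s => fejer_sum n t s * h s).

Lemma integ_fejer n t h : integ h -> integ (fun s => fejer_sum n t s * h s).
Proof.
move=> i; apply: (@integM _ _ _ (n%:R ^+ 2) i); first exact: measurable_fejer_sum.
by move=> s _; rewrite ger0_norm ?fejer_sum_ge0 // fejer_sum_le.
Qed.

Lemma I_fejer_sum n t : I (fejer_sum n t) = 2 * pi * n%:R.
Proof.
have ij (j k : 'I_n) : integ (fun s : R => cos ((j%:R - k%:R) * t) * cos ((j%:R - k%:R) * s)).
  by apply: integZ; rewrite -natB_int; exact: integ_cos.
rewrite /fejer_sum I_sum; last by move=> j; exact: integ_sum.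
transitivity (\sum_(j < n) (2 * pi : R)); last by rewrite sumr_const card_ord mulr_natr.
apply: eq_bigr => j _; rewrite I_sum // (bigD1 j) //= big1 => [|k kj].
  rewrite addr0 I_Z; last by rewrite -natB_int; exact: integ_cos.
  rewrite subrr mul0r cos0 mul1r; under eq_Rintegral do rewrite mul0r cos0.
  by rewrite I_cst mulr1.
rewrite I_Z; last by rewrite -natB_int; exact: integ_cos.
rewrite -natB_int I_cos; have -> : (j%:Z - k%:Z == 0) = false.
  by rewrite subr_eq0 eqz_nat eq_sym; exact: negbTE.
by rewrite !mulr0.
Qed.

Lemma fejer_mulE n h t : (0 < n)%N ->
  n%:R * fejer n h t = (2 * pi)^-1 * I (fun s => fejer_sum n t s * h s).
Proof.
by move=> n0; rewrite /fejer [(2 * pi)^-1 * _]mulrC -mulrA mulVKf // pnatr_eq0 -lt0n.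
Qed.

Lemma bform_const_col n f t : integ f ->
  bform (toeplitz n f) (\col_(j < n) cos (j%:R * t)) (\col_(j < n) cos (j%:R * t)) +
  bform (toeplitz n f) (\col_(j < n) sin (j%:R * t)) (\col_(j < n) sin (j%:R * t)) =
  (2 * pi)^-1 * I (fun s => fejer_sum n t s * f s).
Proof.
move=> i; rewrite !bformE -big_split /=.
transitivity (\sum_(j < n) \sum_(k < n) cos ((j%:R - k%:R) * t) * toeplitz n f j k).
  apply: eq_bigr => j _; rewrite -big_split /=; apply: eq_bigr => k _.
  by rewrite !(mxE _ (fun i0 _ => _)) mulrBl cosB; ring.
by rewrite toeplitz_sum.
Qed.

Lemma sqn_const_col n (t : R) :
  sqn (\col_(j < n) cos (j%:R * t)) + sqn (\col_(j < n) sin (j%:R * t)) = n%:R.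
Proof.
rewrite /sqn -big_split /= (eq_bigr (fun=> 1)) ?sumr_const ?card_ord // => j _.
by rewrite !mxE cos2Dsin2.
Qed.

(* e(t)^* M e(t) with e(t) = (exp(i j t))_j, for symmetric M. *)
Definition christoffel n (M : 'M[R]_n) t : R :=
  bform M (\col_(j < n) cos (j%:R * t)) (\col_(j < n) cos (j%:R * t)) +
  bform M (\col_(j < n) sin (j%:R * t)) (\col_(j < n) sin (j%:R * t)).

Lemma christoffelE n (M : 'M[R]_n) t :
  christoffel M t = \sum_(j < n) \sum_(k < n) M j k * cos ((j%:R - k%:R) * t).
Proof.
rewrite /christoffel !bformE -big_split /=; apply: eq_bigr => j _.
rewrite -big_split /=; apply: eq_bigr => k _.
by rewrite !(mxE _ (fun i0 _ => _)) mulrBl cosB; ring.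
Qed.

Lemma christoffel_lower n f t (A := toeplitz n f) : (0 < n)%N -> integ f ->
  (forall x, x != 0 -> 0 < bform A x x) ->
  n%:R <= christoffel (invmx A) t * fejer n f t.
Proof.
move=> n0 i pA.
have nR : (0 : R) < n%:R by rewrite ltr0n.
set c := \col_(j < n) cos (j%:R * t); set s := \col_(j < n) sin (j%:R * t).
have sA : A^T = A by exact: toeplitz_sym.
have uA : A \in unitmx.
  rewrite unitmxE unitfE; apply/negP => /eqP /eqP /det0P [w w0 wA].
  have := pA w^T; rewrite trmx_eq0 => /(_ w0).
  by rewrite /bform trmxK wA mul0mx mxE ltxx.
have A0 x : 0 <= bform A x x.
  by have [->|/pA/ltW //] := eqVneq x 0; rewrite /bform mulmx0 mxE.
have key l x : 0 <= bform A x x - 2 * l * sqn x + l ^+ 2 * bform (invmx A) x x.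
  have := A0 (x - l *: (invmx A *m x)).
  rewrite -scaleN1r !bformDl !bformDr !bformZl !bformZr.
  have -> : bform A x (invmx A *m x) = sqn x.
    by rewrite /bform mulmxA mulmxK // -sqnE.
  have -> : bform A (invmx A *m x) x = sqn x.
    by rewrite /bform trmx_mul trmx_inv sA mulmxKV // -sqnE.
  have -> : bform A (invmx A *m x) (invmx A *m x) = bform (invmx A) x x.
    by rewrite /bform trmx_mul trmx_inv sA mulmxKV // mulmxA.
  by move=> h; apply: (le_trans h); rewrite le_eqVlt; apply/orP; left; apply/eqP; ring.
pose a := bform A c c + bform A s s.
have aE : a = n%:R * fejer n f t.
  by rewrite /a /A bform_const_col // fejer_mulE.
have := key (a / n%:R) c; have := key (a / n%:R) s; have := sqn_const_col n t.
rewrite -/c -/s => e h1 h2.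
have a0 : 0 < a.
  have [c0|c0] := eqVneq c 0; last by rewrite ltr_wpDr // pA.
  have [s0|s0] := eqVneq s 0; last by rewrite ltr_wpDl // pA.
  move: e; rewrite c0 s0; have /eqP -> : sqn (0 : 'cV[R]_n) == 0 by rewrite sqn_eq0.
  by rewrite addr0 => e; move: nR; rewrite -e ltxx.
have h : 0 <= a - 2 * (a / n%:R) * n%:R + (a / n%:R) ^+ 2 * christoffel (invmx A) t.
  move: (a / n%:R) h1 h2 => l h1 h2; rewrite -e /christoffel -/c -/s /a.
  by apply: (le_trans (addr_ge0 h2 h1)); rewrite le_eqVlt; apply/orP; left; apply/eqP; ring.
have : 0 <= a / n%:R * (christoffel (invmx A) t * (a / n%:R) - n%:R).
  by apply: (le_trans h); rewrite le_eqVlt; apply/orP; left; apply/eqP; field; rewrite gt_eqF.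
rewrite pmulr_rge0 ?divr_gt0 // subr_ge0 aE mulrAC mulfV ?mul1r //.
by rewrite gt_eqF.
Qed.

Lemma christoffel_upper n f t (A := toeplitz n f) : integ f -> integ (fun s => (f s)^-1) ->
  (forall s, Ipi s -> s != 0 -> 0 < f s) ->
  (forall x, x != 0 -> 0 < bform A x x) ->
  christoffel (invmx A) t <= n%:R * fejer n (fun s => (f s)^-1) t.
Proof.
move=> i i' f0 pA.
have sA : A^T = A by exact: toeplitz_sym.
have uA : A \in unitmx.
  rewrite unitmxE unitfE; apply/negP => /eqP /eqP /det0P [w w0 wA].
  have := pA w^T; rewrite trmx_eq0 => /(_ w0).
  by rewrite /bform trmxK wA mul0mx mxE ltxx.
have key (x : 'cV[R]_n) : bform (invmx A) x x <= bform (toeplitz n (fun s => (f s)^-1)) x x.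
  pose y := invmx A *m x.
  have e1 : bform A y y = bform (invmx A) x x.
    by rewrite /bform trmx_mul trmx_inv sA mulmxKV // mulmxA.
  have e2 : (y^T *m x) ord0 ord0 = bform (invmx A) x x.
    by rewrite /bform trmx_mul trmx_inv sA.
  suff : 2 * (y^T *m x) ord0 ord0 <= bform A y y + bform (toeplitz n (fun s => (f s)^-1)) x x.
    by rewrite e1 e2 mulr2n mulrDl mul1r lerD2l.
  have ixy : integ (fun t => ctrig y t * ctrig x t + strig y t * strig x t).
    have := integ_trig y x (integ_cst (1 : R)).
    by under eq_fun do rewrite mulr1.
  rewrite parseval /A !bform_toeplitz // mulrCA -mulrDr ler_pM2l ?invr_gt0 ?mulr_gt0 ?pi_gt0 //.
  rewrite -I_Z // -RintegralD; [|exact: measurable_Ipi|exact: integ_trig|exact: integ_trig].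
  apply: le_I_off0; [exact: integZ|by apply: integD; exact: integ_trig|].
  move=> s Is s0; have fs := f0 s Is s0.
  have b (u v : R) : 2 * (u * v) <= u ^+ 2 * f s + v ^+ 2 * (f s)^-1.
    rewrite -subr_ge0.
    have -> : u ^+ 2 * f s + v ^+ 2 * (f s)^-1 - 2 * (u * v) = (u * f s - v) ^+ 2 / f s.
      by field; rewrite gt_eqF.
    by rewrite divr_ge0 ?sqr_ge0 // ltW.
  have := lerD (b (ctrig y s) (ctrig x s)) (b (strig y s) (strig x s)).
  rewrite -mulrDr => /le_trans; apply; rewrite le_eqVlt; apply/orP; left; apply/eqP; ring.
have := key (\col_(j < n) cos (j%:R * t)); have := key (\col_(j < n) sin (j%:R * t)).
have := bform_const_col n t i'; rewrite /christoffel /fejer.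
set X := bform _ _ _; set Y := bform _ _ _ => e h1 h2.
have [n0|n0] := posnP n.
  have z (M : 'M[R]_n) (x : 'cV[R]_n) : bform M x x = 0.
    by rewrite bformE; subst n; rewrite big_ord0.
  by rewrite !z n0 mul0r addr0.
have := fejer_mulE (fun s => (f s)^-1) t n0; rewrite /fejer => ->.
by rewrite -e addrC [leRHS]addrC; exact: lerD.
Qed.

End Kernels.

Section Fejer.
Variable R : realType.
Notation mu := (@lebesgue_measure R).
Notation I h := (Rintegral mu (@Ipi R) h).
Notation integ h := (mu.-integrable (@Ipi R) (EFin \o h)).

Lemma invr_powR (x b : R) : 0 <= x -> x^-1 `^ b = x `^ (- b).
Proof. by move=> x0; rewrite -powR_inv1 // -powRrM mulN1r. Qed.

Lemma le_norm_I (h : R -> R) : integ h -> `|I h| <= I (fun t => `|h t|).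
Proof. by move=> ih; apply: le_normr_Rintegral => //; exact: measurable_Ipi. Qed.

Lemma cos_le_decr (x y : R) : 0 <= x -> x <= y -> y <= pi -> cos y <= cos x.
Proof.
move=> x0 xy ypi; rewrite le_eqVlt; have [->|nxy] := eqVneq x y; first by rewrite eqxx.
apply/orP; right; rewrite ltr_cos ?in_itv /= ?x0 ?ypi ?(le_trans x0) ?(le_trans xy) //.
by rewrite lt_neqAle nxy.
Qed.

Lemma sin_ge_linear (a x : R) : 0 <= x -> x <= a -> a <= pi -> cos a * x <= sin x.
Proof.
move=> x0 xa api; have [->|nx] := eqVneq x 0; first by rewrite mulr0 sin0.
have xp : 0 < x by rewrite lt_def nx.
have [c cx] := @MVT R sin cos 0 x xp (fun y _ => is_derive_sin y)
  (continuous_subspaceT (@continuous_sin R)).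
rewrite sin0 !subr0 => ->; rewrite ler_wpM2r //; move: cx; rewrite in_itv /= => /andP[c0 cx].
by apply: cos_le_decr; rewrite ?(ltW c0) // (le_trans (ltW cx)).
Qed.

Lemma versine_lb : exists2 k : R, 0 < k &
  forall u, `|u| <= 3 * pi / 2 -> k * u ^+ 2 <= 2 - 2 * cos u.
Proof.
have p0 := pi_gt0 R.
pose c : R := cos (3 * pi / 8).
have c0 : 0 < c by apply: cos_gt0_pihalf; apply/andP; split; lra.
exists (c ^+ 4); first by rewrite exprn_gt0.
move=> u hu; rewrite -cos_norm versineE -(real_normK (num_real u)).
move: (normr_ge0 u) hu; move: `|u| => w w0 hu.
have h1 : c * (w / 4) <= sin (w / 4) by apply: sin_ge_linear; lra.
have h2 : c <= cos (w / 4) by apply: cos_le_decr; lra.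
have e : sin (w / 2) = 2 * (sin (w / 4) * cos (w / 4)).
  have -> : w / 2 = (w / 4) *+ 2 by rewrite -mulr_natr; field.
  by rewrite sin_mulr2n -mulr_natr; ring.
have cw : 0 <= c * (w / 4) by rewrite mulr_ge0 ?(ltW c0) //; lra.
have h3 : c ^+ 2 * w <= 2 * sin (w / 2).
  rewrite e; have : c * (w / 4) * c <= sin (w / 4) * cos (w / 4) by apply: ler_pM => //; exact: ltW.
  have -> : c ^+ 2 * w = 4 * (c * (w / 4) * c) by field.
  lra.
have -> : c ^+ 4 * w ^+ 2 = (c ^+ 2 * w) ^+ 2 by ring.
rewrite ler_pXn2r // ?nnegrE; first by rewrite mulr_ge0 // sqr_ge0.
by apply: le_trans h3; rewrite mulr_ge0 // sqr_ge0.
Qed.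

Lemma versine_lb_away (eta t : R) : 0 < eta -> `|t| < pi -> exists2 k : R, 0 < k &
  forall u, eta <= `|u| -> `|u| <= pi + `|t| -> k <= 2 - 2 * cos u.
Proof.
move=> e0 tpi; have [k k0 hk] := versine_lb.
have t1 : -1 < cos t.
  have tin : `|t| \in `[0, pi] by rewrite in_itv /= normr_ge0 ltW.
  have pin : pi \in `[0, (pi : R)] by rewrite in_itv /= lexx andbT ltW // pi_gt0.
  by rewrite -cospi -[cos t]cos_norm ltr_cos.
exists (Num.min (k * eta ^+ 2) (2 + 2 * cos t)).
  by rewrite lt_min mulr_gt0 ?exprn_gt0 //=; lra.
move=> u h1 h2; have p0 := pi_gt0 R.
have [up|up] := lerP `|u| (3 * pi / 2).
  rewrite ge_min (le_trans _ (hk u up)) // ler_pM2l // -(real_normK (num_real u)).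
  by rewrite ler_pXn2r ?nnegrE // ltW.
rewrite ge_min; apply/orP; right.
have -> : cos u = - cos (`|u| - pi).
  by rewrite -[in LHS]cos_norm -[in LHS](subrK pi `|u|) cosDpi.
have : cos t <= cos (`|u| - pi) by rewrite -(cos_norm t); apply: cos_le_decr; lra.
lra.
Qed.

Lemma fejer_cvg (h : R -> R) (t : R) : integ h -> `|t| < pi -> {for t, continuous h} ->
  (forall s, `|s| < pi -> h (- s) = h s) -> (fun n => fejer n h t) @ \oo --> h t.
Proof.
move=> ih tpi ct ev; apply/cvgrPdist_le => eps e0.
have e20 : 0 < eps / 2 by rewrite divr_gt0.
have [e1 /= e10 He] := (cvgrPdist_le _ _).1 ct _ e20.
pose eta := Num.min e1 (pi - `|t|).
have eta0 : 0 < eta by rewrite lt_min e10 subr_gt0.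
have hnear s : `| `|s| - `|t| | < eta -> `|h s - h t| <= eps / 2.
  move=> hs; have sp : `|s| < pi.
    have : `|s| - `|t| < pi - `|t|.
      by apply: (le_lt_trans (ler_norm _)); apply: (lt_le_trans hs); rewrite ge_min lexx orbT.
    by rewrite ltrD2r.
  have he1 : `| `|s| - `|t| | < e1 by apply: (lt_le_trans hs); rewrite ge_min lexx.
  have [st|st] : `|t - s| = `| `|s| - `|t| | \/ `|t - (- s)| = `| `|s| - `|t| |.
    case: (lerP 0 s) => s0; case: (lerP 0 t) => t0.
    - by left; rewrite (ger0_norm s0) (ger0_norm t0) distrC.
    - by right; rewrite (ger0_norm s0) (ltr0_norm t0) !opprK addrC.
    - by right; rewrite (ltr0_norm s0) (ger0_norm t0) opprK -opprD normrN addrC.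
    - by left; rewrite (ltr0_norm s0) (ltr0_norm t0) opprK addrC.
  - by rewrite distrC; apply: He; rewrite /ball_ /= st.
  - by rewrite -ev // distrC; apply: He; rewrite /ball_ /= st.
have [k k0 hk] := versine_lb_away eta0 tpi.
have hfar n s : Ipi s -> eta <= `| `|s| - `|t| | -> fejer_sum n t s <= 8 / k.
  move=> Is hs; have sp := Ipi_norm Is.
  have D u : eta <= `|u| -> `|u| <= pi + `|t| -> dirichlet_sq n u <= 8 / k.
    move=> h1 h2; rewrite ler_pdivlMr // mulrC; apply: le_trans (versine_dirichlet_sq n u).
    by rewrite ler_wpM2r ?dirichlet_sq_ge0 // hk.
  have d1 : dirichlet_sq n (t - s) <= 8 / k.
    apply: D.
      by apply: (le_trans hs); rewrite distrC; exact: ler_dist_dist.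
    by apply: (le_trans (ler_normB _ _)); rewrite addrC lerD2r.
  have d2 : dirichlet_sq n (t + s) <= 8 / k.
    apply: D.
      by apply: (le_trans hs); rewrite distrC -(normrN s) -{2}(opprK s); exact: ler_dist_dist.
    by apply: (le_trans (ler_normD _ _)); rewrite addrC lerD2r.
  by rewrite fejer_sumE; lra.
pose J := I (fun s => `|h s - h t|).
have ihc : integ (fun s => h s - h t).
  by have := integD ih (integ_cst (- h t)).
have iJ : integ (fun s => `|h s - h t|) by exact: (integrable_norm ihc).
have J0 : 0 <= J by apply: Rintegral_ge0.
near=> n.
have n0 : (0 < n)%N by near: n; exact: nbhs_infty_gt.
have nR : (0 : R) < n%:R by rewrite ltr0n.
have e : n%:R * (h t - fejer n h t) = (2 * pi)^-1 * I (fun s => fejer_sum n t s * - (h s - h t)).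
  rewrite mulrBr fejer_mulE //.
  have -> : I (fun s => fejer_sum n t s * - (h s - h t)) =
      I (fun s => fejer_sum n t s * h t) - I (fun s => fejer_sum n t s * h s).
    rewrite -RintegralB; [|exact: measurable_Ipi|exact: (integ_fejer _ _ (integ_cst _))|exact: integ_fejer].
    by apply: eq_I => s _; ring.
  rewrite RintegralZr ?I_fejer_sum; [|exact: measurable_Ipi|]; last first.
    have := integ_fejer n t (integ_cst (1 : R)).
    by under eq_fun do rewrite mulr1.
  by rewrite [RHS]mulrBr; congr (_ - _); rewrite -(mulrA (2 * pi)) mulKf // twopi_neq0.
have : n%:R * `|h t - fejer n h t| <= n%:R * (eps / 2) + (2 * pi)^-1 * (8 / k * J).
  rewrite -[X in X * `|_|]gtr0_norm // -normrM e normrM gtr0_norm ?invr_gt0 ?twopi_gt0 //.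
  have i1 : integ (fun s => fejer_sum n t s * - (h s - h t)).
    by apply: integ_fejer; have := integZ (- 1) ihc; under eq_fun do rewrite mulN1r.
  apply: (@le_trans _ _ ((2 * pi)^-1 * I (fun s => eps / 2 * fejer_sum n t s + 8 / k * `|h s - h t|))).
    rewrite ler_pM2l ?invr_gt0 ?twopi_gt0 //.
    apply: (le_trans (le_norm_I i1)).
    have iN : integ (fejer_sum n t).
      by have := integ_fejer n t (integ_cst (1 : R)); under eq_fun do rewrite mulr1.
    apply: le_I; [exact: (integrable_norm i1)|by apply: integD; exact: integZ|].
    move=> s Is; rewrite normrM normrN (ger0_norm (fejer_sum_ge0 _ _ _)).
    have [hs|hs] := ltrP `| `|s| - `|t| | eta.
      rewrite mulrC -[leLHS]addr0 lerD //.
        by rewrite ler_wpM2r ?fejer_sum_ge0 // hnear.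
      by rewrite mulr_ge0 // divr_ge0 // ltW.
    rewrite -[leLHS]add0r lerD //.
      by rewrite mulr_ge0 ?fejer_sum_ge0 // ltW.
    by rewrite ler_wpM2r // hfar.
  have iN : integ (fejer_sum n t).
    by have := integ_fejer n t (integ_cst (1 : R)); under eq_fun do rewrite mulr1.
  rewrite RintegralD; [|exact: measurable_Ipi|exact: integZ|exact: integZ].
  rewrite !I_Z // I_fejer_sum mulrDr lerD2r.
  rewrite le_eqVlt; apply/orP; left; apply/eqP.
  by move: (@pi R) (lt0r_neq0 (pi_gt0 R)) => p p1; field.
have : (2 * pi)^-1 * (8 / k * J) <= n%:R * (eps / 2).
  rewrite -ler_pdivrMr //; near: n.
  exists (Num.truncn ((2 * pi)^-1 * (8 / k * J) / (eps / 2))).+1 => // m /= hm.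
  by apply: (le_trans (ltW (truncnS_gt _))); rewrite ler_nat.
move=> h1 h2; rewrite -(ler_pM2l nR).
apply: (le_trans h2); lra.
Unshelve. all: by end_near. Qed.

Lemma fejer_powR_le (b : R) : 0 <= b -> b < 1 -> exists2 C : R, 0 <= C &
  forall n t, (0 < n)%N -> `|t| <= pi -> t != 0 ->
    fejer n (fun s => `|s| `^ (- b)) t <= C * `|t| `^ (- b).
Proof.
move=> b0 b1; have [k k0 hk] := versine_lb.
have B : 0 < 1 - b by rewrite subr_gt0.
pose q : R := Num.sqrt (32 / k).
have q2 : q ^+ 2 = 32 / k by rewrite sqr_sqrtr // divr_ge0 // ltW.
have q0 : 0 <= q by exact: sqrtr_ge0.
pose C : R := (2^-1) `^ (- b) * (1 + (2 * pi)^-1 * (q / (1 - b))).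
exists C.
  rewrite mulr_ge0 ?powR_ge0 // addr_ge0 // mulr_ge0 ?invr_ge0 ?(ltW (twopi_gt0 R)) //.
  by rewrite divr_ge0 // ltW.
move=> n t n0 tpi tn0.
have t0 : 0 < `|t| by rewrite normr_gt0.
have nR : (0 : R) < n%:R by rewrite ltr0n.
have t20 : 0 < `|t| / 2 by rewrite divr_gt0.
have p0 := pi_gt0 R.
have D u : `|t| / 2 <= `|u| -> `|u| <= 3 * `|t| / 2 -> dirichlet_sq n u <= n%:R * (q / `|t|).
  move=> h1 h2.
  have d0 := dirichlet_sq_ge0 n u.
  have hu : k * (`|t| / 2) ^+ 2 * dirichlet_sq n u <= 8.
    apply: le_trans (versine_dirichlet_sq n u); rewrite ler_wpM2r //.
    apply: (le_trans _ (hk u _)); last by apply: (le_trans h2); lra.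
    rewrite ler_pM2l // -(real_normK (num_real u)) ler_pXn2r ?nnegrE // ltW //.
  rewrite -(ler_pXn2r (n := 2)) // ?nnegrE; last by rewrite mulr_ge0 ?divr_ge0.
  rewrite expr2; apply: (@le_trans _ _ (n%:R ^+ 2 * dirichlet_sq n u)).
    by rewrite ler_wpM2r // dirichlet_sq_le.
  rewrite exprMn ler_pM2l ?exprn_gt0 // expr_div_n q2.
  have -> : 32 / k / `|t| ^+ 2 = 8 / (k * (`|t| / 2) ^+ 2) by field; rewrite !gt_eqF.
  by rewrite ler_pdivlMr 1?mulrC // mulr_gt0 // exprn_gt0.
have i1 := integ_fejer n t (integ_powR b1).
have iN : integ (fejer_sum n t).
  by have := integ_fejer n t (integ_cst (1 : R)); under eq_fun do rewrite mulr1.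
have key : I (fun s => fejer_sum n t s * `|s| `^ (- b)) <=
   I (fun s => (`|t| / 2) `^ (- b) * fejer_sum n t s +
      n%:R * (q / `|t|) * ((`|s| <= `|t| / 2)%R%:R * `|s| `^ (- b))).
  apply: le_I => //; first by apply: integD; apply: integZ => //; exact: integ_powR_ball.
  move=> s Is; have [hs|hs] := lerP `|s| (`|t| / 2).
    rewrite mul1r -[leLHS]add0r lerD //; first by rewrite mulr_ge0 ?powR_ge0 ?fejer_sum_ge0.
    rewrite ler_wpM2r ?powR_ge0 // fejer_sumE.
    have a1 : dirichlet_sq n (t - s) <= n%:R * (q / `|t|).
      apply: D.
        by apply: (le_trans _ (lerB_dist _ _)); lra.
      by apply: (le_trans (ler_normB _ _)); lra.
    have a2 : dirichlet_sq n (t + s) <= n%:R * (q / `|t|).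
      apply: D.
        by rewrite -(opprK s); apply: (le_trans _ (lerB_dist _ _)); rewrite normrN; lra.
      by apply: (le_trans (ler_normD _ _)); lra.
    lra.
  rewrite mul0r mulr0 addr0 mulrC ler_wpM2r ?fejer_sum_ge0 //.
  rewrite !powRN lef_pV2 ?posrE ?powR_gt0 //; last exact: lt_trans hs.
  by apply: ge0_ler_powR; rewrite ?nnegrE ?(ltW hs) ?(ltW t20).
rewrite -(ler_pM2l nR) fejer_mulE //.
apply: (@le_trans _ _ ((2 * pi)^-1 * (2 * pi * n%:R * (`|t| / 2) `^ (- b) +
   n%:R * (q / `|t|) * (2 * (`|t| / 2) `^ (1 - b) / (1 - b))))).
  rewrite ler_pM2l ?invr_gt0 ?twopi_gt0 //; apply: (le_trans key).
  rewrite RintegralD; [|exact: measurable_Ipi|exact: integZ|by apply: integZ; exact: integ_powR_ball].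
  rewrite I_Z // I_Z ?I_fejer_sum; last exact: integ_powR_ball.
  apply: lerD; first by rewrite mulrC.
  by rewrite ler_wpM2l ?I_powR_ball // mulr_ge0 ?divr_ge0 ?ler0n.
have -> : (`|t| / 2) `^ (1 - b) = (`|t| / 2) * (`|t| / 2) `^ (- b).
  rewrite powRD; last by apply/implyP => _; rewrite gt_eqF.
  by rewrite powRr1 // ltW.
rewrite powRM ?normr_ge0 ?invr_ge0 // /C.
move: (`|t| `^ (- b)) (2^-1 `^ (- b)) => X Y.
rewrite le_eqVlt; apply/orP; left; apply/eqP.
move: (@pi R) (lt0r_neq0 (pi_gt0 R)) => p p1; field.
by rewrite p1 (gt_eqF B) (gt_eqF t0).
Qed.

Lemma toeplitz_le_powR (b C : R) g : 0 <= b -> b < 1 -> 0 < C -> integ g ->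
  (forall t, Ipi t -> t != 0 -> g t <= C * `|t| `^ (- b)) ->
  exists2 C1 : R, 0 < C1 & forall n (x : 'cV[R]_n), bform (toeplitz n g) x x <= C1 * n%:R `^ b * sqn x.
Proof.
move=> b0 b1 C0 ig hg.
have B : 0 < 1 - b by rewrite subr_gt0.
exists (C * (1 + (2 * pi)^-1 * (2 / (1 - b)))).
  by rewrite mulr_gt0 // ltr_pwDl // mulr_ge0 ?invr_ge0 ?(ltW (twopi_gt0 R)) // divr_ge0 // ltW.
move=> n x; have [n0|n0] := posnP n.
  have z (M : 'M[R]_n) (y : 'cV[R]_n) : bform M y y = 0.
    by rewrite bformE; subst n; rewrite big_ord0.
  by rewrite z -bform1 z mulr0.
have nR : (0 : R) < n%:R by rewrite ltr0n.
have iT := integ_trig x x (integ_cst (1 : R)).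
have {}iT : integ (fun t => ctrig x t * ctrig x t + strig x t * strig x t).
  by move: iT; under eq_fun do rewrite mulr1.
rewrite bform_toeplitz //.
have nV : 0 < n%:R^-1 :> R by rewrite invr_gt0.
apply: (@le_trans _ _ ((2 * pi)^-1 * I (fun t => C * (n%:R `^ b * (ctrig x t * ctrig x t + strig x t * strig x t) +
    n%:R * sqn x * ((`|t| <= n%:R^-1)%R%:R * `|t| `^ (- b)))))).
  rewrite ler_pM2l ?invr_gt0 ?twopi_gt0 //; apply: le_I_off0; first exact: integ_trig.
    by apply: integZ; apply: integD; apply: integZ => //; exact: integ_powR_ball.
  move=> t It t0; have P0 : 0 <= ctrig x t * ctrig x t + strig x t * strig x t.
    by rewrite -!expr2 addr_ge0 // sqr_ge0.
  apply: (@le_trans _ _ (C * ((ctrig x t * ctrig x t + strig x t * strig x t) * `|t| `^ (- b)))).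
    by rewrite mulrCA; apply: ler_wpM2l => //; exact: hg.
  rewrite ler_pM2l //; have [ht|ht] := lerP `|t| n%:R^-1.
    rewrite mul1r -[leLHS]add0r lerD //; first by rewrite mulr_ge0 // powR_ge0.
    by rewrite ler_wpM2r ?powR_ge0 // -!expr2 trig_sq_le.
  rewrite mul0r mulr0 addr0 mulrC ler_wpM2r //.
  rewrite powRN -[n%:R `^ b]invrK lef_pV2 ?posrE ?invr_gt0 ?powR_gt0 ?normr_gt0 //.
  rewrite -powRN -(invr_powR b (ler0n R n)).
  by apply: ge0_ler_powR; rewrite ?nnegrE ?(ltW ht) ?(ltW nV).
rewrite I_Z; last by apply: integD; apply: integZ => //; exact: integ_powR_ball.
rewrite RintegralD; [|exact: measurable_Ipi|exact: integZ|by apply: integZ; exact: integ_powR_ball].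
rewrite I_Z // I_Z; last exact: integ_powR_ball.
have -> : I (fun t => ctrig x t * ctrig x t + strig x t * strig x t) = 2 * pi * sqn x.
  by rewrite sqnE parseval mulVKf // twopi_neq0.
have h := I_powR_ball b1 nV.
have e : n%:R * (2 * n%:R^-1 `^ (1 - b) / (1 - b)) = n%:R `^ b * (2 / (1 - b)).
  have -> : n%:R^-1 `^ (1 - b) = n%:R `^ b / n%:R :> R.
    rewrite invr_powR ?ler0n // opprB powRD; last by apply/implyP => _; rewrite gt_eqF.
    by rewrite powR_inv1 ?ler0n.
  by field; rewrite ?(gt_eqF B) ?(gt_eqF nR).
have s0 := sqn_ge0 x.
apply: (@le_trans _ _ ((2 * pi)^-1 * (C * (n%:R `^ b * (2 * pi * sqn x) + sqn x * (n%:R `^ b * (2 / (1 - b))))))).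
  rewrite ler_pM2l ?invr_gt0 ?twopi_gt0 // ler_pM2l // lerD2l.
  by rewrite -e [leLHS]mulrAC [leLHS]mulrC; apply: ler_wpM2l => //; rewrite ler_pM2l.
rewrite le_eqVlt; apply/orP; left; apply/eqP.
move: (@pi R) (lt0r_neq0 (pi_gt0 R)) => p p1; field.
by rewrite p1 (gt_eqF B).
Qed.

Lemma toeplitz_ge_powR (a c : R) f : 0 <= a -> 0 < c -> integ f ->
  (forall t, Ipi t -> t != 0 -> c * `|t| `^ a <= f t) ->
  exists2 C2 : R, 0 < C2 & forall n (x : 'cV[R]_n), sqn x <= C2 * n%:R `^ a * bform (toeplitz n f) x x.
Proof.
move=> a0 c0 jf hf; have p2 := pi_ge2 R.
exists (2 `^ a * c^-1 * 2).
  by rewrite !mulr_gt0 ?invr_gt0 ?powR_gt0.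
move=> n x; have [n0|n0] := posnP n.
  have z (M : 'M[R]_n) (y : 'cV[R]_n) : bform M y y = 0.
    by rewrite bformE; subst n; rewrite big_ord0.
  by rewrite z -bform1 z mulr0.
have nR : (0 : R) < n%:R by rewrite ltr0n.
have iT : integ (fun t => ctrig x t * ctrig x t + strig x t * strig x t).
  have := integ_trig x x (integ_cst (1 : R)).
  by under eq_fun do rewrite mulr1.
have rV : 0 < (2 * n%:R)^-1 :> R by rewrite invr_gt0 mulr_gt0.
have s0 := sqn_ge0 x.
have ib : integ (fun t : R => (`|t| <= (2 * n%:R)^-1)%R%:R * `|t| `^ (- 0)) by exact: integ_powR_ball.
have key : 2 * pi * sqn x <= (2 * n%:R) `^ a * c^-1 * (2 * pi * bform (toeplitz n f) x x) + n%:R * sqn x * (2 * (2 * n%:R)^-1).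
  have -> : 2 * pi * sqn x = I (fun t => ctrig x t * ctrig x t + strig x t * strig x t).
    by rewrite sqnE parseval mulVKf // twopi_neq0.
  rewrite bform_toeplitz // mulVKf ?twopi_neq0 //.
  apply: (@le_trans _ _ (I (fun t => (2 * n%:R) `^ a * c^-1 * ((ctrig x t * ctrig x t + strig x t * strig x t) * f t) +
     n%:R * sqn x * ((`|t| <= (2 * n%:R)^-1)%R%:R * `|t| `^ (- 0))))).
    apply: le_I_off0 => //; first by apply: integD; apply: integZ => //; exact: integ_trig.
    move=> t It t0; have tp : 0 < `|t| by rewrite normr_gt0.
    have P0 : 0 <= ctrig x t * ctrig x t + strig x t * strig x t.
      by rewrite -!expr2 addr_ge0 // sqr_ge0.
    have f0 : 0 <= f t by apply: le_trans (hf t It t0); rewrite mulr_ge0 ?powR_ge0 // ltW.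
    have [ht|ht] := lerP `|t| (2 * n%:R)^-1.
      rewrite oppr0 powRr0 !mulr1 -[leLHS]add0r lerD //.
        by rewrite !mulr_ge0 ?powR_ge0 ?invr_ge0 // ltW.
      by rewrite -!expr2 trig_sq_le.
    rewrite mul0r mulr0 addr0 mulrCA -[leLHS]mulr1 ler_wpM2l //.
    apply: (@le_trans _ _ ((2 * n%:R) `^ a * c^-1 * (c * `|t| `^ a))); last first.
      by rewrite ler_wpM2l ?hf // mulr_ge0 ?powR_ge0 // invr_ge0 ltW.
    rewrite -mulrA mulKf ?gt_eqF // -powRM ?mulr_ge0 ?ler0n //.
    apply: (@le_trans _ _ (1 `^ a)); first by rewrite powR1.
    apply: ge0_ler_powR; rewrite ?nnegrE ?mulr_ge0 ?ler0n //.
    by rewrite -ler_pdivrMl ?mulr1 ?mulr_gt0 // ltW.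
  rewrite RintegralD; [|exact: measurable_Ipi|by apply: integZ; exact: integ_trig|exact: integZ].
  rewrite I_Z; last exact: integ_trig.
  rewrite lerD2l I_Z // ler_wpM2l ?mulr_ge0 ?ler0n //.
  have := I_powR_ball (ltr01 : (0 : R) < 1) rV.
  by rewrite subr0 divr1 powRr1 ?(ltW rV).
have e : n%:R * sqn x * (2 * (2 * n%:R)^-1) = sqn x by field; rewrite gt_eqF.
rewrite e in key.
have e2 : (2 * n%:R) `^ a = 2 `^ a * n%:R `^ a :> R by rewrite powRM ?ler0n.
rewrite e2 in key.
set W := bform _ _ _ in key *.
have q : pi * sqn x <= 2 `^ a * n%:R `^ a * c^-1 * (2 * pi * W).
  have : 2 * sqn x <= pi * sqn x by rewrite ler_wpM2r.
  lra.
rewrite -(ler_pM2l (pi_gt0 R)); apply: (le_trans q).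
by rewrite le_eqVlt; apply/orP; left; apply/eqP; ring.
Qed.

End Fejer.

(** * The trace limit *)

Lemma sum_invr_sq_le (R : realType) n : \sum_(i < n) (i.+1%:R ^+ 2)^-1 <= 2 :> R.
Proof.
case: n => [|n]; first by rewrite big_ord0.
apply: (@le_trans _ _ (2 - n.+1%:R^-1)); last by rewrite gerBl invr_ge0.
elim: n => [|n IH]; first by rewrite big_ord1 expr1n invr1; lra.
rewrite big_ord_recr /=; apply: (le_trans (lerD IH (lexx _))).
have x0 : (0 : R) < n.+1%:R by rewrite ltr0n.
rewrite -[n.+2]addn1 natrD; move: (n.+1%:R : R) x0 => x x0.
have y0 : 0 < x + 1 by rewrite ltr_wpDr.
rewrite -subr_ge0 (_ : _ - _ = (x * (x + 1) ^+ 2)^-1); last first.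
  by field; rewrite !gt_eqF.
by rewrite invr_ge0 mulr_ge0 ?sqr_ge0 // ltW.
Qed.

Lemma sum_expR_powR_bounded (R : realType) (c e : R) : 0 < c -> 0 < e ->
  exists M, forall n, \sum_(i < n) expR (- (c * i.+1%:R `^ e)) <= M.
Proof.
move=> c0 e0; pose k := (Num.truncn (2 / e)).+1.
have k0 : (0 : R) < k%:R by rewrite ltr0n.
have ke : 2 <= e * k%:R by rewrite -ler_pdivrMl // mulrC ltW // truncnS_gt.
exists ((k%:R / c) ^+ k * 2) => n.
apply: (@le_trans _ _ (\sum_(i < n) (k%:R / c) ^+ k * (i.+1%:R ^+ 2)^-1)); last first.
  by rewrite -mulr_sumr ler_wpM2l ?sum_invr_sq_le // exprn_ge0 // divr_ge0 // ltW.
apply: ler_sum => i _; set m : R := i.+1%:R.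
have m0 : 0 < m by rewrite ltr0n.
have m1 : 1 <= m by rewrite ler1n.
have y0 : 0 < c * m `^ e by rewrite mulr_gt0 // powR_gt0.
have ex : (c * m `^ e / k%:R) ^+ k <= expR (c * m `^ e).
  rewrite -[X in _ <= expR X](@mulfVK _ k%:R) ?gt_eqF // expRM_natr.
  rewrite lerXn2r ?nnegrE ?expR_ge0 ?divr_ge0 // ?ltW //.
  by apply: le_lt_trans (expR_gt1Dx _); rewrite ?lerDr // gt_eqF // divr_gt0.
rewrite expRN; apply: (@le_trans _ _ ((c * m `^ e / k%:R) ^+ k)^-1).
  by rewrite lef_pV2 ?posrE ?expR_gt0 // exprn_gt0 // divr_gt0.
have me : m ^+ 2 <= (m `^ e) ^+ k.
  by rewrite -!powR_mulrn ?powR_ge0 // -powRrM ler_powR.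
rewrite !exprMn !invfM -!exprVn invrK !exprVn mulrAC -mulrA [leLHS]mulrCA mulrA.
rewrite -invfM -expr2 ler_wpM2l //.
  by rewrite mulr_ge0 ?invr_ge0 ?exprn_ge0 // ltW.
by rewrite lef_pV2 ?posrE ?exprn_gt0 ?powR_gt0.
Qed.

Section Trace.
Variable R : realType.
Notation mu := (@lebesgue_measure R).
Notation I h := (Rintegral mu (@Ipi R) h).
Notation integ h := (mu.-integrable (@Ipi R) (EFin \o h)).

Lemma integ_upper (b C : R) (g : R -> R) : b < 1 -> measurable_fun (@Ipi R) g ->
  (forall t, Ipi t -> 0 <= g t <= C * `|t| `^ (- b)) -> integ g.
Proof.
move=> b1 mg hg; apply: (@integ_le _ _ (fun t => C * `|t| `^ (- b)) mg).
  by apply: integZ; exact: integ_powR.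
by move=> t It; have /andP[g0 gC] := hg t It; rewrite ger0_norm.
Qed.

Variables (a b c C : R) (f g : R -> R).
Hypotheses (a0 : 0 <= a) (b0 : 0 <= b) (ab1 : a + b < 1) (c0 : 0 < c) (C0 : 0 < C).
Hypotheses (f_integ : integ f) (f_ge0 : forall t, Ipi t -> 0 <= f t)
  (f_ge : forall t, Ipi t -> t != 0 -> c * `|t| `^ a <= f t)
  (f_even : forall t, `|t| < pi -> f (- t) = f t)
  (f_cont : forall t, `|t| < pi -> t != 0 -> {for t, continuous f}).
Hypotheses (g_meas : measurable_fun (@Ipi R) g)
  (g_bound : forall t, Ipi t -> 0 <= g t <= C * `|t| `^ (- b)).

Let a1 : a < 1. Proof. by apply: le_lt_trans ab1; rewrite lerDl. Qed.
Let b1 : b < 1. Proof. by apply: le_lt_trans ab1; rewrite lerDr. Qed.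

Let f_gt0 t : Ipi t -> t != 0 -> 0 < f t.
Proof.
move=> It t0; apply: lt_le_trans (f_ge It t0).
by rewrite mulr_gt0 // powR_gt0 // normr_gt0.
Qed.

Let g_integ : integ g. Proof. exact: integ_upper b1 g_meas g_bound. Qed.

Let fV_meas : measurable_fun (@Ipi R) (fun t => (f t)^-1).
Proof.
apply: (@eq_measurable_fun _ _ _ _ _ (fun t => f t `^ (-1))).
  by move=> t /set_mem It; rewrite powR_inv1 // f_ge0.
apply: (@measurableT_comp _ _ _ _ _ _ (fun y : R => y `^ (-1))).
  exact: measurable_powR.
exact: integ_measurable f_integ.
Qed.

Let fV_le t : Ipi t -> (f t)^-1 <= c^-1 * `|t| `^ (- a) + (f 0)^-1 * (t == 0)%:R.
Proof.
move=> It; have [->|t0] := eqVneq t 0.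
  by rewrite mulr1 lerDr mulr_ge0 ?powR_ge0 // invr_ge0 ltW.
rewrite mulr0 addr0 powRN -invfM lef_pV2 ?posrE ?f_gt0 //; last first.
  by rewrite mulr_gt0 // powR_gt0 // normr_gt0.
exact: f_ge.
Qed.

Let fV_integ : integ (fun t => (f t)^-1).
Proof.
apply: (@integ_le _ _ (fun t => c^-1 * `|t| `^ (- a) + (f 0)^-1 )) => //.
  by apply: integD; [apply: integZ; exact: integ_powR|exact: integ_cst].
move=> t It; rewrite ger0_norm ?invr_ge0 ?f_ge0 //.
apply: (le_trans (fV_le It)); rewrite lerD2l.
have Ip0 : Ipi (0 : R) by rewrite /Ipi /= oppr_le0 pi_ge0 pi_gt0.
by case: (t == 0); rewrite ?mulr1 ?mulr0 // invr_ge0 f_ge0.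
Qed.

Lemma toeplitz_posdef n (x : 'cV[R]_n) : x != 0 -> 0 < bform (toeplitz n f) x x.
Proof.
move=> x0; have [C2 C20 h] := toeplitz_ge_powR a0 c0 f_integ f_ge.
have s0 : 0 < sqn x by rewrite lt_def sqn_eq0 x0 sqn_ge0.
have := lt_le_trans s0 (h n x).
by rewrite pmulr_rgt0 // mulr_gt0 // powR_gt0 // ltr0n lt0n; apply: contraNneq x0 => n0; subst n; apply/eqP/matrixP => -[].
Qed.

Lemma christoffel_ge0 n t : 0 <= christoffel (invmx (toeplitz n f)) t.
Proof.
set A := toeplitz n f.
have sA : A^T = A by exact: toeplitz_sym.
have uA : A \in unitmx.
  rewrite unitmxE unitfE; apply/negP => /eqP /eqP /det0P [w w0 wA].
  have := @toeplitz_posdef n w^T; rewrite trmx_eq0 => /(_ w0).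
  by rewrite /bform trmxK wA mul0mx mxE ltxx.
have h x : 0 <= bform (invmx A) x x.
  have -> : bform (invmx A) x x = bform A (invmx A *m x) (invmx A *m x).
    by rewrite /bform trmx_mul trmx_inv sA mulmxKV // mulmxA.
  have [->|/toeplitz_posdef/ltW //] := eqVneq (invmx A *m x) 0.
  by rewrite /bform mulmx0 mxE.
by rewrite addr_ge0.
Qed.

Lemma christoffel_cvg t : `|t| < pi -> t != 0 ->
  (fun n => n%:R^-1 * christoffel (invmx (toeplitz n f)) t) @ \oo --> (f t)^-1.
Proof.
move=> tpi t0.
have It : Ipi t by rewrite /Ipi /=; move: tpi; rewrite ltr_norml => /andP[/ltW -> ->].
have ft := f_gt0 It t0.
have cf := fejer_cvg f_integ tpi (f_cont tpi t0) f_even.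
have cfV : (fun n => fejer n (fun s => (f s)^-1) t) @ \oo --> (f t)^-1.
  apply: fejer_cvg => //; last by move=> s sp; rewrite f_even.
  by apply: cvgV; [rewrite gt_eqF|exact: f_cont].
have cfI : (fun n => (fejer n f t)^-1) @ \oo --> (f t)^-1 by apply: cvgV => //; rewrite gt_eqF.
apply: (squeeze_cvgr _ cfI cfV); near=> n.
have n0 : (0 < n)%N by near: n; exact: nbhs_infty_gt.
have nR : (0 : R) < n%:R by rewrite ltr0n.
have lo := christoffel_lower t n0 f_integ (@toeplitz_posdef n).
have up := christoffel_upper t f_integ fV_integ f_gt0 (@toeplitz_posdef n).
have ch0 := christoffel_ge0 n t.
apply/andP; split; last by rewrite ler_pdivrMl.
have F0 : 0 < fejer n f t.
  rewrite ltNge; apply/negP => F0.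
  have : christoffel (invmx (toeplitz n f)) t * fejer n f t <= 0 by rewrite mulr_ge0_le0.
  by move=> /(le_trans lo); rewrite leNgt nR.
by rewrite ler_pdivlMl // -[_^-1]mul1r mulrA mulr1 ler_pdivrMr.
Unshelve. all: by end_near. Qed.

Lemma trace_cvg :
  (fun n => n%:R^-1 * \tr (invmx (toeplitz n f) *m toeplitz n g)) @ \oo -->
  (2 * pi)^-1 * I (fun t => g t / f t).
Proof.
pose w n t := n%:R^-1 * christoffel (invmx (toeplitz n f)) t.
have [C' C'0 hC'] := fejer_powR_le a0 a1.
have e n : n%:R^-1 * \tr (invmx (toeplitz n f) *m toeplitz n g) = (2 * pi)^-1 * I (fun t => w n t * g t).
  rewrite trace_toeplitz // mulrCA; congr (_ * _).
  have mch : measurable_fun (@Ipi R) (fun t => \sum_(j < n) \sum_(k < n) invmx (toeplitz n f) j k * cos ((j%:R - k%:R) * t)).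
    apply: measurable_sum => j; apply: measurable_sum => k; apply: measurable_funM => //.
    exact: measurable_cosMl.
  rewrite -I_Z.
    by apply: eq_I => t _; rewrite /w christoffelE mulrA.
  apply: (@integM _ _ _ (\sum_(j < n) \sum_(k < n) `|invmx (toeplitz n f) j k|) g_integ mch).
  move=> t _; apply: (le_trans (ler_norm_sum _ _ _)); apply: ler_sum => j _.
  apply: (le_trans (ler_norm_sum _ _ _)); apply: ler_sum => k _.
  by rewrite normrM ler_piMr // norm_cos_le1.
under eq_fun do rewrite e.
apply: cvgMl_tmp.
pose G (t : R) : R := c^-1 * C' * C * `|t| `^ (- (a + b)).
have wm n : measurable_fun (@Ipi R) (w n).
  apply: measurable_funM => //; rewrite (_ : christoffel _ = (fun t => \sum_(j < n) \sum_(k < n)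
    invmx (toeplitz n f) j k * cos ((j%:R - k%:R) * t))); last by apply/funext => t; exact: christoffelE.
  apply: measurable_sum => j; apply: measurable_sum => k; apply: measurable_funM => //.
  exact: measurable_cosMl.
have w0 n t : 0 <= w n t by rewrite mulr_ge0 ?invr_ge0 ?ler0n // christoffel_ge0.
have wle n t : Ipi t -> t != 0 -> w n t <= c^-1 * (C' * `|t| `^ (- a)).
  move=> It t0; have [->|n0] := posnP n.
    by rewrite /w invr0 mul0r !mulr_ge0 ?powR_ge0 // invr_ge0 ltW.
  have nR : (0 : R) < n%:R by rewrite ltr0n.
  rewrite /w ler_pdivrMl //.
  apply: (le_trans (christoffel_upper t f_integ fV_integ f_gt0 (@toeplitz_posdef n))).
  rewrite ler_pM2l //.
  apply: (@le_trans _ _ (c^-1 * fejer n (fun s => `|s| `^ (- a)) t)); last first.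
    by rewrite ler_pM2l ?invr_gt0 //; apply: hC' => //; exact: Ipi_norm.
  rewrite /fejer mulrCA ler_pM2l; last by rewrite divr_gt0 // invr_gt0 twopi_gt0.
  rewrite -I_Z; last by apply: integ_fejer; exact: integ_powR.
  apply: le_I_off0; [exact: integ_fejer|by apply: integZ; apply: integ_fejer; exact: integ_powR|].
  move=> s Is s0; rewrite mulrCA ler_wpM2l ?fejer_sum_ge0 //.
  by have := fV_le Is; rewrite (negbTE s0) mulr0 addr0.
have null : mu [set 0; - pi] = 0%E.
  apply/eqP; rewrite eq_le measure_ge0 andbT.
  have -> : [set 0; - pi] = [set (0 : R)] `|` [set (- pi : R)] by [].
  apply: (le_trans (measureU2 _ _ _)) => //; try exact: measurable_set1.
  by rewrite -[leLHS]/(mu [set 0%R] + mu [set (- pi)%R])%E !lebesgue_measure_set1 adde0.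
have off (Q : R -> Prop) : (forall t, `|t| < pi -> t != 0 -> Q t) -> {ae mu, forall t, Ipi t -> Q t}.
  move=> h; exists [set 0; - pi]; split => //.
    by apply: measurableU; exact: measurable_set1.
  move=> t /= nt; apply: contrapT => /not_orP [t0 tpi]; apply: nt => It; apply: h; last exact/eqP.
  rewrite ltr_norml; case/andP: It => l ->; rewrite andbT lt_neqAle l andbT.
  by apply/eqP => e'; apply: tpi.
have lim (t : R) : `|t| < pi -> t != 0 -> (fun n => w n t * g t) @ \oo --> g t / f t.
  by move=> tpi t0; rewrite [X in _ --> X]mulrC; apply: cvgMr_tmp; exact: christoffel_cvg.
have dom n (t : R) : `|t| < pi -> t != 0 -> `|w n t * g t| <= G t.
  move=> tpi t0.
  have It : Ipi t by rewrite /Ipi /=; move: tpi; rewrite ltr_norml => /andP[/ltW -> ->].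
  have /andP[g0 gC] := g_bound It.
  have wg0 : 0 <= w n t * g t by exact: mulr_ge0.
  have h := ler_pM (w0 n t) g0 (wle n t It t0) gC.
  rewrite (ger0_norm wg0); apply: (le_trans h).
  rewrite /G opprD powRD; last by rewrite normr_eq0 t0 implybT.
  by rewrite le_eqVlt; apply/orP; left; apply/eqP; ring.
have m1 n : measurable_fun (@Ipi R) (fun t => (w n t * g t)%:E).
  by apply/measurable_EFinP; apply: measurable_funM.
have m2 : measurable_fun (@Ipi R) (fun t => (g t / f t)%:E).
  by apply/measurable_EFinP; apply: measurable_funM.
have m3 : {ae mu, forall t, Ipi t -> (fun n => (w n t * g t)%:E) @ \oo --> (g t / f t)%:E}.
  by apply: off => t tpi t0; apply: cvg_EFin; [exact: nearW|exact: lim].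
have m4 : integ G by apply: integZ; exact: integ_powR.
have m5 : {ae mu, forall t n, Ipi t -> (`|(w n t * g t)%:E| <= (EFin \o G) t)%E}.
  have h : {ae mu, forall t, Ipi t -> forall n, (`|(w n t * g t)%:E| <= (EFin \o G) t)%E}.
    by apply: off => t tpi t0 n; rewrite /= lee_fin; exact: dom.
  by case: h => A [mA A0 hA]; exists A; split => // t nt; apply: hA => /= h; apply: nt => n It; exact: h.
have [ig _ cv] := @dominated_convergence _ _ R mu (@Ipi R) (@measurable_Ipi R) _ _ _ m1 m2 m3 m4 m5.
have := fine_cvg (_ : _ --> (fine (\int[mu]_(t in @Ipi R) (g t / f t)%:E))%:E).
rewrite fineK; last by apply: integrable_fin_num => //; exact: measurable_Ipi.
by move=> /(_ _ _ _ _ cv).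
Qed.

Lemma toeplitz_ae_cvg d (Om : measurableType d) (P : probability Om R)
    (X : forall n : nat, Om -> 'cV[R]_n) :
  (forall n, centered_gaussian P (X n) (toeplitz n g)) ->
  {ae P, forall w, (fun n : nat => n%:R^-1 * ((X n w)^T *m invmx (toeplitz n f) *m X n w) ord0 ord0)
     @ \oo --> (2 * pi)^-1 * I (fun t => g t / f t)}.
Proof.
move=> hX.
have [C1 C10 h1] := @toeplitz_le_powR R b C g b0 b1 C0 g_integ (fun t It _ => proj2 (andP (g_bound It))).
have [C2 C20 h2] := toeplitz_ge_powR a0 c0 f_integ f_ge.
pose D : R := C1 * C2.
have D0 : 0 < D by rewrite mulr_gt0.
pose Lam n : R := D * (maxn n 1)%:R `^ (a + b - 1).
have cv := trace_cvg.
have /cvg_seq_bounded/= := cvgP _ cv.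
move=> [K0 [_ /(_ (K0 + 1))]]; rewrite ltrDl ltr01 => /(_ isT) hK.
apply: (@quadratic_form_ae_cvg _ _ _ P X (fun n => toeplitz n f) (fun n => toeplitz n g) Lam (K0 + 1)).
- by move=> n; exact: toeplitz_sym.
- by move=> n; exact: toeplitz_sym.
- exact: toeplitz_posdef.
- move=> [|n] x.
    by rewrite !mul0r bformE big_ord0.
  have n0 : (0 : R) < n.+1%:R by rewrite ltr0n.
  apply: (le_trans (h1 _ x)).
  apply: (@le_trans _ _ (C1 * n.+1%:R `^ b * (C2 * n.+1%:R `^ a * bform (toeplitz n.+1 f) x x))).
    by rewrite ler_wpM2l // mulr_ge0 ?powR_ge0 // ltW.
  rewrite /Lam (maxn_idPl _) // /D (_ : a + b - 1 = b + a + - 1); last by ring.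
  have nn : (n.+1%:R : R) != 0 by rewrite gt_eqF.
  have e : n.+1%:R `^ (b + a - 1) = n.+1%:R `^ b * n.+1%:R `^ a / n.+1%:R.
    by rewrite powRD ?nn ?implybT // (@powRD _ _ b) ?nn ?implybT // powR_inv1 // ltW.
  rewrite e le_eqVlt; apply/orP; left; apply/eqP.
  by move: (_ `^ b) (_ `^ a) (bform _ _ _) => u v z; field.
- exact: hX.
- by move=> n; rewrite mulr_gt0 // powR_gt0 // ltr0n leq_max orbT.
- by move=> n; apply: le_trans (ler_norm _) (hK n Logic.I).
- move=> e e0; have [|M hM] := @sum_expR_powR_bounded R (e / D) (1 - (a + b)) (divr_gt0 e0 D0).
    by rewrite subr_gt0.
  exists M => n; apply: le_trans (hM n); rewrite le_eqVlt; apply/orP; left; apply/eqP.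
  apply: eq_bigr => i _; congr expR; congr (- _).
  by rewrite /Lam (maxn_idPl _) // invfM mulrA -powRN opprB.
- exact: cv.
Qed.

End Trace.

(** * The spectral density of fractional Gaussian noise *)

Section FGNDensity.
Variable R : realType.
Notation mu := (@lebesgue_measure R).
Notation I h := (Rintegral mu (@Ipi R) h).
Notation integ h := (mu.-integrable (@Ipi R) (EFin \o h)).

Lemma sum_powR_bounded (p : R) : 1 < p ->
  exists M, forall n, \sum_(k < n) k.+1%:R `^ (- p) <= M.
Proof.
move=> p1; pose e := p - 1; have e0 : 0 < e by rewrite subr_gt0.
exists (1 + e^-1) => -[|n]; first by rewrite big_ord0 addr_ge0 // invr_ge0 ltW.
apply: (@le_trans _ _ (1 + e^-1 * (1 - n.+1%:R `^ (- e)))); last first.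
  by rewrite lerD2l ler_piMr ?invr_ge0 ?gerBl ?powR_ge0 // ltW.
elim: n => [|n IH]; first by rewrite big_ord1 !powR1 subrr mulr0 addr0.
rewrite big_ord_recr /=; apply: (le_trans (lerD IH (lexx _))).
set x : R := n.+2%:R; have x0 : 0 < x by rewrite ltr0n.
set y : R := n.+1%:R; have y0 : 0 < y by rewrite ltr0n.
have xy : y / x = 1 + - x^-1.
  rewrite (_ : y = x - 1); last by rewrite /x /y -[n.+2%:R]natr1 addrK.
  by rewrite mulrBl divff ?gt_eqF // mul1r.
have key : 1 + e / x <= (y / x) `^ (- e).
  rewrite /powR gt_eqF ?divr_gt0 //; apply: (le_trans (expR_ge1Dx _)).
  rewrite ler_expR mulNr lerNr -mulrN ler_pM2l // xy le_ln1Dx // ltrN2 invf_lt1 //.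
  by rewrite /x ltr1n.
have -> : x `^ (- p) = x `^ (- e) * x^-1.
  rewrite (_ : - p = - e + - 1); last by rewrite /e; ring.
  by rewrite powRD ?(lt0r_neq0 x0) ?implybT // powR_inv1 // ltW.
have -> : y `^ (- e) = x `^ (- e) * (y / x) `^ (- e).
  by rewrite -powRM ?divr_ge0 // ?ltW // mulrC divfK // gt_eqF.
move: (x `^ (- e)) (powR_ge0 x (- e)) ((y / x) `^ (- e)) key => A A0 B key.
rewrite -subr_ge0 (_ : _ - _ = e^-1 * A * (B - (1 + e / x))); last by field; rewrite !gt_eqF.
by rewrite !mulr_ge0 ?invr_ge0 ?subr_ge0 // ltW.
Qed.

Variable H : R.
Hypotheses (H0 : 0 < H) (H1 : H < 1).

(* The terms of index [k.+1] and [- k.+1] of the series in [fgn_series]. *)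
Definition fgn_pair (k : nat) (l : R) : R :=
  `|l - 2 * pi * k.+1%:R| `^ (- (2 * H + 1)) + `|l + 2 * pi * k.+1%:R| `^ (- (2 * H + 1)).

Definition fgn_tail (l : R) : R := limn (series (fgn_pair ^~ l)).

Lemma fgn_partial_sumE N (l : R) :
  \sum_(i < (2 * N).+1) `| l - 2 * pi * ((i%:Z - N%:Z)%:~R) | `^ (- (2 * H + 1)) =
  `|l| `^ (- (2 * H + 1)) + series (fgn_pair ^~ l) N.
Proof.
rewrite seriesEord /=; elim: N => [|N IH].
  by rewrite big_ord0 big_ord1 /= subrr mulr0 subr0 addr0.
have e1 (i : nat) : (i.+1%:Z - N.+1%:Z)%:~R = (i%:Z - N%:Z)%:~R :> R by congr (_%:~R); lia.
rewrite mulnS big_ord_recl big_ord_recr /= [in RHS]big_ord_recr /= [RHS]addrA -IH.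
rewrite (_ : (0%:Z - N.+1%:Z)%:~R = - N.+1%:R :> R); last by rewrite sub0r rmorphN.
rewrite (_ : ((bump 0 (2 * N).+1)%:Z - N.+1%:Z)%:~R = N.+1%:R :> R); last first.
  by rewrite (_ : _ - _ = N.+1%:Z) // /bump; lia.
rewrite (eq_bigr (fun i : 'I_(2 * N).+1 => `| l - 2 * pi * ((i%:Z - N%:Z)%:~R) | `^ (- (2 * H + 1)))); last first.
  by move=> i _; rewrite /bump leq0n add1n e1.
by rewrite mulrN opprK /fgn_pair addrCA; congr (_ + _); rewrite addrC.
Qed.

Let pair_ge0 k l : 0 <= fgn_pair k l. Proof. by rewrite addr_ge0 // powR_ge0. Qed.

Lemma fgn_pair_ge_pi (k : nat) (l : R) : `|l| <= pi ->
  pi * k.+1%:R <= `|l - 2 * pi * k.+1%:R| /\ pi * k.+1%:R <= `|l + 2 * pi * k.+1%:R|.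
Proof.
move=> lp; have p0 := pi_gt0 R.
have k1 : (1 : R) <= k.+1%:R by rewrite ler1n.
move: lp; rewrite ler_norml => /andP[l1 l2].
have h : pi <= pi * k.+1%:R :> R by rewrite ler_pMr.
split.
  by rewrite distrC; apply: le_trans (ler_norm _); lra.
by apply: le_trans (ler_norm _); lra.
Qed.

Lemma fgn_pair_le k l : `|l| <= pi -> fgn_pair k l <= 2 * k.+1%:R `^ (- (2 * H + 1)).
Proof.
move=> /(fgn_pair_ge_pi k)[h1 h2].
have k1 : (0 : R) < k.+1%:R by rewrite ltr0n.
have pk : k.+1%:R <= pi * k.+1%:R :> R by rewrite ler_peMl ?ler0n //; have := pi_ge2 R; lra.
have p0 : 0 <= 2 * H + 1 by rewrite addr_ge0 // mulr_ge0 // ltW.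
have aux (y : R) : pi * k.+1%:R <= y -> y `^ (- (2 * H + 1)) <= k.+1%:R `^ (- (2 * H + 1)).
  move=> hy; have ky : k.+1%:R <= y by exact: le_trans hy.
  have y0 := lt_le_trans k1 ky.
  by rewrite !powRN lef_pV2 ?posrE ?powR_gt0 // ge0_ler_powR // nnegrE ltW.
by rewrite mulr_natl mulr2n lerD ?aux.
Qed.

Lemma fgn_series_bounded : exists M, forall l N, `|l| <= pi -> series (fgn_pair ^~ l) N <= M.
Proof.
have [|M hM] := @sum_powR_bounded (2 * H + 1); first by rewrite ltrDr mulr_gt0.
exists (2 * M) => l N lp; rewrite seriesEord /=.
apply: (@le_trans _ _ (\sum_(k < N) 2 * k.+1%:R `^ (- (2 * H + 1)))).
  by apply: ler_sum => k _; exact: fgn_pair_le.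
by rewrite -mulr_sumr ler_pM2l.
Qed.

Lemma fgn_pair_nd l : nondecreasing_seq (series (fgn_pair ^~ l)).
Proof. by apply: nondecreasing_series => k _ _; exact: pair_ge0. Qed.

Lemma fgn_tail_cvg l : `|l| <= pi -> series (fgn_pair ^~ l) @ \oo --> fgn_tail l.
Proof.
move=> lp; have [M hM] := fgn_series_bounded.
apply: nondecreasing_is_cvgn; first exact: fgn_pair_nd.
by exists M => _ [n _ <-]; exact: hM.
Qed.

Lemma fgn_tail_ge0 l : `|l| <= pi -> 0 <= fgn_tail l.
Proof.
move=> lp; apply: limr_ge; first by apply: cvgP; exact: fgn_tail_cvg.
by apply: nearW => n; rewrite seriesEord /= sumr_ge0.
Qed.

Lemma fgn_tail_bounded : exists2 M, 0 <= M & forall l, `|l| <= pi -> fgn_tail l <= M.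
Proof.
have [M hM] := fgn_series_bounded.
have h l : `|l| <= pi -> fgn_tail l <= M.
  move=> lp; apply: limr_le; first by apply: cvgP; exact: fgn_tail_cvg.
  by apply: nearW => n; exact: hM.
exists M => //; apply: le_trans (h 0 _); last by rewrite normr0 pi_ge0.
by apply: fgn_tail_ge0; rewrite normr0 pi_ge0.
Qed.

Lemma fgn_tail_even l : fgn_tail (- l) = fgn_tail l.
Proof.
rewrite /fgn_tail; congr (limn (series _)); apply/funext => k; rewrite /fgn_pair addrC.
by congr (_ `^ _ + _ `^ _); rewrite -normrN; congr `|_|; ring.
Qed.

(* Each term obeys this bound, because [`|l0 - 2 * pi * k| >= 1] for [k != 0];
   it replaces uniform convergence in the proof of continuity. *)
Lemma fgn_tail_comparison l l0 : `|l| <= pi -> `|l0| <= pi ->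
  fgn_tail l0 <= (1 + `|l - l0|) `^ (2 * H + 1) * fgn_tail l.
Proof.
move=> lp l0p; have P0 := pi_gt0 R; have P2 := pi_ge2 R.
have p0 : 0 <= 2 * H + 1 by rewrite addr_ge0 // mulr_ge0 // ltW.
apply: limr_le; first by apply: cvgP; exact: fgn_tail_cvg.
apply: nearW => n.
apply: (@le_trans _ _ ((1 + `|l - l0|) `^ (2 * H + 1) * series (fgn_pair ^~ l) n)); last first.
  rewrite ler_wpM2l ?powR_ge0 //; apply: nondecreasing_cvgn_le; first exact: fgn_pair_nd.
  by apply: cvgP; exact: fgn_tail_cvg.
rewrite !seriesEord /= mulr_sumr; apply: ler_sum => k _.
have aux (m : R) : pi <= `|l0 - m| -> pi <= `|l - m| ->
    `|l0 - m| `^ (- (2 * H + 1)) <= (1 + `|l - l0|) `^ (2 * H + 1) * `|l - m| `^ (- (2 * H + 1)).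
  move=> h0 h1.
  have d0 : 0 < `|l0 - m| by exact: lt_le_trans h0.
  have d1 : 0 < `|l - m| by exact: lt_le_trans h1.
  rewrite !powRN ler_pdivlMr ?powR_gt0 // ler_pdivrMl ?powR_gt0 // -powRM ?addr_ge0 //.
  apply: (ge0_ler_powR p0); rewrite ?nnegrE ?mulr_ge0 ?addr_ge0 //.
  rewrite (_ : l - m = (l0 - m) + (l - l0)); last by ring.
  apply: (le_trans (ler_normD _ _)); rewrite mulrDr mulr1 lerD2l ler_peMl //; lra.
have [a1 a2] := fgn_pair_ge_pi k lp; have [a3 a4] := fgn_pair_ge_pi k l0p.
have pk : pi <= pi * k.+1%:R :> R by rewrite ler_pMr // ler1n.
rewrite mulrDr lerD //; first by apply: aux; exact: le_trans pk _.
by have := aux (- (2 * pi * k.+1%:R)); rewrite !opprK; apply; exact: le_trans pk _.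
Qed.

Let near_norm_le_pi (l0 : R) : `|l0| < pi -> \forall l \near l0, `|l| <= pi.
Proof.
move=> l0p; apply/nbhs_ballP; exists (pi - `|l0|) => [|l]; first by rewrite /= subr_gt0.
rewrite /ball /= => /ltW h; rewrite -[l](subKr l0).
by apply: (le_trans (ler_normB _ _)); rewrite -lerBrDl.
Qed.

Lemma fgn_tail_continuous (l0 : R) : `|l0| < pi -> {for l0, continuous fgn_tail}.
Proof.
move=> l0p; have p0 : 0 <= 2 * H + 1 by rewrite addr_ge0 // mulr_ge0 // ltW.
have cw : (fun l : R => (1 + `|l - l0|) `^ (2 * H + 1)) @ l0 --> (1 : R).
  have c0 : (fun l : R => 1 + `|l - l0|) @ l0 --> (1 : R).
    rewrite [X in _ --> X](_ : _ = 1 + `|l0 - l0|); last by rewrite subrr normr0 addr0.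
    by apply: cvgD; [exact: cvg_cst|apply: cvg_norm; apply: cvgB; [exact: cvg_id|exact: cvg_cst]].
  have c1 := cvg_comp _ _ c0 (@continuous_powR_norm R (2 * H + 1) 1 (oner_neq0 _)).
  rewrite normr1 powR1 in c1; apply: cvg_trans c1; apply: near_eq_cvg; apply: nearW => l /=.
  by rewrite ger0_norm // addr_ge0.
have c1 : (fun l : R => (1 + `|l - l0|) `^ (2 * H + 1) * fgn_tail l0) @ l0 --> fgn_tail l0.
  by rewrite -[X in _ --> X]mul1r; apply: cvgMr_tmp.
have c2 : (fun l : R => ((1 + `|l - l0|) `^ (2 * H + 1))^-1 * fgn_tail l0) @ l0 --> fgn_tail l0.
  rewrite -[X in _ --> X]mul1r; apply: cvgMr_tmp; rewrite -[X in _ --> X]invr1.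
  by apply: cvgV => //; rewrite oner_neq0.
apply: (squeeze_cvgr _ c2 c1); near=> l.
have lp : `|l| <= pi.
  by near: l; exact: near_norm_le_pi.
have w0 (x : R) : 0 < (1 + `|x|) `^ (2 * H + 1) by rewrite powR_gt0 // ltr_pwDl.
apply/andP; split.
  by rewrite ler_pdivrMl //; apply: fgn_tail_comparison => //; exact: ltW.
by rewrite -normrN opprB; apply: fgn_tail_comparison => //; exact: ltW.
Unshelve. all: by end_near. Qed.

Lemma fgn_unnormE l : `|l| <= pi -> fgn_unnorm H l = (2 - 2 * cos l) * (`|l| `^ (- (2 * H + 1)) + fgn_tail l).
Proof.
move=> lp; rewrite /fgn_unnorm; congr (_ * _); apply/cvg_lim => //.
rewrite (_ : (fun N : nat => _) = (fun N => `|l| `^ (- (2 * H + 1)) + series (fgn_pair ^~ l) N)); last first.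
  by apply/funext => N; exact: fgn_partial_sumE.
by apply: cvgD; [exact: cvg_cst|exact: fgn_tail_cvg].
Qed.

Lemma fgn_unnorm_even l : `|l| <= pi -> fgn_unnorm H (- l) = fgn_unnorm H l.
Proof. by move=> lp; rewrite !fgn_unnormE ?normrN // cosN fgn_tail_even. Qed.

Lemma fgn_unnorm_measurable : measurable_fun (@Ipi R) (fgn_unnorm H).
Proof.
apply: (@eq_measurable_fun _ _ _ _ _ (fun l => (2 - 2 * cos l) * (`|l| `^ (- (2 * H + 1)) + fgn_tail l))).
  by move=> l /set_mem Il; rewrite fgn_unnormE // Ipi_norm.
have mc : measurable_fun (@Ipi R) (fun l : R => 2 - 2 * cos l).
  by apply: measurable_funB => //; apply: measurable_funM => //; apply: measurable_funTS; exact: measurable_cos.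
apply: measurable_funM => //; apply: measurable_funD.
  by apply: measurable_funTS; exact: measurable_powR_norm.
apply: (@measurable_fun_cvg _ _ _ _ (fun n l => series (fgn_pair ^~ l) n)); last first.
  by move=> l Il; apply: fgn_tail_cvg; exact: Ipi_norm.
move=> n; rewrite (_ : (fun l => _) = (fun l => \sum_(k < n) fgn_pair k l)); last first.
  by apply/funext => l; rewrite seriesEord.
apply: measurable_sum => k; apply: measurable_funTS; apply: measurable_funD.
  apply: (measurableT_comp (measurable_powR_norm _)); exact: measurable_funB.
by apply: (measurableT_comp (measurable_powR_norm _)); exact: measurable_funD.
Qed.

Lemma fgn_unnorm_continuous (l0 : R) : `|l0| < pi -> l0 != 0 -> {for l0, continuous (fgn_unnorm H)}.
Proof.
move=> l0p l00.
have c : (fun l => (2 - 2 * cos l) * (`|l| `^ (- (2 * H + 1)) + fgn_tail l)) @ l0 --> fgn_unnorm H l0.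
  rewrite fgn_unnormE ?ltW //; apply: cvgM.
    by apply: cvgB; [exact: cvg_cst|apply: cvgMl_tmp; exact: continuous_cos].
  by apply: cvgD; [exact: continuous_powR_norm|exact: fgn_tail_continuous].
apply: cvg_trans c; apply: near_eq_cvg; near=> l; rewrite fgn_unnormE //.
by near: l; exact: near_norm_le_pi.
Unshelve. all: by end_near. Qed.

Lemma norm_sin_le (x : R) : `|sin x| <= `|x|.
Proof.
wlog x0 : x / 0 < x.
  move=> h; have [x0|x0|->] := ltgtP x 0; [|exact: h|by rewrite sin0].
  by rewrite -normrN -sinN -[leRHS]normrN; apply: h; rewrite oppr_gt0.
have [c _] := @MVT R sin cos 0 x x0 (fun y _ => is_derive_sin y)
  (continuous_subspaceT (@continuous_sin R)).
by rewrite sin0 !subr0 => ->; rewrite normrM ler_piMl // norm_cos_le1.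
Qed.

Lemma versine_ub (u : R) : 2 - 2 * cos u <= `|u| ^+ 2.
Proof.
rewrite versineE -[leLHS]ger0_norm ?sqr_ge0 // normrX lerXn2r ?nnegrE //.
rewrite normrM ger0_norm // (le_trans (ler_wpM2l _ (norm_sin_le _))) //.
by rewrite normrM mulrCA [`|2^-1|]ger0_norm ?invr_ge0 // divff ?mulr1.
Qed.

Let sqr_powR (l : R) : l != 0 -> `|l| ^+ 2 * `|l| `^ (- (2 * H + 1)) = `|l| `^ (1 - 2 * H).
Proof.
move=> l0; rewrite -powR_mulrn // -powRD ?normr_eq0 ?l0 ?implybT //.
by congr (_ `^ _); ring.
Qed.

Lemma fgn_unnorm_lower : exists2 k : R, 0 < k &
  forall l, `|l| <= pi -> l != 0 -> k * `|l| `^ (1 - 2 * H) <= fgn_unnorm H l.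
Proof.
have [k k0 hk] := versine_lb R; exists k => // l lp l0; rewrite fgn_unnormE //.
have P0 := pi_gt0 R.
rewrite -sqr_powR // mulrA real_normK ?num_real //.
have hkl : k * l ^+ 2 <= 2 - 2 * cos l by apply: hk; apply: (le_trans lp); lra.
apply: ler_pM hkl _; [|exact: powR_ge0|by rewrite lerDl fgn_tail_ge0].
by apply: mulr_ge0; [exact: ltW|exact: sqr_ge0].
Qed.

Lemma fgn_unnorm_upper : exists2 C : R, 0 < C &
  forall l, `|l| <= pi -> 0 <= fgn_unnorm H l <= C * `|l| `^ (1 - 2 * H).
Proof.
have [M M0 hM] := fgn_tail_bounded.
have C0 : 0 < 1 + M * pi `^ (2 * H + 1) by rewrite ltr_pwDl // mulr_ge0 ?powR_ge0.
exists (1 + M * pi `^ (2 * H + 1)) => // l lp; rewrite fgn_unnormE //.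
have v0 : 0 <= 2 - 2 * cos l by rewrite versineE sqr_ge0.
apply/andP; split; first by rewrite mulr_ge0 // addr_ge0 ?powR_ge0 // fgn_tail_ge0.
have [->|l0] := eqVneq l 0; first by rewrite cos0 mulr1 subrr mul0r mulr_ge0 ?powR_ge0 // ltW.
have q0 : 0 <= 2 * H + 1 by rewrite addr_ge0 // mulr_ge0 // ltW.
have n0 : 0 < `|l| by rewrite normr_gt0.
apply: (@le_trans _ _ (`|l| ^+ 2 * (`|l| `^ (- (2 * H + 1)) + M))).
  apply: (ler_pM v0 _ (versine_ub l)); last by rewrite lerD2l hM.
  by rewrite addr_ge0 ?powR_ge0 ?fgn_tail_ge0.
rewrite [leLHS]mulrDr [leRHS]mulrDl mul1r sqr_powR // lerD2l -sqr_powR //.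
have h1 : 1 <= pi `^ (2 * H + 1) * `|l| `^ (- (2 * H + 1)).
  by rewrite powRN ler_pdivlMr ?powR_gt0 // mul1r ge0_ler_powR // nnegrE ?ltW // pi_gt0.
rewrite [leRHS](_ : _ = `|l| ^+ 2 * M * (pi `^ (2 * H + 1) * `|l| `^ (- (2 * H + 1)))).
  by rewrite ler_peMr // mulr_ge0 ?sqr_ge0.
ring.
Qed.

Lemma fgn_unnorm_integrable : integ (fgn_unnorm H).
Proof.
have [C C0 hC] := fgn_unnorm_upper.
apply: (@integ_upper _ (2 * H - 1) C); [|exact: fgn_unnorm_measurable|].
  by rewrite ltrBlDr; move: H1; lra.
by move=> t /Ipi_norm tp; rewrite opprB; exact: hC.
Qed.

Lemma C_H_gt0 : 0 < C_H H.
Proof.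
have P0 := pi_gt0 R; have P2 := pi_ge2 R.
rewrite /C_H divr_gt0 ?mulr_gt0 //.
have [k k0 hk] := fgn_unnorm_lower.
pose h (t : R) : R := k * pi^-1 * (1 + - 1 * ((`|t| <= 1)%R%:R * `|t| `^ (- 0))).
have ib : integ (fun t => (`|t| <= 1)%R%:R * `|t| `^ (- 0)) by exact: integ_powR_ball.
have ih1 : integ (fun t => 1 + - 1 * ((`|t| <= 1)%R%:R * `|t| `^ (- 0))).
  by apply: integD; [exact: integ_cst|exact: integZ].
have ih : integ h by exact: integZ.
apply: (@lt_le_trans _ _ (I h)).
  rewrite /h I_Z // mulr_gt0 ?divr_gt0 //.
  rewrite (_ : I _ = I (fun=> 1) + - 1 * I (fun t => (`|t| <= 1)%R%:R * `|t| `^ (- 0))); last first.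
    by rewrite -I_Z //; apply: RintegralD; [exact: measurable_Ipi|exact: integ_cst|exact: integZ].
  have := @I_powR_ball R 0 1 ltr01 ltr01; rewrite I_cst subr0 powR1 divr1 !mulr1 mulN1r.
  rewrite subr_gt0; move/le_lt_trans; apply; lra.
apply: le_I_off0 => //; first exact: fgn_unnorm_integrable.
move=> t It t0; have tp := Ipi_norm It; have n0 : 0 < `|t| by rewrite normr_gt0.
have hkt := hk t tp t0; rewrite /h oppr0 powRr0 mulr1 mulN1r.
have [t1|t1] := leP `|t| 1.
  by rewrite subrr mulr0; apply: le_trans hkt; rewrite mulr_ge0 ?powR_ge0 // ltW.
rewrite subr0 mulr1; apply: le_trans hkt; rewrite ler_pM2l //.
apply: (@le_trans _ _ (`|t| `^ (- 1))); last by rewrite ler_powR ?ltW //; move: H1; lra.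
by rewrite powR_inv1 // lef_pV2 ?posrE.
Qed.

End FGNDensity.

Section FGNWeight.
Variable R : realType.
Notation mu := (@lebesgue_measure R).
Notation integ h := (mu.-integrable (@Ipi R) (EFin \o h)).

Lemma powR_norm_le_pi (r s l : R) : r <= s -> `|l| <= pi -> l != 0 ->
  `|l| `^ s <= pi `^ (s - r) * `|l| `^ r.
Proof.
move=> rs lp l0; have -> : `|l| `^ s = `|l| `^ (s - r) * `|l| `^ r.
  by rewrite -powRD ?subrK // normr_eq0 l0 implybT.
by rewrite ler_wpM2r ?powR_ge0 // ge0_ler_powR ?subr_ge0 // nnegrE pi_ge0.
Qed.

Variable alpha : R.
Hypothesis halpha : - (1 / 2) < alpha < 1 / 2.
Let H : R := 1 / 2 + alpha.
Let H0 : 0 < H. Proof. by case/andP: halpha; rewrite /H; lra. Qed.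
Let H1 : H < 1. Proof. by case/andP: halpha; rewrite /H; lra. Qed.
Let eH : 1 - 2 * H = - 2 * alpha. Proof. by rewrite /H; field. Qed.

Lemma g_lower : exists2 c : R, 0 < c &
  forall t, Ipi t -> t != 0 -> c * `|t| `^ (2 * Num.max (- alpha) 0) <= g_ alpha t.
Proof.
have [k k0 hk] := fgn_unnorm_lower H0 H1; have D0 := C_H_gt0 H0 H1.
set a : R := 2 * Num.max (- alpha) 0.
have sa : 1 - 2 * H <= a by rewrite eH /a mulNr -mulrN ler_pM2l // le_max lexx.
have p0 : 0 < pi `^ (a - (1 - 2 * H)) :> R by rewrite powR_gt0 // pi_gt0.
exists (C_H H * (k / pi `^ (a - (1 - 2 * H)))); first by rewrite mulr_gt0 // divr_gt0.
move=> t It t0; have tp := Ipi_norm It.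
rewrite /g_ /f_H -mulrA ler_pM2l //; apply: le_trans (hk _ tp t0).
by rewrite -mulrA ler_pM2l // ler_pdivrMl // powR_norm_le_pi.
Qed.

Lemma g_upper : exists2 C : R, 0 < C &
  forall t, Ipi t -> 0 <= g_ alpha t <= C * `|t| `^ (- (2 * Num.max alpha 0)).
Proof.
have [k k0 hk] := fgn_unnorm_upper H0 H1; have D0 := C_H_gt0 H0 H1.
set b : R := 2 * Num.max alpha 0.
have sb : - b <= 1 - 2 * H by rewrite eH /b mulNr lerN2 ler_pM2l // le_max lexx.
have p0 : 0 < pi `^ ((1 - 2 * H) - - b) :> R by rewrite powR_gt0 // pi_gt0.
exists (C_H H * (k * pi `^ ((1 - 2 * H) - - b))); first by rewrite mulr_gt0 // mulr_gt0.
move=> t It; have tp := Ipi_norm It; have /andP[h1 h2] := hk _ tp.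
rewrite /g_ /f_H mulr_ge0 ?(ltW D0) //= -mulrA ler_pM2l //.
have [->|t0] := eqVneq t 0.
  by rewrite fgn_unnormE ?normr0 ?pi_ge0 // cos0 mulr1 subrr mul0r !mulr_ge0 ?powR_ge0 // ltW.
by apply: (le_trans h2); rewrite -mulrA ler_pM2l // powR_norm_le_pi.
Qed.

Lemma g_measurable : measurable_fun (@Ipi R) (g_ alpha).
Proof. by apply: measurable_funM => //; exact: fgn_unnorm_measurable. Qed.

Lemma g_even (t : R) : `|t| < pi -> g_ alpha (- t) = g_ alpha t.
Proof. by move=> tp; rewrite /g_ /f_H fgn_unnorm_even // ltW. Qed.

Lemma g_continuous (t : R) : `|t| < pi -> t != 0 -> {for t, continuous (g_ alpha)}.
Proof. by move=> tp t0; apply: cvgMl_tmp; exact: fgn_unnorm_continuous. Qed.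

Lemma g_integrable : integ (g_ alpha).
Proof.
have [C C0 hC] := g_upper; apply: integ_upper g_measurable hC.
by case/andP: halpha => _ h; rewrite mulrC -ltr_pdivlMr // gt_max h divr_gt0.
Qed.

End FGNWeight.

Theorem theorem2 (R : realType) (d : measure_display) (Om : measurableType d)
  (P : probability Om R) (alpha beta : R)
  (halpha : - (1/2) < alpha < 1/2) (hbeta : - (1/2) < beta < 1/2)
  (hab : Num.max (- alpha) 0 + Num.max beta 0 < 1/2)
  (xi : forall n : nat, Om -> 'cV[R]_n)
  (hxi : forall n : nat, centered_gaussian P (xi n) (toeplitz n (g_ beta))) :
  {ae P, forall w,
    (fun n : nat => n%:R^-1 *
        ((xi n w)^T *m invmx (toeplitz n (g_ alpha)) *m xi n w) ord0 ord0)
      @ \oo --> (2 * pi)^-1 *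
        Rintegral (@lebesgue_measure R) (@Ipi R) (fun t => g_ beta t / g_ alpha t)}.
Proof.
have [c c0 hc] := g_lower halpha.
have [C C0 hC] := g_upper hbeta.
have [C' _ hC'] := g_upper halpha.
apply: (toeplitz_ae_cvg (a := 2 * Num.max (- alpha) 0) (b := 2 * Num.max beta 0)
  (c := c) (C := C)) => //.
- by rewrite mulr_ge0 // le_max lexx orbT.
- by rewrite mulr_ge0 // le_max lexx orbT.
- by rewrite -mulrDr mulrC -ltr_pdivlMr.
- exact: g_integrable.
- by move=> t It; case/andP: (hC' t It).
- exact: g_even.
- exact: g_continuous.
- exact: g_measurable.
Qed.
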